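(* Let $f\in\mathcal{P}^d$. Then the Fourier--Laplace transform $\widehat f$ is identically zero if and only if, for every oriented hyperplane $h$ in $\mathbf{R}^d$, the ($(d-1)$-dimensional) Fourier--Laplace transform $\widehat{f_h}$ of the signed section $f_h$ is identically zero.
   Context: $[S]$ denotes the indicator function of a set $S\subset\mathbf{R}^d$. A convex polyhedron is the intersection of finitely many closed half-spaces of $\mathbf{R}^d$; a generalized polyhedron is a finite union of convex polyhedra. $\mathcal{P}^d$ is the algebra of finite real linear combinations of indicator functions of convex polyhedra in $\mathbf{R}^d$, where functions that differ only on a set of measure zero are identified. Signed section: an oriented hyperplane $h$ is a hyperplane with a chosen unit normal vector $\mathbf{n}_h$. For $f\in\mathcal{P}^d$ and almost all $\mathbf{x}\in h$, put $f_h^{+}(\mathbf{x})=\lim_{\varepsilon\to0+}f(\mathbf{x}+\varepsilon\mathbf{n}_h)$, $f_h^{-}(\mathbf{x})=\lim_{\varepsilon\to0+}f(\mathbf{x}-\varepsilon\mathbf{n}_h)$ (computed from a representation of $f$ as a finite linear combination of indicators of full-dimensional convex polyhedra), and $f_h(\mathbf{x})=f_h^+(\mathbf{x})-f_h^-(\mathbf{x})$. Then $f_h$ is an element of $\mathcal{P}^{d-1}$ on $h\cong\mathbf{R}^{d-1}$ (isometric identification). A cone with apex $\mathbf{p}$ is a generalized polyhedron $C$ such that $\mathbf{p}+t(\mathbf{x}-\mathbf{p})\in C$ for all $\mathbf{x}\in C$, $t\ge 0$. A line-cone is a cone that is a union of parallel lines. Fourier--Laplace transform: $f\mapsto\widehat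 f$ is the (known to exist, unique) linear map from $\mathcal{P}^d$ to meromorphic functions on $\mathbf{C}^d$ such that: (i) for a simplicial cone $K=\{\sum_j t_j\mathbf{w}_j:t_j\ge0\}$ ($\mathbf{w}_1,\dots,\mathbf{w}_d$ linearly independent), $\widehat{[K]}$ is the meromorphic continuation of $\int_K e^{\langle\mathbf{z},\mathbf{x}\rangle}d\mathbf{x}$ from the region where $-\Re\mathbf{z}$ is in the interior of the dual cone $\{\mathbf{y}:\langle\mathbf{x},\mathbf{y}\rangle\ge0\ \forall\mathbf{x}\in K\}$; (ii) $\widehat{[K+\mathbf{v}]}(\mathbf{z})=e^{\langle\mathbf{z},\mathbf{v}\rangle}\widehat{[K]}(\mathbf{z})$ for such $K$ and all $\mathbf{v}\in\mathbf{R}^d$; (iii) $\widehat{[D]}=0$ for every line-cone $D$. On $\mathcal{P}^0=\mathbf{R}$ (relevant when $d=1$) the transform is the identity. Vanishing of $\widehat{f_h}$ does not depend on the identification $h\cong\mathbf{R}^{d-1}$. *)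

(* Defs.v *)
From HB Require Import structures.
From mathcomp Require Import all_boot all_order all_algebra.
From mathcomp Require Import complex.
From mathcomp Require Import all_classical all_reals all_analysis.
Set Implicit Arguments. Unset Strict Implicit. Unset Printing Implicit Defensive.
Import Order.TTheory GRing.Theory Num.Theory numFieldNormedType.Exports.
Local Open Scope classical_set_scope.
Local Open Scope ring_scope.
Local Open Scope complex_scope.

(* The library has no Lebesgue measure on R^n: it is built on n.-tuple R, as the
   Dirac mass on the one-point space for n = 0 and as the image of
   lebesgue_measure \x (Lebesgue measure on R^n) under consing for n.+1. *)
Section lebesgue_tuple.
Variable R : realType.
Local Notation RT := (measurableTypeR R).

Definition tuple_cons n (p : RT * n.-tuple RT) : n.+1.-tuple RT :=
  [tuple of p.1 :: p.2].

Definition tuple_uncons n (t : n.+1.-tuple RT) : RT * n.-tuple RT :=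
  (thead t, [tuple of behead t]).

Lemma measurable_tuple_cons n : measurable_fun [set: _] (@tuple_cons n).
Proof. exact: measurable_cons. Qed.

Lemma measurable_tuple_uncons n : measurable_fun [set: _] (@tuple_uncons n).
Proof.
apply/measurable_fun_pairP; split.
  exact: measurable_tnth.
exact: measurable_behead.
Qed.

Lemma tuple_consK n : cancel (@tuple_cons n) (@tuple_uncons n).
Proof.
by case=> x t; rewrite /tuple_uncons theadE; congr pair; exact/val_inj.
Qed.

Section step.
Variables (n : nat) (m : {sigma_finite_measure set (n.-tuple RT) -> \bar R}).

Let prodm := (@lebesgue_measure R \x m)%E.

Definition lebesgue_step : set (n.+1.-tuple RT) -> \bar R :=
  pushforward prodm (@tuple_cons n).

HB.instance Definition _ := Measure.copy lebesgue_step
  (measure_function_pushforward__canonical__measure_function_Measure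
     prodm (@measurable_tuple_cons n)).

Lemma lebesgue_step_sigma_finite : sigma_finite setT lebesgue_step.
Proof.
have /sigma_finiteP[F [TF ndF Foo]] := sigma_finiteT (@lebesgue_measure R).
have /sigma_finiteP[G [TG ndG Goo]] := sigma_finiteT m.
exists (fun k => @tuple_uncons n @^-1` (F k `*` G k)).
  rewrite -preimage_bigcup (_ : \bigcup_k _ = setT) ?preimage_setT//.
  apply/seteqP; split=> // -[x y] _.
  have [i _ Fx] : (\bigcup_k F k) x by rewrite -TF.
  have [j _ Gy] : (\bigcup_k G k) y by rewrite -TG.
  exists (maxn i j) => //; split => /=.
    by move: x Fx; exact/subsetPset/ndF/leq_maxl.
  by move: y Gy; exact/subsetPset/ndG/leq_maxr.
move=> k; have [mF Fk] := Foo k; have [mG Gk] := Goo k; split.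
  rewrite -[X in measurable X]setTI; apply: measurable_tuple_uncons => //.
  exact: measurableX.
rewrite /lebesgue_step /pushforward -comp_preimage.
rewrite (_ : _ \o _ = id); last by apply/funext; exact: tuple_consK.
by rewrite preimage_id /prodm product_measure1E// lte_mul_pinfty// ge0_fin_numE.
Qed.

HB.instance Definition _ := Measure_isSigmaFinite.Build _ _ _ lebesgue_step
  lebesgue_step_sigma_finite.

End step.

Fixpoint lebesgue_tuple n : {sigma_finite_measure set (n.-tuple RT) -> \bar R} :=
  if n is k.+1 then lebesgue_step (lebesgue_tuple k)
  else \d_([tuple] : 0.-tuple RT).

End lebesgue_tuple.

Section euclidean.
Variables (R : realType) (n : nat).
Implicit Types (x y : 'rV[R]_n) (A : set 'rV[R]_n).

(* The library norm on 'rV[R]_n is the max norm. *)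
Definition dotp x y : R := \sum_(i < n) x ord0 i * y ord0 i.

Definition enorm x : R := Num.sqrt (dotp x x).

Definition row_of_tuple (t : n.-tuple (measurableTypeR R)) : 'rV[R]_n :=
  \row_i tnth t i.

Definition ae_equal (T : Type) (f g : 'rV[R]_n -> T) : Prop :=
  {ae @lebesgue_tuple R n, forall t, f (row_of_tuple t) = g (row_of_tuple t)}.

Definition closed_halfspace A : Prop :=
  exists (a : 'rV[R]_n) (b : R), a != 0 /\ A = [set x | dotp a x <= b].

Definition convex_polyhedron A : Prop :=
  exists (m : nat) (H : 'I_m -> set 'rV[R]_n),
    (forall i, closed_halfspace (H i)) /\ A = \bigcap_(i in [set: 'I_m]) H i.

Definition generalized_polyhedron A : Prop :=
  exists (m : nat) (P : 'I_m -> set 'rV[R]_n),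
    (forall i, convex_polyhedron (P i)) /\ A = \bigcup_(i in [set: 'I_m]) P i.

Definition indicator_comb (Q : set 'rV[R]_n -> Prop) (f : 'rV[R]_n -> R) : Prop :=
  exists (m : nat) (c : 'I_m -> R) (P : 'I_m -> set 'rV[R]_n),
    (forall i, Q (P i)) /\ f = (fun x => \sum_(i < m) c i * \1_(P i) x).

(* The elements of the algebra P^n are classes of functions modulo ae_equal;
   a class is handled through any of its members. *)
Definition polyhedral_function (f : 'rV[R]_n -> R) : Prop :=
  exists g, indicator_comb convex_polyhedron g /\ ae_equal f g.

Definition fulldim_polyhedron A : Prop := convex_polyhedron A /\ A° !=set0.

(* Some representative of the class of f that is a combination of indicators of
   full-dimensional polyhedra; 0 if there is none, i.e. if f is not in P^n. *)
Definition fulldim_representative (f : 'rV[R]_n -> R) : 'rV[R]_n -> R :=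
  xget (fun=> 0) [set g | indicator_comb fulldim_polyhedron g /\ ae_equal f g].

Definition cone_with_apex (p : 'rV[R]_n) A : Prop :=
  generalized_polyhedron A /\
  forall x t, A x -> 0 <= t -> A (p + t *: (x - p)).

Definition line_cone A : Prop :=
  (exists p, cone_with_apex p A) /\
  exists u : 'rV[R]_n, u != 0 /\ forall x t, A x -> A (x + t *: u).

(* The generators are the rows of W. *)
Definition simplicial_cone (W : 'M[R]_n) : set 'rV[R]_n :=
  [set x | exists t : 'I_n -> R,
    (forall j, 0 <= t j) /\ x = \sum_(j < n) t j *: row j W].

Definition translate (v : 'rV[R]_n) A : set 'rV[R]_n := [set x + v | x in A].

Definition dual_cone A : set 'rV[R]_n :=
  [set y | forall x, A x -> 0 <= dotp x y].

End euclidean.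

Section signed_section.
Variables (R : realType) (n : nat).

Record oriented_hyperplane := OrientedHyperplane {
  normal : 'rV[R]_n;
  offset : R;
  normal_unit : enorm normal = 1 }.

Definition hyperplane_set (h : oriented_hyperplane) : set 'rV[R]_n :=
  [set x | dotp (normal h) x = offset h].

Definition one_sided_limit (f : 'rV[R]_n -> R) (x u : 'rV[R]_n) : R :=
  lim (fulldim_representative f (x + e *: u) @[e --> 0^'+]).

Definition signed_section_at (f : 'rV[R]_n -> R) (h : oriented_hyperplane)
    (x : 'rV[R]_n) : R :=
  one_sided_limit f x (normal h) - one_sided_limit f x (- normal h).

End signed_section.

Definition isometric_identification (R : realType) (n : nat)
    (h : oriented_hyperplane R n.+1) (phi : 'rV[R]_n -> 'rV[R]_n.+1) : Prop :=
  (forall x y, enorm (phi x - phi y) = enorm (x - y)) /\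
  range phi = hyperplane_set h.

Definition signed_section (R : realType) (n : nat) (f : 'rV[R]_n.+1 -> R)
    (h : oriented_hyperplane R n.+1) (phi : 'rV[R]_n -> 'rV[R]_n.+1) :
    'rV[R]_n -> R :=
  fun y => signed_section_at f h (phi y).

Section meromorphic.
Variables (R : realType) (n : nat).
(* R[i] carries its normed-module structure over itself as R[i]^o, so that
   differentiable below means complex differentiable. *)
Local Notation C := (R[i]^o).
Implicit Types (F G : 'rV[C]_n -> C) (U : set 'rV[C]_n).

Definition holomorphic_on U F : Prop :=
  open U /\ forall z, U z -> differentiable F z.

(* A meromorphic function is given by a total function that is locally a
   quotient of holomorphic functions wherever the denominator, which vanishes
   identically on no nonempty open set, is nonzero.  The values elsewhere are
   irrelevant: two meromorphic functions are the same when they agree outside a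
   nowhere dense set. *)
Definition meromorphic F : Prop :=
  forall p, exists U g h,
    [/\ U p, holomorphic_on U g, holomorphic_on U h,
        [set z | U z /\ h z = 0]° = set0 &
        forall z, U z -> h z != 0 -> F z = g z / h z].

Definition nowhere_dense U : Prop := (closure U)° = set0.

Definition mero_eq_on U F G : Prop := nowhere_dense [set z | U z /\ F z <> G z].

Definition mero_eq F G : Prop := mero_eq_on [set: 'rV[C]_n] F G.

Definition mero_zero F : Prop := mero_eq F (fun=> 0).

End meromorphic.

Section Fourier_Laplace.
Variable R : realType.
Local Notation C := (R[i]^o).

Definition cexp (z : C) : C :=
  (expR (complex.Re z) * cos (complex.Im z)) +i*
  (expR (complex.Re z) * sin (complex.Im z)).

Definition cdotp n (z : 'rV[C]_n) (x : 'rV[R]_n) : C :=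
  \sum_(i < n) z ord0 i * (x ord0 i)%:C.

Definition re_row n (z : 'rV[C]_n) : 'rV[R]_n := \row_i complex.Re (z ord0 i).

Definition cintegral n (A : set 'rV[R]_n) (f : 'rV[R]_n -> C) : C :=
  (\int[@lebesgue_tuple R n]_(t in @row_of_tuple R n @^-1` A)
     complex.Re (f (row_of_tuple t))) +i*
  (\int[@lebesgue_tuple R n]_(t in @row_of_tuple R n @^-1` A)
     complex.Im (f (row_of_tuple t))).

Definition convergence_region n (W : 'M[R]_n) : set 'rV[C]_n :=
  [set z | (dual_cone (simplicial_cone W))° (- re_row z)].

(* T induces a linear map from P^n to meromorphic functions with the
   characterizing properties of the transform.  FL_simplicial_cone says that the
   meromorphic function T [K] continues the Laplace integral over K, which
   converges on convergence_region. *)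
Record is_Fourier_Laplace_pos n (T : ('rV[R]_n -> R) -> ('rV[C]_n -> C)) : Prop := {
  FL_meromorphic : forall f, polyhedral_function f -> meromorphic (T f);
  FL_ae : forall f g, polyhedral_function f -> polyhedral_function g ->
    ae_equal f g -> mero_eq (T f) (T g);
  FL_linear : forall (a : R) f g,
    polyhedral_function f -> polyhedral_function g ->
    mero_eq (T (fun x => a * f x + g x)) (fun z => a%:C * T f z + T g z);
  FL_simplicial_cone : forall W : 'M[R]_n, row_free W ->
    mero_eq_on (convergence_region W) (T (\1_(simplicial_cone W)))
      (fun z => cintegral (simplicial_cone W) (fun x => cexp (cdotp z x)));
  FL_translate : forall (W : 'M[R]_n) (v : 'rV[R]_n), row_free W ->
    mero_eq (T (\1_(translate v (simplicial_cone W))))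
      (fun z => cexp (cdotp z v) * T (\1_(simplicial_cone W)) z);
  FL_line_cone : forall D, line_cone D -> mero_zero (T (\1_D)) }.

(* On functions on the one-point space R^0 the transform is the identity. *)
Definition is_Fourier_Laplace n : (('rV[R]_n -> R) -> ('rV[C]_n -> C)) -> Prop :=
  if n is 0%N then fun T => forall f, T f = (fun=> (f 0)%:C)
  else fun T => is_Fourier_Laplace_pos T.

End Fourier_Laplace.

(* Main.v *)
(* The distributional gradient of f is carried by its facets: its component along v is
   the sum over hyperplanes h of <v, n_h> f_h delta_h.  On the Fourier side this reads
     - <z, v> f^(z) = sum_h <v, n_h> F_h(z),
   where F_h is the transform of f_h, pulled back along the projection onto h and
   multiplied by the exponential of offset(h) <z, n_h>.  Vanishing of every F_h gives
   f^ = 0.  Conversely let f^ = 0, take v = n, and move z in the direction i s n with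
   s -> +oo.  The term of a hyperplane whose normal is not parallel to n is a combination of
   exponentials of constant modulus times inverses of linear forms, one of which grows,
   so it tends to 0; what remains is a finite sum of exp(i s c) F_{n,c}(z) over the
   hyperplanes {<n, x> = c}, which tends to 0 only if every F_{n,c}(z) is 0.

   The identity is checked on the generators of P^d: modulo null sets every polyhedral
   function is a combination of wedges {x | A x >= b} with A of independent rows, which
   are line-cones or translated simplicial cones. *)

Require Import Defs.
From mathcomp Require Import all_boot all_order all_algebra.
From mathcomp Require Import complex.
From mathcomp Require Import all_classical all_reals all_analysis.
From mathcomp Require Import measurable_realfun ring lra.
Set Implicit Arguments. Unset Strict Implicit. Unset Printing Implicit Defensive.
Import Order.TTheory GRing.Theory Num.Theory numFieldNormedType.Exports.
Local Open Scope classical_set_scope.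
Local Open Scope ring_scope.
Local Open Scope complex_scope.
Import ComplexField.Normc.

(** * Change of variables and null sets for lebesgue_tuple *)

Section affine_change.
Variable R : realType.
Local Notation mu := (@lebesgue_measure R).
Local Notation RT := (measurableTypeR R).

(** [FL k f] is determined only off a nowhere dense set, so it has no values that could be followed
    along a ray. The argument therefore works with the explicit sums [comb_transform], evaluated at
    points z with [Re <z, w> != 0] for every dual vector w of the wedges involved. These points form
    an open dense set on which the sums are continuous, so vanishing off a nowhere dense set becomes
    vanishing at each of them. Conditions on real parts, rather than [<z, w> != 0], make the set
    invariant under imaginary translations: the ray z + i t n stays in it, and the reciprocals that
    do not decay along the ray remain bounded. A second difficulty is that several wedges, with
    proportional normals of either sign, can have facets in one hyperplane. Facet contributions are
    therefore indexed by pairs (wedge, row) and written in the variables of the ambient space;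
    hyperplanes appear only as groups of such pairs, and the isometry [phi h] enters only when a
    group is compared with the transform of the signed section. *)

Lemma measurable_affine (a c : R) :
  measurable_fun [set: RT] (fun x : RT => a * x + c : RT).
Proof. by apply: measurable_funD => //; apply: measurable_funM. Qed.

(** By uniqueness of Lebesgue measure: [|a|] times the image measure gives every interval its
    length. For a < 0 the preimage of ]x, y] is half-open on the other side, which does not affect
    the length. *)
Lemma lebesgue_measure_affine (a c : R) (A : set RT) : a != 0 -> measurable A ->
  (mu ((fun x : RT => (a * x + c)%R) @^-1` A) = `|a|^-1%:E * mu A)%E.
Proof.
move=> a0 mA.
have na0 : 0 < `|a| by rewrite normr_gt0.
pose nu := measure_function_pushforward__canonical__measure_function_Measure
     mu (@measurable_affine a c).
suff -> : mu A = mscale (NngNum (ltW na0)) nu A.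
  by rewrite /mscale/= /pushforward muleA -EFinM mulVf ?gt_eqF// mul1e.
apply: lebesgue_measure_unique => //= _ [[x y]] _ <-.
rewrite /mscale/= /pushforward.
have [a_gt0|a_le0] := ltP 0 a.
  have -> : (fun x0 : RT => (a * x0 + c)%R) @^-1` `]x, y]%classic =
     `](x - c) / a, (y - c) / a]%classic.
    apply/seteqP; split => t /=; rewrite !in_itv/= ltr_pdivrMr// ler_pdivlMr//;
    by rewrite ltrBlDr lerBrDr mulrC.
  rewrite !lebesgue_measure_itv/= !lte_fin.
  rewrite ltr_pM2r ?invr_gt0// ltrD2r; case: ifPn; last by rewrite mule0.
  by move=> xy; rewrite -!EFinD -EFinM gtr0_norm//; congr EFin; field.
have {}a_le0 : a < 0 by rewrite lt_neqAle a0.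
have -> : (fun x0 : RT => (a * x0 + c)%R) @^-1` `]x, y]%classic =
     `[(y - c) / a, (x - c) / a[%classic.
  apply/seteqP; split => t /=; rewrite !in_itv/= ltr_ndivlMr// ler_ndivrMr//;
  by rewrite ltrBlDr lerBrDr mulrC andbC.
rewrite !lebesgue_measure_itv/= !lte_fin.
rewrite ltr_nM2r ?invr_lt0// ltrD2r; case: ifPn; last by rewrite mule0.
by move=> xy; rewrite -!EFinD -EFinM ltr0_norm//; congr EFin; field.
Qed.

Lemma integral_affine (a c : R) (f : RT -> \bar R) : a != 0 ->
  measurable_fun setT f -> (forall t, 0 <= f t)%E ->
  (\int[mu]_x f (a * x + c)%R = `|a|^-1%:E * \int[mu]_x f x)%E.
Proof.
move=> a0 mf f0.
have na0 : 0 <= `|a|^-1 by rewrite invr_ge0.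
pose nu := measure_function_pushforward__canonical__measure_function_Measure
     mu (@measurable_affine a c).
transitivity (\int[nu]_y f y)%E.
  rewrite ge0_integral_pushforward//; exact: measurable_affine.
rewrite -(@ge0_integral_mscale _ _ _ mu setT measurableT (NngNum na0))//.
apply: eq_measure_integral => A mA _.
exact: (lebesgue_measure_affine c a0 mA).
Qed.

Lemma integral_lebesgue_tupleS n (f : n.+1.-tuple RT -> \bar R) :
  measurable_fun setT f -> (forall t, 0 <= f t)%E ->
  (\int[lebesgue_tuple R n.+1]_t f t =
   \int[mu]_x \int[lebesgue_tuple R n]_t f (tuple_cons (x, t)))%E.
Proof.
move=> mf f0.
transitivity (\int[pushforward (mu \x lebesgue_tuple R n)%E (@tuple_cons R n)]_t f t)%E.
  by [].
rewrite (ge0_integral_pushforward (@measurable_tuple_cons R n))//.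
rewrite preimage_setT fubini_tonelli1//.
  by apply: measurableT_comp => //; exact: measurable_tuple_cons.
by move=> x; exact: f0.
Qed.

Lemma integral_lebesgue_tupleS_swap n (f : n.+1.-tuple RT -> \bar R) :
  measurable_fun setT f -> (forall t, 0 <= f t)%E ->
  (\int[lebesgue_tuple R n.+1]_t f t =
   \int[lebesgue_tuple R n]_t \int[mu]_x f (tuple_cons (x, t)))%E.
Proof.
move=> mf f0; rewrite integral_lebesgue_tupleS// (fubini_tonelli (f \o @tuple_cons R n))//.
  by apply: measurableT_comp => //; exact: measurable_tuple_cons.
by move=> x; exact: f0.
Qed.
End affine_change.

Section linear_change.
Variable R : realType.
Local Notation mu := (@lebesgue_measure R).
Local Notation RT := (measurableTypeR R).

Definition tuple_of_row n (x : 'rV[R]_n) : n.-tuple RT := [tuple x ord0 i | i < n].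

Lemma row_of_tupleK n : cancel (@row_of_tuple R n) (@tuple_of_row n).
Proof. by move=> t; apply: eq_from_tnth => i; rewrite tnth_mktuple mxE. Qed.

Lemma tuple_of_rowK n : cancel (@tuple_of_row n) (@row_of_tuple R n).
Proof. by move=> x; apply/rowP => i; rewrite mxE tnth_mktuple. Qed.

Lemma row_of_tuple_cons n (x : R) (t : n.-tuple RT) :
  row_of_tuple (tuple_cons (x, t)) = row_mx x%:M (row_of_tuple t) :> 'rV_(1 + n).
Proof.
apply/rowP => i; rewrite !mxE; case: splitP => j ij.
  by rewrite !mxE ord1 eqxx mulr1n (_ : i = ord0)//; apply/val_inj; rewrite /= ij ord1.
rewrite mxE (_ : i = lift ord0 j) ?tnthS; last exact/val_inj.
by congr tnth; apply/val_inj.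
Qed.

Lemma tuple_of_row_mx n (x : R) (v : 'rV[R]_n) :
  tuple_of_row (row_mx x%:M v : 'rV_(1 + n)) = tuple_cons (x, tuple_of_row v).
Proof.
by rewrite -[RHS]row_of_tupleK row_of_tuple_cons tuple_of_rowK.
Qed.

Lemma measurable_tuple_cons2 n (x : RT) :
  measurable_fun [set: n.-tuple RT] (fun t => tuple_cons (x, t)).
Proof. exact: (@measurable_cons _ _ _ _ (fun=> x) n id). Qed.

Lemma measurable_tuple_cons1 n (t : n.-tuple RT) :
  measurable_fun [set: RT] (fun x => tuple_cons (x, t)).
Proof. exact: (@measurable_cons _ _ _ _ id n (fun=> t)). Qed.

Lemma measurable_coord n (i : 'I_n) :
  measurable_fun [set: n.-tuple RT] (fun t => row_of_tuple t ord0 i : RT).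
Proof.
under eq_fun do rewrite mxE; exact: measurable_tnth.
Qed.

Lemma measurable_affine_tuple m n (M : 'M[R]_(m, n)) (v : 'rV[R]_n) :
  measurable_fun [set: m.-tuple RT]
    (fun t => tuple_of_row (row_of_tuple t *m M + v)).
Proof.
apply/measurable_fun_tnthP => i /=.
rewrite (_ : _ \o _ = fun t => \sum_j row_of_tuple t ord0 j * M j i + v ord0 i); last first.
  by apply/funext => t /=; rewrite tnth_mktuple !mxE.
apply: measurable_funD => //; apply: measurable_sum => j.
by apply: measurable_funM => //; exact: measurable_coord.
Qed.

Local Open Scope ereal_scope.

Lemma integral_translate n (v : 'rV[R]_n) (f : n.-tuple RT -> \bar R) :
  measurable_fun setT f -> (forall t, 0 <= f t) ->
  \int[lebesgue_tuple R n]_t f (tuple_of_row (row_of_tuple t + v)) =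
  \int[lebesgue_tuple R n]_t f t.
Proof.
elim: n => [|n IH] in v f *.
  move=> mf f0; apply: eq_integral => t _; congr f.
  by rewrite tuple0 [RHS]tuple0.
move=> mf f0.
have mt : measurable_fun [set: n.+1.-tuple RT] (fun t => tuple_of_row (row_of_tuple t + v)).
  by have := measurable_affine_tuple 1%:M v; under eq_fun do rewrite mulmx1.
rewrite !integral_lebesgue_tupleS//; last exact: measurableT_comp.
pose F (x : RT) := \int[lebesgue_tuple R n]_t f (tuple_cons (x, t)).
have mF : measurable_fun setT F.
  apply: (@measurable_fun_fubini_tonelli_F _ _ _ _ _ _ (f \o @tuple_cons R n)).
    by apply: measurableT_comp => //; exact: measurable_tuple_cons.
  by move=> x; exact: f0.
transitivity (\int[mu]_x F (1 * x + v ord0 ord0)%R); last first.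
  rewrite (integral_affine (v ord0 ord0) (oner_neq0 R) mF).
    by rewrite normr1 invr1 mul1e.
  by move=> x; exact: integral_ge0.
apply: eq_integral => x _; rewrite /F.
rewrite -[RHS](IH (\row_i v ord0 (lift ord0 i))%R)//; last first.
  exact: (measurableT_comp mf (@measurable_tuple_cons2 n _)).
apply: eq_integral => t _; congr f.
rewrite -tuple_of_row_mx row_of_tuple_cons; congr tuple_of_row.
apply/rowP => i; rewrite !mxE; case: splitP => j ij; rewrite !mxE ?ord1 ?eqxx ?mulr1n.
  by rewrite mul1r; congr (_ + v _ _)%R; apply/val_inj; rewrite /= ij ord1.
by congr (_ + v _ _)%R; apply/val_inj.
Qed.

(** Change of variables as a property of M, so that it can be propagated through matrix products.
    With nonnegative integrands Tonelli applies without integrability conditions. *)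
Definition rescales n (M : 'M[R]_n) := forall f : n.-tuple RT -> \bar R,
  measurable_fun setT f -> (forall t, 0 <= f t) ->
  \int[lebesgue_tuple R n]_t f (tuple_of_row (row_of_tuple t *m M)) =
  (`|\det M|^-1)%:E * \int[lebesgue_tuple R n]_t f t.

Lemma measurable_mul_tuple m n (M : 'M[R]_(m, n)) :
  measurable_fun [set: m.-tuple RT] (fun t => tuple_of_row (row_of_tuple t *m M)).
Proof. by have := measurable_affine_tuple M 0%R; under eq_fun do rewrite addr0. Qed.

Lemma rescalesM n (M N : 'M[R]_n) : rescales M -> rescales N -> rescales (M *m N).
Proof.
move=> gM gN f mf f0.
have := gM (fun t => f (tuple_of_row (row_of_tuple t *m N))).
under eq_integral do rewrite tuple_of_rowK -mulmxA.
move=> ->//; last by apply: measurableT_comp => //; exact: measurable_mul_tuple.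
by rewrite gN// muleA -EFinM det_mulmx normrM invfM.
Qed.

(** The map is (x, t) -> (x + t c, t): with t held fixed the inner integral over x is merely
    translated, hence the swapped order of integration. *)
Lemma rescales_shear n (c : 'cV[R]_n) : rescales (block_mx 1%:M 0 c 1%:M : 'M[R]_(1 + n)).
Proof.
move=> f mf f0; rewrite det_lblock !det1 mulr1 normr1 invr1 mul1e.
rewrite !integral_lebesgue_tupleS_swap//; last first.
  by apply: measurableT_comp => //; exact: measurable_mul_tuple.
apply: eq_integral => t _.
pose F x := f (tuple_cons (x, t)).
transitivity (\int[mu]_x F (1 * x + (row_of_tuple t *m c) ord0 ord0)%R); last first.
  rewrite (@integral_affine _ 1%R _ F) ?oner_neq0//.
  - by rewrite normr1 invr1 mul1e.
  - exact: (measurableT_comp mf (@measurable_tuple_cons1 n t)).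
  - by move=> x; exact: f0.
apply: eq_integral => x _; rewrite /F; congr f.
rewrite -[in RHS](row_of_tupleK t) -tuple_of_row_mx; congr tuple_of_row.
rewrite row_of_tuple_cons mul_row_block !mulmx1 mulmx0 add0r mul1r; congr row_mx.
by rewrite row_of_tupleK [in LHS](mx11_scalar (_ *m _)) -raddfD.
Qed.

(** The map is (x, t) -> (a x, t U + x b): for fixed x the inner integral is a change of variables
    by U followed by a translation, and the outer one is scaled by a. *)
Lemma rescales_upper n (a : R) (b : 'rV[R]_n) (U : 'M[R]_n) :
  a != 0%R -> rescales U -> rescales (block_mx a%:M b 0 U : 'M[R]_(1 + n)).
Proof.
move=> a0 gU f mf f0; rewrite det_ublock det_scalar1 normrM invfM EFinM -muleA.
rewrite !integral_lebesgue_tupleS//; last first.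
  by apply: measurableT_comp => //; exact: measurable_mul_tuple.
pose F (x : RT) := \int[lebesgue_tuple R n]_t f (tuple_cons (x, t)).
have F0 x : 0 <= F x by exact: integral_ge0.
have mF : measurable_fun setT F.
  apply: (@measurable_fun_fubini_tonelli_F _ _ _ _ _ _ (f \o @tuple_cons R n)).
    by apply: measurableT_comp => //; exact: measurable_tuple_cons.
  by move=> x; exact: f0.
transitivity (\int[mu]_x ((`|\det U|^-1)%:E * F (a * x + 0)%R)); last first.
  rewrite ge0_integralZl//.
  - by rewrite (integral_affine 0 a0 mF)// muleCA.
  - apply: measurableT_comp => //; exact: measurable_affine.
apply: eq_integral => x _; rewrite addr0 /F.
pose g t := f (tuple_cons ((a * x)%R, tuple_of_row (row_of_tuple t + x *: b))).
transitivity (\int[lebesgue_tuple R n]_t g (tuple_of_row (row_of_tuple t *m U))).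
  apply: eq_integral => t _; congr f.
  rewrite -tuple_of_row_mx; congr tuple_of_row.
  rewrite row_of_tuple_cons mul_row_block mulmx0 addr0 tuple_of_rowK; congr row_mx.
    by rewrite -scalar_mxM mulrC.
  by rewrite mul_scalar_mx addrC.
rewrite gU.
- congr (_ * _).
  rewrite (@integral_translate _ (x *: b)%R (fun t => f (tuple_cons ((a * x)%R, t))))//.
    exact: (measurableT_comp mf (@measurable_tuple_cons2 n _)).
- apply: (@measurableT_comp _ _ _ _ _ _ (fun t => f (tuple_cons ((a * x)%R, t)))).
    exact: (measurableT_comp mf (@measurable_tuple_cons2 n _)).
  by have := measurable_affine_tuple 1%:M (x *: b)%R; under eq_fun do rewrite mulmx1.
- by move=> t; exact: f0.
Qed.

(** Gaussian elimination with induction on the Schur complement: a matrix with nonzero upper left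
    entry is a shear times a block upper triangular matrix. *)
Lemma unitmx_rescales n (M : 'M[R]_n) : M \in unitmx -> rescales M.
Proof.
elim: n => [|n IH] in M *.
  move=> _ f mf f0; rewrite det_mx00 normr1 invr1 mul1e.
  by apply: eq_integral => t _; congr f; rewrite tuple0 [RHS]tuple0.
have pivot (N : 'M[R]_(1 + n)) : N \in unitmx -> ulsubmx N ord0 ord0 != 0%R -> rescales N.
  move=> uN; set a := ulsubmx N ord0 ord0 => a0.
  set r := ursubmx N; set c := dlsubmx N; set D := drsubmx N.
  have NE : N = block_mx 1%:M 0 (a^-1 *: c) 1%:M *m block_mx a%:M r 0 (D - a^-1 *: (c *m r))%R.
    rewrite mulmx_block !mul1mx !mul0mx !addr0 -[LHS]submxK; congr block_mx.
    - by rewrite [LHS]mx11_scalar.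
    - by rewrite mul_mx_scalar scalerA divff// scale1r.
    - by rewrite -scalemxAl addrC subrK.
  rewrite NE; apply: rescalesM; first exact: rescales_shear.
  apply: rescales_upper => //; apply: IH.
  move: uN; rewrite NE unitmx_mul => /andP[_]; rewrite !unitmxE det_ublock unitrM.
  by case/andP.
move=> uM.
have [M00|] := eqVneq (ulsubmx (M : 'M[R]_(1 + n)) ord0 ord0) 0%R; last exact: pivot.
have [i Mi] : exists i, dlsubmx (M : 'M[R]_(1 + n)) i ord0 != 0%R.
  apply: contrapT => /forallNP M0.
  move: uM; rewrite unitmxE unitfE -det_tr (expand_det_row _ ord0) big1 ?eqxx// => j _.
  rewrite mxE; move: M00; rewrite 2!mxE lshift0 => M00.
  case: (unliftP ord0 j) => [k ->|->]; last by rewrite M00 mul0r.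
  have /negP := M0 k; rewrite negbK 2!mxE lshift0 => /eqP.
  by rewrite (_ : rshift 1 k = lift ord0 k) => [->|]; [rewrite mul0r|exact/val_inj].
(* Left multiplication by [S 1] adds row i of the lower block to the first row, which makes the
   pivot nonzero; [S (-1)] undoes this, and both are block upper triangular. *)
pose S (s : R) : 'M[R]_(1 + n) := block_mx 1%:M (s *: delta_mx ord0 i) 0 1%:M.
have ME : M = S (-1)%R *m (S 1%R *m (M : 'M[R]_(1 + n))).
  rewrite mulmxA mulmx_block ?mul1mx ?mulmx1 ?mul0mx ?mulmx0 ?addr0 ?add0r.
  by rewrite -scalerDl subrr scale0r -scalar_mx_block mul1mx.
have gS s : rescales (S s).
  apply: rescales_upper; first exact: oner_neq0.
  move=> f mf f0; rewrite det1 normr1 invr1 mul1e; apply: eq_integral => t _.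
  by rewrite mulmx1 row_of_tupleK.
rewrite ME; apply: rescalesM; first exact: gS.
apply: pivot.
  move: uM; rewrite [in X in X -> _]ME !unitmx_mul => /andP[_ ]; apply.
rewrite -[X in _ *m X](@submxK _ 1 n 1 n) mulmx_block block_mxKul mul1mx scale1r mxE M00 add0r.
by rewrite -rowE mxE.
Qed.

End linear_change.

Section null_sets.
Variable R : realType.
Local Notation mu := (@lebesgue_measure R).
Local Notation RT := (measurableTypeR R).

Lemma measurable_dotp n (a : 'rV[R]_n) :
  measurable_fun [set: n.-tuple RT] (fun t => dotp a (row_of_tuple t) : RT).
Proof.
apply: measurable_sum => i; apply: measurable_funM => //; exact: measurable_coord.
Qed.

Lemma dotp_row_mx n (a x : R) (v w : 'rV[R]_n) :
  dotp (row_mx a%:M v : 'rV_(1 + n)) (row_mx x%:M w) = a * x + dotp v w.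
Proof.
rewrite /dotp big_split_ord /= big_ord1; congr (_ + _).
  by rewrite !(row_mxEl _ _ ord0) !mxE eqxx !mulr1n.
by apply: eq_bigr => i _; rewrite !row_mxEr.
Qed.

Lemma measurable_hyperplane n (a : 'rV[R]_n) (b : R) :
  measurable [set t : n.-tuple RT | dotp a (row_of_tuple t) = b].
Proof.
have := measurable_dotp a measurableT (measurable_set1 b).
by rewrite setTI; congr measurable.
Qed.

(** Slices along the first coordinate: if the tail of a is nonzero, every slice is a hyperplane one
    dimension lower; otherwise the first coefficient is nonzero and the slices in the other
    direction are single points. *)
Lemma hyperplane_null n (a : 'rV[R]_n) (b : R) : a != 0 ->
  lebesgue_tuple R n [set t | dotp a (row_of_tuple t) = b] = 0%E.
Proof.
elim: n => [|n IH] in a b *.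
  by move=> /eqP; rewrite thinmx0.
move=> a0; set H := [set t | _].
have mH : measurable H by exact: measurable_hyperplane.
have aE : a = row_mx (a ord0 ord0)%:M (rsubmx (a : 'rV_(1 + n))).
  rewrite -[LHS](@hsubmxK _ 1 1 n); congr (@row_mx R 1 1 n _ _).
  by rewrite [LHS]mx11_scalar mxE lshift0.
set a' := rsubmx _ in aE.
have HE x t : H (tuple_cons (x, t)) <-> a ord0 ord0 * x + dotp a' (row_of_tuple t) = b.
  by rewrite /H/= row_of_tuple_cons aE dotp_row_mx -aE.
have -> : (lebesgue_tuple R n.+1 H = \int[lebesgue_tuple R n.+1]_t (\1_H t)%:E)%E.
  by rewrite integral_indic// setIT.
have m1 : measurable_fun setT (fun t => (\1_H t : R)%:E).
  by apply/measurable_EFinP; exact: measurable_indic.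
have p1 t : (0 <= (\1_H t : R)%:E)%E by rewrite lee_fin.
have [a'0|a'0] := eqVneq a' 0; last first.
  rewrite integral_lebesgue_tupleS//; apply: integral0_eq => x _.
  pose G := [set t | dotp a' (row_of_tuple t) = b - a ord0 ord0 * x].
  transitivity (\int[lebesgue_tuple R n]_t (\1_G t : R)%:E)%E.
    apply: eq_integral => t _; congr EFin; rewrite !indicE; congr (nat_of_bool _)%:R.
    apply/idP/idP; rewrite !inE => /=.
      by rewrite /G/= => /HE <-; rewrite addrC addKr.
    by rewrite /G/= => gt; apply/HE; rewrite gt addrC subrK.
  rewrite integral_indic ?setIT; [exact: IH|by []|exact: measurable_hyperplane].
have a00 : a ord0 ord0 != 0.
  apply: contraNneq a0 => a00; rewrite aE a00 a'0 -scalemx1 scale0r.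
  by rewrite row_mx0.
rewrite integral_lebesgue_tupleS_swap//; apply: integral0_eq => t _.
pose c := (b - dotp a' (row_of_tuple t)) / a ord0 ord0.
transitivity (\int[mu]_x (\1_[set c] x : R)%:E)%E.
  apply: eq_integral => x _; congr EFin; rewrite !indicE; congr (nat_of_bool _)%:R.
  apply/idP/idP; rewrite !inE => /=.
    by move=> /HE tb; rewrite /c -tb addrK mulrC mulKf.
  by move=> xc; apply/HE; rewrite xc /c mulrC divfK// subrK.
rewrite integral_indic ?setIT; [exact: lebesgue_measure_set1|by []|exact: measurable_set1].
Qed.

Lemma ae_notin_hyperplane n (a : 'rV[R]_n) (b : R) : a != 0 ->
  {ae lebesgue_tuple R n, forall t, dotp a (row_of_tuple t) <> b}.
Proof.
move=> a0; exists [set t | dotp a (row_of_tuple t) = b]; split.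
- exact: measurable_hyperplane.
- exact: hyperplane_null.
- by move=> t /= /contrapT.
Qed.

Let box n (x : 'rV[R]_n) (r : R) : set (n.-tuple RT) :=
  [set t | forall i, ball (x ord0 i) r (row_of_tuple t ord0 i)].

Let measurable_box n (x : 'rV[R]_n) (r : R) : measurable (box x r).
Proof.
rewrite (_ : box x r = \bigcap_(i in [set: 'I_n])
   ((fun t => row_of_tuple t ord0 i : RT) @^-1` ball (x ord0 i) r)); last first.
  by apply/seteqP; split => t /= h i; [move=> _; exact: h|exact: h].
apply: fin_bigcap_measurable; first exact: finite_finset.
move=> i _; rewrite -[X in measurable X]setTI; apply: measurable_coord => //.
exact: measurable_ball.
Qed.

Let box_gt0 n (x : 'rV[R]_n) (r : R) : 0 < r ->
  (0 < lebesgue_tuple R n (box x r))%E.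
Proof.
move=> r0; elim: n => [|n IH] in x *.
  rewrite [X in lebesgue_tuple _ _ X](_ : _ = setT).
    by rewrite /= diracE in_setT lte_fin ltr01.
  by apply/seteqP; split => // t _ [].
pose y : 'rV[R]_n := \row_i x ord0 (lift ord0 i).
have -> : lebesgue_tuple R n.+1 (box x r) =
    (mu \x lebesgue_tuple R n)%E (ball (x ord0 ord0) r `*` box y r).
  rewrite [LHS]/= /lebesgue_step /pushforward; congr (_ _).
  apply/seteqP; split => [[u t]|[u t] [/= ux ty] i] /=.
    move=> h; split => [|i]/=; first by have := h ord0; rewrite mxE.
    have := h (lift ord0 i); rewrite !mxE tnthS/=.
    by congr (ball _ _ (tnth _ _)); exact/val_inj.
  rewrite mxE; case: (unliftP ord0 i) => [j ->|->//].
  have := ty j; rewrite !mxE tnthS/=.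
  by congr (ball _ _ (tnth _ _)); exact/val_inj.
rewrite product_measure1E; [|exact: measurable_ball|exact: measurable_box].
apply: mule_gt0; last exact: IH.
rewrite [ltRHS](lebesgue_measure_ball _ (ltW r0)).
by rewrite lte_fin mulrn_wgt0.
Qed.

(** Balls of the max norm are boxes of positive measure, so no null set contains a nonempty open
    set. This converts a.e. equality into equality at points of local constancy. *)
Lemma ae_open n (U : set 'rV[R]_n) (P : 'rV[R]_n -> Prop) :
  open U -> U !=set0 -> {ae lebesgue_tuple R n, forall t, P (row_of_tuple t)} ->
  exists2 x, U x & P x.
Proof.
move=> oU [x Ux] [N [mN N0 PN]].
have /nbhs_ballP[r /= r0 rU] : nbhs x U by exact: open_nbhs_nbhs.
apply: contrapT => nP.
have := box_gt0 x r0; rewrite ltNge => /negP; apply.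
rewrite -N0; apply: le_measure.
- by rewrite inE; exact: measurable_box.
- by rewrite inE.
move=> t bt; apply: PN => /= Pt.
apply: nP; exists (row_of_tuple t) => //; apply: rU; split => // i j.
by rewrite ord1; exact: bt.
Qed.

End null_sets.

(** * The Laplace integral of a simplicial cone *)

Section complex_integral.
Variable R : realType.
Local Notation C := (R[i]).

(** Integrability travels with the value: a product of two complex integrals expands into four real
    tensor products, each of which requires it. *)
Definition has_cint d (T : measurableType d) (m : {measure set T -> \bar R})
    (F : T -> C) (c : C) : Prop :=
  [/\ m.-integrable setT (fun x => (complex.Re (F x))%:E),
      m.-integrable setT (fun x => (complex.Im (F x))%:E),
      (\int[m]_x complex.Re (F x) = complex.Re c)%R &
      (\int[m]_x complex.Im (F x) = complex.Im c)%R].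

Lemma Re_cmul (x y : C) :
  complex.Re (x * y) = complex.Re x * complex.Re y - complex.Im x * complex.Im y.
Proof. by case: x y => [a b] [c d]. Qed.

Lemma Im_cmul (x y : C) :
  complex.Im (x * y) = complex.Re x * complex.Im y + complex.Im x * complex.Re y.
Proof. by case: x y => [a b] [c d]. Qed.

Section product.
Variables (d1 d2 : measure_display) (T1 : measurableType d1) (T2 : measurableType d2).
Variables (m1 : {sigma_finite_measure set T1 -> \bar R})
          (m2 : {sigma_finite_measure set T2 -> \bar R}).

Lemma measurable_tensor (f : T1 -> R) (g : T2 -> R) :
  measurable_fun setT f -> measurable_fun setT g ->
  measurable_fun setT (fun p : T1 * T2 => f p.1 * g p.2).
Proof. by move=> mf mg; apply: measurable_funM; apply: measurableT_comp. Qed.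

Lemma integrable_tensor (f : T1 -> R) (g : T2 -> R) :
  m1.-integrable setT (EFin \o f) -> m2.-integrable setT (EFin \o g) ->
  (m1 \x m2)%E.-integrable setT (fun p => (f p.1 * g p.2)%:E).
Proof.
move=> /integrableP[/measurable_EFinP mf fi] /integrableP[/measurable_EFinP mg gi].
apply/integrable12ltyP.
  by apply/measurable_EFinP; exact: measurable_tensor.
under eq_integral => x _.
  rewrite (eq_integral (fun y => `|(f x)%:E| * `|(g y)%:E|))%E; last first.
    by move=> y _; rewrite /= normrM.
  rewrite ge0_integralZl//=; last first.
    by apply/measurable_EFinP; exact: measurableT_comp.
  over.
rewrite ge0_integralZr//=; last 2 first.
- by apply/measurable_EFinP; exact: measurableT_comp.
- exact: integral_ge0.
by rewrite lte_mul_pinfty// ?integral_ge0// ge0_fin_numE ?integral_ge0.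
Qed.

Lemma Rintegral_tensor (f : T1 -> R) (g : T2 -> R) :
  m1.-integrable setT (EFin \o f) -> m2.-integrable setT (EFin \o g) ->
  \int[(m1 \x m2)%E]_p (f p.1 * g p.2) = \int[m1]_x f x * \int[m2]_y g y.
Proof.
move=> fi gi.
have gfin : (\int[m2]_y (g y)%:E)%E \is a fin_num by exact: integrable_fin_num.
have ffin : (\int[m1]_y (f y)%:E)%E \is a fin_num by exact: integrable_fin_num.
rewrite /Rintegral -(integral12_prod_meas1 (integrable_tensor fi gi)) -fineM//; congr fine.
rewrite -(fineK gfin) -integralZr//.
apply: eq_integral => x _; rewrite /fubini_F /= fineK// -integralZl//.
Qed.

Lemma has_cint_tensor (F : T1 -> C) (G : T2 -> C) (a b : C) :
  has_cint m1 F a -> has_cint m2 G b ->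
  has_cint (m1 \x m2)%E (fun p => F p.1 * G p.2) (a * b).
Proof.
move=> [Fr Fi Fra Fia] [Gr Gi Grb Gib].
have I1 := integrable_tensor Fr Gr; have I2 := integrable_tensor Fi Gi.
have I3 := integrable_tensor Fr Gi; have I4 := integrable_tensor Fi Gr.
split.
- under eq_fun do rewrite Re_cmul EFinB; exact: integrableB.
- under eq_fun do rewrite Im_cmul EFinD; exact: integrableD.
- under eq_Rintegral do rewrite Re_cmul.
  rewrite RintegralB//.
  by rewrite (Rintegral_tensor Fr Gr) (Rintegral_tensor Fi Gi) Re_cmul Fra Fia Grb Gib.
- under eq_Rintegral do rewrite Im_cmul.
  rewrite RintegralD//.
  by rewrite (Rintegral_tensor Fr Gi) (Rintegral_tensor Fi Gr) Im_cmul Fra Fia Grb Gib.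
Qed.
End product.

Local Notation mu := (@lebesgue_measure R).
Local Notation RT := (measurableTypeR R).

Lemma has_cint_tupleS n (F : RT -> C) (G : n.-tuple RT -> C) (a b : C) :
  has_cint mu F a -> has_cint (lebesgue_tuple R n) G b ->
  has_cint (lebesgue_tuple R n.+1)
    (fun t => F (tuple_uncons t).1 * G (tuple_uncons t).2) (a * b).
Proof.
move=> hF hG; have [I1 I2 I3 I4] := has_cint_tensor hF hG.
have E (h : R * n.-tuple RT -> R) : (mu \x lebesgue_tuple R n)%E.-integrable setT (EFin \o h) ->
    (lebesgue_tuple R n.+1).-integrable setT (EFin \o h \o @tuple_uncons R n) /\
    \int[lebesgue_tuple R n.+1]_t h (tuple_uncons t) = \int[(mu \x lebesgue_tuple R n)%E]_p h p.
  move=> hi.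
  have hi' : (mu \x lebesgue_tuple R n)%E.-integrable (@tuple_cons R n @^-1` setT)
      ((EFin \o h \o @tuple_uncons R n) \o @tuple_cons R n).
    rewrite preimage_setT; apply: eq_integrable hi => // p _ /=.
    by rewrite tuple_consK.
  have mh : measurable_fun setT (EFin \o h \o @tuple_uncons R n).
    apply: measurableT_comp; first by case/integrableP: hi.
    exact: measurable_tuple_uncons.
  split; first exact: (integrable_pushforward (@measurable_tuple_cons R n) mh hi').
  rewrite /Rintegral; congr fine.
  transitivity (\int[pushforward (mu \x lebesgue_tuple R n)%E (@tuple_cons R n)]_t
    (EFin \o h \o @tuple_uncons R n) t)%E; first by [].
  rewrite (integral_pushforward (@measurable_tuple_cons R n) mh hi')// preimage_setT.
  by apply: eq_integral => p _ /=; rewrite tuple_consK.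
have [J1 J3] := E _ I1; have [J2 J4] := E _ I2.
by split => //; rewrite ?J3 ?J4.
Qed.

Lemma integrable_rescale n (M : 'M[R]_n) (f : n.-tuple RT -> R) : M \in unitmx ->
  (lebesgue_tuple R n).-integrable setT (EFin \o f) ->
  (lebesgue_tuple R n).-integrable setT
     (fun t => (f (tuple_of_row (row_of_tuple t *m M)))%:E) /\
  \int[lebesgue_tuple R n]_t f (tuple_of_row (row_of_tuple t *m M)) =
  `|\det M|^-1 * \int[lebesgue_tuple R n]_t f t.
Proof.
move=> uM fi; have rM := unitmx_rescales uM.
have [mf f_lty] := integrableP _ _ _ fi.
set g := fun t => _.
have mM := measurable_mul_tuple M.
split.
  apply/integrableP; split; first exact: (measurableT_comp mf mM).
  have := rM (fun t => `|(f t)%:E|%E).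
  rewrite /g => ->.
  - by rewrite lte_mul_pinfty// lee_fin invr_ge0.
  - exact: measurableT_comp.
  - by [].
rewrite /Rintegral.
have -> : (\int[lebesgue_tuple R n]_t (f (tuple_of_row (row_of_tuple t *m M)))%:E =
    (`|\det M|^-1)%:E * \int[lebesgue_tuple R n]_t (f t)%:E)%E.
  (* [rescales] speaks of nonnegative functions, so it is applied to the positive and the negative
     part. *)
  rewrite (integralE _ _ (EFin \o f)) (integralE _ _ (fun t => (f _)%:E)).
  rewrite (funepos_comp (EFin \o f)) (funeneg_comp (EFin \o f)).
  have := rM (EFin \o f)^\+%E; have := rM (EFin \o f)^\-%E.
  rewrite /comp => -> //; last exact: measurable_funeneg.
  move=> -> //; last exact: measurable_funepos.
  rewrite [RHS]muleBr//; apply: fin_num_adde_defr.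
  exact: (integrable_pos_fin_num measurableT fi).
by rewrite fineM// integrable_fin_num.
Qed.

Lemma has_cint_rescale n (M : 'M[R]_n) (F : n.-tuple RT -> C) (c : C) : M \in unitmx ->
  has_cint (lebesgue_tuple R n) F c ->
  has_cint (lebesgue_tuple R n)
     (fun t => F (tuple_of_row (row_of_tuple t *m M))) ((`|\det M|^-1)%:C * c).
Proof.
move=> uM [Fr Fi Fra Fia].
have [I1 J1] := integrable_rescale uM Fr; have [I2 J2] := integrable_rescale uM Fi.
split => //.
- by rewrite J1 Fra; case: (c) => a b /=; rewrite mul0r subr0.
- by rewrite J2 Fia; case: (c) => a b /=; rewrite mul0r addr0.
Qed.

Lemma cexpD (x y : C) : cexp (x + y) = cexp x * cexp y.
Proof.
case: x y => [a b] [c d]; rewrite /cexp /= expRD cosD sinD; simpc.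
by congr Complex; ring.
Qed.

Lemma cexp0 : cexp (0 : C) = 1.
Proof. by rewrite /cexp /= expR0 cos0 sin0 mulr1 mulr0. Qed.

Definition half_exp (z : C) (x : RT) : C :=
  if 0 <= x then cexp (z * (x : R)%:C) else 0.

Section half_line.
Variables a b : R.
Hypothesis a0 : a < 0.
Let N := a ^+ 2 + b ^+ 2.
Let N0 : 0 < N. Proof. by rewrite /N ltr_wpDr ?sqr_ge0// exprn_even_gt0//= lt_eqF. Qed.

(* The constant 2 makes the integrand nonnegative, as the library's fundamental theorem
   of calculus on a half-line requires; it is removed again in integral_exp_trigo. *)
Let f (p q x : R) := expR (a * x) * (2 + p * cos (b * x) + q * sin (b * x)).
(** The antiderivative of [f]: the coefficients u of cos and v of sin solve a u + b v = p and a v -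
    b u = q. *)
Let F (p q x : R) := expR (a * x) * (2 / a + (a * p - b * q) / N * cos (b * x)
                       + (b * p + a * q) / N * sin (b * x)).

Let dF p q (x : R) : is_derive x 1 (F p q) (f p q x).
Proof.
rewrite /F; apply: is_derive_eq; rewrite /GRing.scale/= /f /N.
by field; rewrite (lt_eqF a0)/= (gt_eqF N0).
Qed.

Let cf p q : continuous (f p q).
Proof.
move=> x; apply: differentiable_continuous; apply/derivable1_diffP.
by rewrite /f; exact: ex_derive.
Qed.

Let cvgF p q : F p q x @[x --> +oo] --> 0.
Proof.
pose K := `|2 / a| + `|(a * p - b * q) / N| + `|(b * p + a * q) / N|.
have e0 : expR (a * x) * K @[x --> +oo] --> 0.
  rewrite -[X in _ --> X](mul0r K); apply: cvgMl.
  have -> : (fun x => expR (a * x)) = (fun x => expR (- x)) \o (fun x => - a * x).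
    by apply/funext => x /=; rewrite mulNr opprK.
  apply: (@cvg_comp _ _ _ _ _ _ +oo); last exact: cvgr_expR.
  by apply: gt0_cvgMry; [rewrite oppr_gt0|exact: cvg_id].
apply/cvgr0Pnorm_le => e eps0; near=> x.
have : `|expR (a * x) * K| <= e by near: x; exact: cvgr0_norm_le.
apply: le_trans; rewrite /F !normrM ler_wpM2l// [leRHS]ger0_norm ?addr_ge0//.
have h (u v : R) : `|v| <= 1 -> `|u * v| <= `|u|.
  by move=> v1; rewrite normrM ler_piMr.
rewrite (le_trans (ler_normD _ _))// lerD//; last by apply: h; rewrite ler_norml sin_geN1 sin_le1.
rewrite (le_trans (ler_normD _ _))// lerD//; apply: h; rewrite ler_norml.
by rewrite cos_geN1 cos_le1.
Unshelve. all: by end_near. Qed.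

Let f_ge0 p q x : `|p| <= 1 -> `|q| <= 1 -> 0 <= f p q x.
Proof.
move=> p1 q1; rewrite /f mulr_ge0 ?expR_ge0//.
have h (u v : R) : `|u| <= 1 -> `|v| <= 1 -> -1 <= u * v.
  by move=> u1 v1; have := mulr_ile1 (normr_ge0 u) (normr_ge0 v) u1 v1;
    rewrite -normrM ler_norml => /andP[].
have := h _ _ p1 (_ : `|cos (b * x)| <= 1); rewrite ler_norml cos_geN1 cos_le1 => /(_ isT).
have := h _ _ q1 (_ : `|sin (b * x)| <= 1); rewrite ler_norml sin_geN1 sin_le1 => /(_ isT).
lra.
Qed.

Let F0 p q : F p q 0 = 2 / a + (a * p - b * q) / N.
Proof. by rewrite /F !mulr0 expR0 cos0 sin0 mul1r mulr0 addr0 mulr1. Qed.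

Let int_f p q : `|p| <= 1 -> `|q| <= 1 ->
  mu.-integrable `[0, +oo[ (EFin \o f p q) /\ \int[mu]_(x in `[0, +oo[) f p q x = - F p q 0.
Proof.
move=> p1 q1.
have FTC : (\int[mu]_(x in `[0%R, +oo[) (f p q x)%:E = 0%:E - (F p q 0)%:E)%E.
  apply: ge0_continuous_FTC2y.
  - by move=> x _; exact: f_ge0.
  - exact/continuous_subspaceT/cf.
  - exact: cvgF.
  - by move=> x _; exact: (@ex_derive _ _ _ _ _ _ _ (dF p q x)).
  - apply: cvg_at_right_filter; apply: differentiable_continuous; apply/derivable1_diffP.
    exact: (@ex_derive _ _ _ _ _ _ _ (dF p q 0)).
  - by move=> x _; rewrite derive1E; exact: (@derive_val _ _ _ _ _ _ _ (dF p q x)).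
split; last by rewrite /Rintegral FTC /= sub0r.
apply/integrableP; split.
  by apply/measurable_EFinP/measurable_funTS; exact: continuous_measurable_fun.
under eq_integral => x _ do rewrite /= ger0_norm ?f_ge0//.
by rewrite FTC -EFinB ltry.
Qed.

Let g (p q x : R) := expR (a * x) * (p * cos (b * x) + q * sin (b * x)).

Lemma integral_exp_trigo p q : `|p| <= 1 -> `|q| <= 1 ->
  mu.-integrable `[0, +oo[ (fun x => (expR (a * x) * (p * cos (b * x) + q * sin (b * x)))%:E) /\
  \int[mu]_(x in `[0, +oo[) (expR (a * x) * (p * cos (b * x) + q * sin (b * x))) =
    - (a * p - b * q) / (a ^+ 2 + b ^+ 2).
Proof.
move=> p1 q1.
have [I1 J1] := int_f p1 q1.
have [|| I2 J2] := @int_f 0 0; rewrite ?normr0//.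
have E x : g p q x = f p q x - f 0 0 x by rewrite /g /f; ring.
split.
  rewrite (_ : (fun _ => _) = (fun x => (f p q x)%:E - (f 0 0 x)%:E)%E).
    exact: integrableB.
  by apply/funext => x; rewrite -EFinB -E.
under eq_Rintegral => x _ do rewrite -/(g p q x) E.
by rewrite RintegralB// J1 J2 !F0 -/N; ring.
Qed.
End half_line.

Lemma has_cint_half_exp (z : C) : complex.Re z < 0 ->
  has_cint mu (half_exp z) (- z^-1).
Proof.
case: z => a b /= a0.
have [|| I1 J1] := @integral_exp_trigo _ b a0 1 0; rewrite ?normr0 ?normr1//.
have [|| I2 J2] := @integral_exp_trigo _ b a0 0 1; rewrite ?normr0 ?normr1//.
have Ez (x : R) : (a +i* b) * x%:C = (a * x) +i* (b * x).
  by apply/eqP; rewrite eq_complex Re_cmul Im_cmul /= !mulr0 subr0 add0r !eqxx.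
have E1 x : complex.Re (half_exp (a +i* b) x) =
    ((fun x : R => expR (a * x) * (1 * cos (b * x) + 0 * sin (b * x))) \_ `[0, +oo[) x.
  rewrite /half_exp patchE mem_setE in_itv/= andbT; case: ifP => // _.
  by rewrite Ez /cexp /= mul1r mul0r addr0.
have E2 x : complex.Im (half_exp (a +i* b) x) =
    ((fun x : R => expR (a * x) * (0 * cos (b * x) + 1 * sin (b * x))) \_ `[0, +oo[) x.
  rewrite /half_exp patchE mem_setE in_itv/= andbT; case: ifP => // _.
  by rewrite Ez /cexp /= mul1r mul0r add0r.
split.
- under eq_fun do rewrite E1.
  by move/integrable_mkcond : I1; rewrite restrict_EFin; apply; exact: measurable_itv.
- under eq_fun do rewrite E2.
  by move/integrable_mkcond : I2; rewrite restrict_EFin; apply; exact: measurable_itv.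
- under eq_Rintegral do rewrite E1.
  by rewrite -Rintegral_mkcond J1 /=; ring.
- under eq_Rintegral do rewrite E2.
  by rewrite -Rintegral_mkcond J2 /=; ring.
Qed.

Lemma integral_lebesgue_tuple0 (c : R) :
  (\int[lebesgue_tuple R 0]_t c%:E = c%:E)%E.
Proof.
rewrite integral_cst// [X in (_ * X)%E](_ : _ = 1%E) ?mule1//.
exact: diracT.
Qed.

Lemma has_cint_tuple0 (c : C) : has_cint (lebesgue_tuple R 0) (fun=> c) c.
Proof.
have I (r : R) : (lebesgue_tuple R 0).-integrable setT (fun=> r%:E).
  apply/integrableP; split; first exact: measurable_cst.
  by rewrite integral_lebesgue_tuple0 ltry.
by split => //; rewrite /Rintegral integral_lebesgue_tuple0.
Qed.

Lemma has_cint_orthant n (z : 'I_n -> C) : (forall i, complex.Re (z i) < 0) ->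
  has_cint (lebesgue_tuple R n) (fun t => \prod_i half_exp (z i) (tnth t i))
    (\prod_i - (z i)^-1).
Proof.
elim: n z => [|n IH] z z0.
  by under eq_fun do rewrite big_ord0; rewrite big_ord0; exact: has_cint_tuple0.
rewrite big_ord_recl; under eq_fun do rewrite big_ord_recl.
have := has_cint_tupleS (has_cint_half_exp (z0 ord0)) (IH _ (fun i => z0 (lift ord0 i))).
congr has_cint; apply/funext => t; congr (_ * _); apply: eq_bigr => i _.
by rewrite {2}[t]tuple_eta tnthS.
Qed.

Lemma prod_half_exp n (z : 'I_n -> C) (t : n.-tuple RT) :
  \prod_i half_exp (z i) (tnth t i) =
  if [forall i, 0 <= tnth t i] then cexp (\sum_i z i * (tnth t i)%:C) else 0.
Proof.
case: ifPn => [/forallP t0|].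
  rewrite (big_morph (@cexp R) cexpD cexp0).
  by apply: eq_bigr => i _; rewrite /half_exp t0.
by rewrite negb_forall => /existsP[i ti]; rewrite (bigD1 i)//= /half_exp (negbTE ti) mul0r.
Qed.

Lemma simplicial_coneP n (W : 'M[R]_n) x : W \in unitmx ->
  simplicial_cone W x <-> forall i, 0 <= (x *m invmx W) ord0 i.
Proof.
move=> uW; split=> [[t [t0 ->]] i|x0].
  have -> : \sum_j t j *: row j W = (\row_j t j) *m W.
    by rewrite mulmx_sum_row; apply: eq_bigr => j _; rewrite mxE.
  by rewrite mulmxK// mxE.
exists (fun i => (x *m invmx W) ord0 i); split => //.
by rewrite -[LHS](mulmxKV uW) mulmx_sum_row.
Qed.

Lemma cdotp_mul n m (z : 'rV[R[i]^o]_n) (W : 'M[R]_(m, n)) (s : 'rV[R]_m) :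
  cdotp z (s *m W) = \sum_j cdotp z (row j W) * (s ord0 j)%:C.
Proof.
rewrite /cdotp; under [RHS]eq_bigr do rewrite mulr_suml.
rewrite exchange_big /=; apply: eq_bigr => i _.
rewrite mxE rmorph_sum mulr_sumr; apply: eq_bigr => j _.
by rewrite !mxE rmorphM /=; rewrite mulrAC mulrA.
Qed.

(** In the coordinates x = t W the cone is the orthant and exp <z, x> is a product of half-line
    exponentials with rates <z, w_j>; the Jacobian is [|det W|]. *)
Lemma cintegral_simplicial_cone n (W : 'M[R]_n) (z : 'rV[R[i]^o]_n) : W \in unitmx ->
  (forall j, complex.Re (cdotp z (row j W)) < 0) ->
  cintegral (simplicial_cone W) (fun x => cexp (cdotp z x)) =
  (`|\det W|)%:C * \prod_j - (cdotp z (row j W))^-1.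
Proof.
move=> uW z0.
have uV : invmx W \in unitmx by rewrite unitmx_inv.
have [_ _ J1 J2] := has_cint_rescale uV (has_cint_orthant z0).
have detE : `|\det (invmx W)|^-1 = `|\det W| by rewrite det_inv normfV invrK.
rewrite detE in J1 J2.
have CE (c : C) : complex.Re c +i* complex.Im c = c by case: c.
rewrite -[RHS]CE -J1 -J2 {J1 J2 CE}.
have E t : \prod_j half_exp (cdotp z (row j W)) (tnth (tuple_of_row (row_of_tuple t *m invmx W)) j)
   = if row_of_tuple t \in simplicial_cone W then cexp (cdotp z (row_of_tuple t)) else 0.
  rewrite prod_half_exp; have -> : [forall i, 0 <= tnth (tuple_of_row (row_of_tuple t *m invmx W)) i]
      = (row_of_tuple t \in simplicial_cone W).
    apply/forallP/idP; rewrite inE.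
      by move=> h; apply/simplicial_coneP => // i; have := h i; rewrite tnth_mktuple.
    by move/simplicial_coneP => h i; rewrite tnth_mktuple; exact: h.
  case: ifP => // _; congr cexp.
  rewrite -[in RHS](mulmxKV uW (row_of_tuple t)) cdotp_mul.
  by apply: eq_bigr => i _; rewrite tnth_mktuple.
rewrite /cintegral 2!(Rintegral_mkcond _ (_ @^-1` _)).
congr Complex; apply: eq_Rintegral => t _; rewrite E patchE.
  rewrite (_ : (t \in _) = (row_of_tuple t \in simplicial_cone W)); first by case: ifP.
  by apply/idP/idP; rewrite !inE.
rewrite (_ : (t \in _) = (row_of_tuple t \in simplicial_cone W)); first by case: ifP.
by apply/idP/idP; rewrite !inE.
Qed.
End complex_integral.

(** * Equality of functions on a dense open set *)

Section agreement.
Variables (R : realType) (n : nat).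
Local Notation C := (R[i]^o).
Implicit Types (F G H : 'rV[C]_n -> C) (U : set 'rV[C]_n).

(** A reformulation of [mero_eq_on] by open dense sets, which can be intersected; agreements are
    then combined by intersecting the witnesses. *)
Definition agree U F G := exists D : set 'rV[C]_n,
  [/\ open D, dense D & forall z, D z -> U z -> F z = G z].

Lemma mero_eq_onP U F G : mero_eq_on U F G <-> agree U F G.
Proof.
rewrite /mero_eq_on /nowhere_dense; set S := [set z | _]; split=> [S0|[D [oD dD DFG]]].
  exists (~` closure S); split.
  - by apply: closed_openC; exact: closed_closure.
  - move=> A [z Az] oA; apply/set0P/eqP => AS.
    have AC : A `<=` closure S by rewrite -[closure S]setCK; apply/disjoints_subset.
    by move: AC; rewrite (open_subsetE _ oA) S0 => /(_ _ Az).
  - move=> z nSz Uz; apply: contrapT => FGz; apply: nSz.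
    by apply: subset_closure; split.
apply/seteqP; split=> // z Sz.
have [y [/interior_subset Sy Dy]] := dD _ (ex_intro _ z Sz) (open_interior _).
have [x [[Ux Fx] Dx]] := Sy _ (open_nbhs_nbhs (conj oD Dy)).
by apply: Fx; exact: DFG.
Qed.

Lemma agree_refl U F : agree U F F.
Proof. by exists setT; split => //; [exact: openT|move=> A A0 _; rewrite setIT]. Qed.

Lemma agree_sym U F G : agree U F G -> agree U G F.
Proof. by move=> [D [oD dD E]]; exists D; split=> // z Dz Uz; rewrite E. Qed.

Lemma agree_trans U F G H : agree U F G -> agree U G H -> agree U F H.
Proof.
move=> [D [oD dD E]] [D' [oD' dD' E']]; exists (D `&` D'); split.
- exact: openI.
- exact: denseI.
- by move=> z [Dz D'z] Uz; rewrite E// E'.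
Qed.

Lemma agree_eq U F G : (forall z, U z -> F z = G z) -> agree U F G.
Proof. by move=> E; have [D [oD dD _]] := agree_refl U F; exists D; split=> // z _; exact: E. Qed.

Lemma agree_comp2 U (op : C -> C -> C) F G F' G' : agree U F F' -> agree U G G' ->
  agree U (fun z => op (F z) (G z)) (fun z => op (F' z) (G' z)).
Proof.
move=> [D [oD dD E]] [D' [oD' dD' E']]; exists (D `&` D'); split.
- exact: openI.
- exact: denseI.
- by move=> z [Dz D'z] Uz; rewrite E// E'.
Qed.

Lemma agree_sub U V F G : U `<=` V -> agree V F G -> agree U F G.
Proof. by move=> UV [D [oD dD E]]; exists D; split=> // z Dz /UV; exact: E. Qed.

Lemma agree_setU U V F G : agree U F G -> agree V F G -> agree (U `|` V) F G.
Proof.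
move=> [D [oD dD E]] [D' [oD' dD' E']]; exists (D `&` D'); split.
- exact: openI.
- exact: denseI.
- by move=> z [Dz D'z] [/(E _ Dz)|/(E' _ D'z)].
Qed.

Lemma agree_dense U F G : open U -> dense U -> agree U F G -> agree setT F G.
Proof.
move=> oU dU [D [oD dD E]]; exists (D `&` U); split.
- exact: openI.
- exact: denseI.
- by move=> z [Dz Uz] _; exact: E.
Qed.

Lemma mero_eqP F G : mero_eq F G <-> agree setT F G.
Proof. exact: mero_eq_onP. Qed.

End agreement.

(** * Continuity of exponentials, and density of points with nonzero real pairings *)

Section continuity.
Variables (R : realType).
Local Notation C := (R[i]^o).

Lemma normc_le_ReIm (x : R[i]) : `|x| <= (`|complex.Re x| + `|complex.Im x|)%:C.
Proof.
case: x => a b /=; have -> : a +i* b = a%:C + 'i%C * b%:C by simpc.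
rewrite (le_trans (ler_normD _ _))// normrM.
have -> : `|'i%C : R[i]| = 1 by rewrite normc_def /= expr0n expr1n add0r sqrtr1.
have nr (c : R) : `|c%:C| = `|c|%:C by rewrite normc_def /= expr0n addr0 sqrtr_sqr.
by rewrite mul1r !nr -rmorphD.
Qed.

Lemma normc_ge_Im (x : R[i]) : `|complex.Im x|%:C <= `|x|.
Proof.
have := normc_ge_Re (x * 'i%C); rewrite ReiNIm normrN normrM.
have -> : `|'i%C : R[i]| = 1 by rewrite normc_def /= expr0n expr1n add0r sqrtr1.
by rewrite mulr1.
Qed.

Lemma Re_continuous : continuous (@complex.Re R : C -> R).
Proof.
move=> x; apply/(@cvgrPdist_lt _ _ _ _ (nbhs_filter (x : C))) => e e0.
have e0' : 0 < e%:C :> R[i] by rewrite ltcR.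
apply/nbhs_ballP; exists e%:C => //= y; rewrite /ball /= => xy.
by rewrite -ltcR (le_lt_trans _ xy)// -(raddfB (@complex.Re R)); exact: normc_ge_Re.
Qed.

Lemma Im_continuous : continuous (@complex.Im R : C -> R).
Proof.
move=> x; apply/(@cvgrPdist_lt _ _ _ _ (nbhs_filter (x : C))) => e e0.
have e0' : 0 < e%:C :> R[i] by rewrite ltcR.
apply/nbhs_ballP; exists e%:C => //= y; rewrite /ball /= => xy.
by rewrite -ltcR (le_lt_trans _ xy)// -(raddfB (@complex.Im R)); exact: normc_ge_Im.
Qed.

Lemma cvg_complex (T : Type) (F : set_system T) {FF : Filter F} (f g : T -> R) (a b : R) :
  f @ F --> a -> g @ F --> b -> ((fun t => f t +i* g t) : T -> C) @ F --> (a +i* b : C).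
Proof.
move=> fa gb; apply/cvgrPdist_lt => e e0.
(* The radius e is an element of [R[i]]; being positive in its order, it is real. *)
have [r r0 eE] : exists2 r : R, 0 < r & e = r%:C.
  move: e0; rewrite ltcE /= => /andP[/eqP ei er]; exists (complex.Re e) => //.
  by case: e ei {er} => ? ? /= ->.
have r2 : 0 < r / 2 by rewrite divr_gt0.
near=> t; rewrite eE (le_lt_trans (normc_le_ReIm _))// ltcR /=.
rewrite [ltRHS](splitr r) ltrD//; near: t; [move/cvgrPdist_lt: fa|move/cvgrPdist_lt: gb]; exact.
Unshelve. all: by end_near. Qed.

Lemma cexp_continuous : continuous (@cexp R : C -> C).
Proof.
move=> x; rewrite /cexp.
have cR := @Re_continuous x; have cI := @Im_continuous x.
have FF : Filter (nbhs (x : C)) by exact: nbhs_filter.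
have eR : expR (complex.Re y) @[y --> (x : C)] --> expR (complex.Re x).
  exact: (cvg_comp _ _ cR (@continuous_expR R _)).
have cC : cos (complex.Im y) @[y --> (x : C)] --> cos (complex.Im x).
  exact: (cvg_comp _ _ cI (@continuous_cos R _)).
have cS : sin (complex.Im y) @[y --> (x : C)] --> sin (complex.Im x).
  exact: (cvg_comp _ _ cI (@continuous_sin R _)).
exact: (cvg_complex (cvgM eR cC) (cvgM eR cS)).
Qed.

Lemma cdotp_continuous n (x : 'rV[R]_n) : continuous (fun z : 'rV[C]_n => cdotp z x : C).
Proof.
move=> z; have FF : Filter (nbhs z) by exact: nbhs_filter.
apply: (@cvg_big C _ +%R 0 predT (@add_continuous C) _ (nbhs z) (index_enum 'I_n)
  (fun i z => z ord0 i * (x ord0 i)%:C) (fun i => z ord0 i * (x ord0 i)%:C) FF) => i _.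
by apply: cvgMr_tmp; exact: coord_continuous.
Qed.

Definition re_generic n (w : 'rV[R]_n) : set 'rV[C]_n :=
  [set z | complex.Re (cdotp z w) != 0].

Lemma open_re_generic n (w : 'rV[R]_n) : open (re_generic w).
Proof.
apply: (@open_comp _ _ (fun z : 'rV[C]_n => complex.Re (cdotp z w)) [set x : R | x != 0]).
  move=> z _; apply: (@continuous_comp _ _ _ (fun z => cdotp z w : C) (@complex.Re R : C -> R)).
    exact: cdotp_continuous.
  exact: Re_continuous.
exact: open_neq.
Qed.

Definition cplx_row n (x : 'rV[R]_n) : 'rV[C]_n := \row_i (x ord0 i)%:C.

Lemma cdotpD n (z z' : 'rV[C]_n) (x : 'rV[R]_n) : cdotp (z + z') x = cdotp z x + cdotp z' x.
Proof. by rewrite /cdotp -big_split; apply: eq_bigr => i _; rewrite mxE mulrDl. Qed.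

Lemma cdotpZ n (a : C) (z : 'rV[C]_n) (x : 'rV[R]_n) : cdotp (a *: z) x = a * cdotp z x.
Proof. by rewrite /cdotp mulr_sumr; apply: eq_bigr => i _; rewrite mxE mulrA. Qed.

Lemma cdotp_cplx n (x y : 'rV[R]_n) : cdotp (cplx_row x) y = (dotp x y)%:C.
Proof. by rewrite /dotp rmorph_sum; apply: eq_bigr => i _; rewrite mxE rmorphM. Qed.

Lemma dotpp_eq0 n (x : 'rV[R]_n) : (dotp x x == 0) = (x == 0).
Proof.
apply/eqP/eqP => [|->]; last by rewrite /dotp big1// => i _; rewrite mxE mul0r.
move/eqP; rewrite psumr_eq0 => [/allP x0|i _]; last by rewrite -expr2 sqr_ge0.
apply/rowP => i; have := x0 i (mem_index_enum _).
by rewrite mulf_eq0 orbb mxE => /eqP.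
Qed.

(** Moving z by a small real multiple t w changes [Re <z, w>] by t <w, w>. *)
Lemma dense_re_generic n (w : 'rV[R]_n) : w != 0 -> dense (re_generic w).
Proof.
move=> w0 A [z Az] oA.
have [zw|] := eqVneq (complex.Re (cdotp z w)) 0; last by exists z.
have : \forall t \near (0 : C), A (z + t *: cplx_row w).
  have FF : Filter (nbhs (0 : C)) by exact: nbhs_filter.
  have h1 : (t *: cplx_row w) @[t --> (0 : C)] --> 0 *: cplx_row w by exact: scalel_continuous.
  have := cvgD (cvg_cst z) h1; rewrite scale0r addr0.
  by apply; exact: open_nbhs_nbhs.
move=> /nbhs_ballP[e e0 he]; exists (z + (e / 2) *: cplx_row w); split.
  apply: he; rewrite /ball /= sub0r normrN gtr0_norm ?divr_gt0// ltr_pdivrMr//.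
  by rewrite ltr_pMr// ltr1n.
have [r r0 eE] : exists2 r : R, 0 < r & e = r%:C.
  move: e0; rewrite /= ltcE /= => /andP[/eqP ei er]; exists (complex.Re e) => //.
  by case: e ei {er he} => ? ? /= ->.
rewrite /re_generic /= cdotpD raddfD /= zw add0r cdotpZ cdotp_cplx eE.
have -> : (r%:C / 2) * (dotp w w)%:C = (r / 2 * dotp w w)%:C.
  by rewrite !rmorphM /= fmorphV /= rmorph_nat.
by rewrite /= !mulf_neq0 ?dotpp_eq0 ?gt_eqF// invr_neq0.
Qed.

Lemma dense_open_bigcap n (I : eqType) (r : seq I) (D : I -> set 'rV[C]_n) :
  (forall i, i \in r -> open (D i) /\ dense (D i)) ->
  open (\bigcap_(i in [set` r]) D i) /\ dense (\bigcap_(i in [set` r]) D i).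
Proof.
elim: r => [|i r IH] h.
  rewrite (_ : [set` [::]] = set0) ?bigcap_set0; last by apply/seteqP; split.
  by split; [exact: openT|move=> A A0 _; rewrite setIT].
have -> : \bigcap_(j in [set` i :: r]) D j = D i `&` \bigcap_(j in [set` r]) D j.
  rewrite (_ : [set` i :: r] = i |` [set` r]) ?bigcap_setU1//.
  by apply/seteqP; split=> j /=; rewrite inE; [case/predU1P; [left|right]|case=> [->|->]; rewrite ?eqxx ?orbT].
have [oi di] := h i (mem_head _ _).
have [|oD dD] := IH; first by move=> j jr; apply: h; rewrite inE jr orbT.
by split; [exact: openI|exact: denseI].
Qed.

Lemma dense_eq0 n (D : set 'rV[C]_n) (F : 'rV[C]_n -> C) z :
  open D -> dense D -> (forall y, D y -> F y = 0) -> {for z, continuous F} -> F z = 0.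
Proof.
move=> oD dD FD cF; apply: contrapT => /eqP Fz.
have FF : Filter (nbhs z) by exact: nbhs_filter.
have : \forall y \near z, F y != 0.
  move/(@cvgrPdist_lt _ C _ _ FF): cF => /(_ `|F z|); rewrite normr_gt0 => /(_ Fz).
  apply: filterS => y; apply: contraTneq => ->; by rewrite subr0 ltxx.
move=> Sz; have {}Sz : [set y | F y != 0]° z by [].
have [y [/interior_subset Sy Dy]] := dD _ (ex_intro _ z Sz) (open_interior _).
by move/eqP: Sy; apply; exact: FD.
Qed.

End continuity.

(** * Decomposition of polyhedral functions into wedges *)

Section dotp_theory.
Variables (R : realType) (n : nat).
Implicit Types (x y z : 'rV[R]_n).

Lemma dotpE x y : dotp x y = (x *m y^T) ord0 ord0.
Proof. by rewrite mxE; apply: eq_bigr => i _; rewrite mxE. Qed.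

Lemma dotpC x y : dotp x y = dotp y x.
Proof. by apply: eq_bigr => i _; rewrite mulrC. Qed.

Lemma dotpDl x y z : dotp (x + y) z = dotp x z + dotp y z.
Proof. by rewrite !dotpE mulmxDl mxE. Qed.

Lemma dotpDr x y z : dotp z (x + y) = dotp z x + dotp z y.
Proof. by rewrite ![dotp z _]dotpC dotpDl. Qed.

Lemma dotpZl a x y : dotp (a *: x) y = a * dotp x y.
Proof. by rewrite !dotpE -scalemxAl mxE. Qed.

Lemma dotpZr a x y : dotp y (a *: x) = a * dotp y x.
Proof. by rewrite ![dotp y _]dotpC dotpZl. Qed.

Lemma dotpNl x y : dotp (- x) y = - dotp x y.
Proof. by rewrite -scaleN1r dotpZl mulN1r. Qed.

Lemma dotpNr x y : dotp x (- y) = - dotp x y.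
Proof. by rewrite dotpC dotpNl dotpC. Qed.

Lemma dotp0l x : dotp 0 x = 0.
Proof. by rewrite -(scale0r 0) dotpZl mul0r. Qed.

Lemma dotp_suml (I : Type) (r : seq I) (P : pred I) (F : I -> 'rV[R]_n) y :
  dotp (\sum_(i <- r | P i) F i) y = \sum_(i <- r | P i) dotp (F i) y.
Proof.
exact: (big_morph (fun x => dotp x y) (fun x z => dotpDl x z y) (dotp0l y)).
Qed.

Lemma dotp_continuous x : continuous (fun y => dotp x y : R).
Proof.
move=> y; apply: (@cvg_big R _ +%R 0 predT (@add_continuous R) _ (nbhs y) (index_enum 'I_n)
  (fun i z => x ord0 i * z ord0 i) (fun i => x ord0 i * y ord0 i)) => i _.
by apply: cvgMl_tmp; exact: coord_continuous.
Qed.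

End dotp_theory.

Section ae_equal_theory.
Variables (R : realType) (n : nat).
Implicit Types (f g h : 'rV[R]_n -> R).

Lemma ae_equal_refl f : ae_equal f f.
Proof. by apply: nearW. Qed.

Lemma ae_equal_sym f g : ae_equal f g -> ae_equal g f.
Proof. by apply: filterS => t ->. Qed.

Lemma ae_equal_trans f g h : ae_equal f g -> ae_equal g h -> ae_equal f h.
Proof. by apply: filterS2 => t -> ->. Qed.

Lemma ae_equal_comp2 (op : R -> R -> R) f g f' g' : ae_equal f f' -> ae_equal g g' ->
  ae_equal (fun x => op (f x) (g x)) (fun x => op (f' x) (g' x)).
Proof. by apply: filterS2 => t -> ->. Qed.

End ae_equal_theory.

Section wedges.
Variable (R : realType).

Definition wedge m n (A : 'M[R]_(m, n)) (b : 'rV[R]_m) : set 'rV[R]_n :=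
  [set x | forall i, b ord0 i <= dotp (row i A) x].

(** Independent rows also force a nonempty interior, so the same combinations serve to compute the
    transform and as full-dimensional representatives for signed sections. *)
Record wedge_data n := WedgeData {
  wedge_size : nat;
  wedge_normals : 'M[R]_(wedge_size, n);
  wedge_offsets : 'rV[R]_wedge_size;
  wedge_free : row_free wedge_normals }.

Definition wedge_set n (w : wedge_data n) : set 'rV[R]_n :=
  wedge (wedge_normals w) (wedge_offsets w).

Definition wedge_comb n (s : seq (R * wedge_data n)) (x : 'rV[R]_n) : R :=
  \sum_(p <- s) p.1 * \1_(wedge_set p.2) x.

Definition in_wedge_span n (f : 'rV[R]_n -> R) := exists s, ae_equal f (wedge_comb (n := n) s).

Section span.
Variable n : nat.
Implicit Types (f g : 'rV[R]_n -> R).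

Lemma in_span_ae f g : ae_equal f g -> in_wedge_span g -> in_wedge_span f.
Proof. by move=> fg [s gs]; exists s; exact: ae_equal_trans gs. Qed.

Lemma in_span0 : in_wedge_span (fun _ : 'rV[R]_n => 0).
Proof. by exists [::]; apply: nearW => t; rewrite /wedge_comb big_nil. Qed.

Lemma in_span_lin (a : R) f g : in_wedge_span f -> in_wedge_span g ->
  in_wedge_span (fun x => a * f x + g x).
Proof.
move=> [s fs] [s' gs]; exists ([seq (a * p.1, p.2) | p <- s] ++ s').
have := ae_equal_comp2 (fun u v => a * u + v) fs gs.
apply: filterS => t ->; rewrite /wedge_comb big_cat big_map mulr_sumr; congr (_ + _).
by apply: eq_bigr => p _; rewrite mulrA.
Qed.

Lemma in_span_wedge m (A : 'M[R]_(m, n)) (b : 'rV[R]_m) : row_free A ->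
  in_wedge_span (\1_(wedge A b)).
Proof.
move=> fA; exists [:: (1, WedgeData b fA)]; apply: nearW => t.
by rewrite /wedge_comb big_seq1 mul1r.
Qed.

Section arrangement.
Variables (M : nat) (a : 'I_M -> 'rV[R]_n) (b : 'I_M -> R).
Hypothesis a0 : forall i, a i != 0.

Let l i x := dotp (a i) x - b i.
Let cell (S : {set 'I_M}) (s : 'I_M -> bool) : set 'rV[R]_n :=
  [set x | forall i, i \in S -> 0 <= (-1) ^+ (s i) * l i x].

Let indic_asbool (P : set 'rV[R]_n) x : \1_P x = (if `[< P x >] then 1 else 0 : R).
Proof. by rewrite indicE; case: asboolP => Px; [rewrite mem_set|rewrite memNset]. Qed.

Let ae_l i : {ae lebesgue_tuple R n, forall t, l i (row_of_tuple t) != 0}.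
Proof.
have := ae_notin_hyperplane (b i) (a0 i); apply: filterS => t tb.
by rewrite /l subr_eq0; apply/eqP.
Qed.

(** Off the null set {l_j = 0} exactly one of the two inequalities at j holds, so the cells of s and
    s' partition the cell from which that inequality is dropped. *)
Let cell_flip (S : {set 'I_M}) (s s' : 'I_M -> bool) j : j \in S -> s' j = ~~ s j ->
  (forall i, i != j -> s' i = s i) ->
  ae_equal (\1_(cell S s) : _ -> R) (fun x => (-1) * \1_(cell S s') x + \1_(cell (S :\ j) s) x).
Proof.
move=> jS s'j s'i; have := ae_l j; apply: filterS => t lt.
set x := row_of_tuple t in lt *; rewrite !indic_asbool.
have E : cell S s x <-> (0 <= (-1) ^+ (s j) * l j x) /\ cell (S :\ j) s x.
  split=> [h|[hj h] i iS].
    by split=> [|i]; [exact: h|rewrite !inE => /andP[_]; exact: h].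
  by have [->//|ij] := eqVneq i j; apply: h; rewrite !inE ij.
have E' : cell S s' x <-> ~ (0 <= (-1) ^+ (s j) * l j x) /\ cell (S :\ j) s x.
  have jE : 0 <= (-1) ^+ (s' j) * l j x <-> ~ (0 <= (-1) ^+ (s j) * l j x).
    rewrite s'j signrN mulNr oppr_ge0.
    have lt' : (-1) ^+ s j * l j x != 0 by rewrite mulf_neq0// signr_eq0.
    by rewrite le_eqVlt (negbTE lt') /= ltNge; split=> [/negP|/negP].
  split=> [h|[/jE hj h] i iS].
    split; first by apply/jE; exact: h.
    by move=> i; rewrite !inE => /andP[ij iS]; rewrite -s'i//; exact: h.
  by have [->//|ij] := eqVneq i j; rewrite s'i//; apply: h; rewrite !inE ij.
case: (pselect (0 <= (-1) ^+ (s j) * l j x)) => hj;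
  case: (pselect (cell (S :\ j) s x)) => hc; do !case: asboolP => //; rewrite ?mulr1 ?mulr0 ?addr0 ?add0r ?addNr//; tauto.
Qed.

(* A dependence sum_i la_i a_i = 0 makes sum_i la_i l_i constant; with all signs chosen so
   that every |la_i| occurs, this constant is <= 0 and the cell lies in {l_j = 0}. *)
Let cell_dependent (S : {set 'I_M}) (la : 'I_M -> R) j : j \in S -> la j != 0 ->
  \sum_(i in S) la i *: a i = 0 ->
  exists s, ae_equal (\1_(cell S s) : _ -> R) (fun=> 0).
Proof.
move=> jS; wlog b0 : la / 0 <= \sum_(i in S) la i * b i.
  move=> H laj la0; have [|bneg] := leP 0 (\sum_(i in S) la i * b i).
    by move=> ?; exact: (H la).
  apply: (H (fun i => - la i)); rewrite ?oppr_eq0//.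
    by under eq_bigr do rewrite mulNr; rewrite sumrN oppr_ge0 ltW.
  by under eq_bigr do rewrite scaleNr; rewrite sumrN la0 oppr0.
move=> laj la0; exists (fun i => la i < 0).
have := ae_l j; apply: filterS => t lt; rewrite indic_asbool; case: asboolP => // cx.
set x := row_of_tuple t in lt cx *; exfalso.
have E : \sum_(i in S) `|la i| * ((-1) ^+ (la i < 0)%R * l i x) = - \sum_(i in S) la i * b i.
  transitivity (dotp (\sum_(i in S) la i *: a i) x - \sum_(i in S) la i * b i); last first.
    by rewrite la0 dotp0l sub0r.
  rewrite dotp_suml -sumrB; apply: eq_bigr => i _.
  by rewrite dotpZl mulrA [`|_| * _]mulrC -numEsign mulrBr.
have p0 i : i \in S -> 0 <= `|la i| * ((-1) ^+ (la i < 0)%R * l i x).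
  by move=> iS; rewrite mulr_ge0//; exact: cx.
have : \sum_(i in S) `|la i| * ((-1) ^+ (la i < 0)%R * l i x) == 0.
  by rewrite eq_le sumr_ge0// andbT E oppr_le0.
rewrite psumr_eq0// => /allP/(_ j (mem_index_enum _))/implyP/(_ jS).
by rewrite !mulf_eq0 normr_eq0 (negbTE laj) signr_eq0 (negbTE lt).
Qed.

(** Induction on the number of inequalities. Independent normals give a wedge. Dependent ones give a
    sign pattern [tau] with a null cell, and [tau] is transformed into s one sign at a time; each
    change costs a cell with one inequality fewer. *)
Let cell_span k (S : {set 'I_M}) s : (#|S| <= k)%N -> in_wedge_span (\1_(cell S s)).
Proof.
elim: k => [|k IH] in S s *; last move=> Sk.
  rewrite leqn0 cards_eq0 => /eqP ->.
  have -> : cell finset.set0 s = wedge (0 : 'M[R]_(0, n)) 0.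
    by apply/seteqP; split=> x _ // i; [case: i|rewrite inE].
  by apply: in_span_wedge; rewrite /row_free mxrank0.
pose A : 'M[R]_(#|S|, n) := \matrix_(i < #|S|) ((-1) ^+ s (enum_val i) *: a (enum_val i)).
have [fA|] := boolP (row_free A).
  have -> : cell S s = wedge A (\row_i ((-1) ^+ s (enum_val i) * b (enum_val i))).
    apply/seteqP; split=> x h i.
      have := h _ (enum_valP i).
      by rewrite mxE rowK dotpZl /l mulrBr subr_ge0.
    move=> iS; have := h (enum_rank_in iS i).
    by rewrite mxE rowK dotpZl /l enum_rankK_in// mulrBr subr_ge0.
  exact: in_span_wedge.
rewrite -kermx_eq0 => /rowV0Pn[v /sub_kermxP vA v0].
have [i0 vi0] : exists i, v ord0 i != 0.
  apply/existsP; apply: contraNT v0 => /existsPn h; apply/eqP/rowP => i.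
  by rewrite mxE; have := h i; rewrite negbK => /eqP.
have j0S := enum_valP i0; set j0 := enum_val i0 in j0S.
pose la i := v ord0 (enum_rank_in j0S i) * (-1) ^+ s i.
have la0 : \sum_(i in S) la i *: a i = 0.
  rewrite -[RHS]vA mulmx_sum_row (reindex_onto enum_val (enum_rank_in j0S)) /=; last first.
    by move=> i iS; rewrite enum_rankK_in.
  apply: eq_big => [i|i _]; first by rewrite enum_valP enum_valK_in eqxx.
  by rewrite /la rowK scalerA enum_valK_in.
have [|tau cell0] := cell_dependent (la := la) j0S _ la0.
  by rewrite /la enum_valK_in mulf_neq0// signr_eq0.
(* The list r contains the indices at which s1 may still differ from [tau]. *)
have flips (r : seq 'I_M) s1 : (forall i, i \notin r -> s1 i = tau i) ->
    in_wedge_span (\1_(cell S s1)).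
  elim: r s1 => [|i r IHr] s1 h.
    have -> : s1 = tau by apply/funext => i; exact: h.
    exact: in_span_ae cell0 in_span0.
  pose s2 := fun j => if j == i then tau i else s1 j.
  have sp2 : in_wedge_span (\1_(cell S s2)).
    apply: IHr => j jr; rewrite /s2; case: eqP => [->//|/eqP ji].
    by apply: h; rewrite inE negb_or ji.
  have [iS|iS] := boolP (i \in S); last first.
    have -> // : cell S s1 = cell S s2.
    apply/seteqP; split=> x hx j jS; have := hx j jS; rewrite /s2; case: eqP => // ji;
    by rewrite -ji jS in iS.
  have [e|ne] := eqVneq (s1 i) (tau i).
    have -> // : s1 = s2 by apply/funext => j; rewrite /s2; case: eqP => // ->.
  apply: (in_span_ae (@cell_flip S s1 s2 i iS _ _)).
  - by rewrite /s2 eqxx; case: (s1 i) (tau i) ne => [] [].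
  - by move=> j ji; rewrite /s2 (negbTE ji).
  - apply: in_span_lin => //; apply: IH.
    by move: Sk; rewrite (cardsD1 i) iS.
by apply: (flips (enum 'I_M)) => i; rewrite mem_enum.
Qed.

Lemma in_span_arrangement : in_wedge_span (\1_[set x | forall i, dotp (a i) x <= b i]).
Proof.
have -> : [set x | forall i, dotp (a i) x <= b i] = cell (finset.setTfor 'I_M) (fun=> true).
  apply/seteqP; split=> x h i => [_|]; first by rewrite expr1 mulN1r oppr_ge0 subr_le0.
  by have := h i (finset.in_setT i); rewrite expr1 mulN1r oppr_ge0 subr_le0.
exact: cell_span (leqnn _).
Qed.

End arrangement.

Lemma in_span_sum (I : Type) (r : seq I) (c : I -> R) (F : I -> 'rV[R]_n -> R) :
  (forall i, in_wedge_span (F i)) -> in_wedge_span (fun x => \sum_(i <- r) c i * F i x).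
Proof.
move=> h; elim: r => [|i r IH].
  by under [fun x => _]eq_fun do rewrite big_nil; exact: in_span0.
by under [fun x => _]eq_fun do rewrite big_cons; exact: in_span_lin.
Qed.

Lemma polyhedral_in_span f : polyhedral_function f -> in_wedge_span f.
Proof.
move=> [_ [[m [c [P [hP ->]]] fg]]]; apply: in_span_ae fg _; apply: in_span_sum => i.
have [M [H [hH ->]]] := hP i.
have [a /choice[b hab]] := choice hH.
rewrite (_ : \bigcap_(i in _) _ = [set x | forall j, dotp (a j) x <= b j]).
  by apply: in_span_arrangement => j; have [] := hab j.
apply/seteqP; split=> x h j.
  by have := h j I; have [_ ->] := hab j.
by move=> _; have [_ ->] := hab j; exact: h.
Qed.

End span.
End wedges.

(** * The transform of a wedge *)

Section wedge_geometry.
Variables (R : realType).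

Lemma row_free_row_neq0 m n (A : 'M[R]_(m, n)) i : row_free A -> row i A != 0.
Proof.
move=> fA; apply/eqP => Ai0.
have : delta_mx ord0 i *m A == 0 :> 'rV_n by rewrite -rowE Ai0.
rewrite mulmx_free_eq0// => /eqP/rowP/(_ i); rewrite !mxE !eqxx => /eqP.
by rewrite oner_eq0.
Qed.

Lemma mul_row'_col' m n p (A : 'M[R]_(m, n)) (B : 'M[R]_(n, p)) j k :
  row' j A *m col' k B = row' j (col' k (A *m B)).
Proof. by apply/matrixP => u v; rewrite !mxE; apply: eq_bigr => i _; rewrite !mxE. Qed.

Lemma row'_col'_1 m (j : 'I_m) : row' j (col' j (1%:M : 'M[R]_m)) = 1%:M.
Proof. by apply/matrixP => u v; rewrite !mxE (inj_eq lift_inj). Qed.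

Lemma row_free_row' m n (A : 'M[R]_(m, n)) j : row_free A -> row_free (row' j A).
Proof.
move=> /row_freeP[B AB]; apply/row_freeP; exists (col' j B).
by rewrite mul_row'_col' AB row'_col'_1.
Qed.

Lemma wedge_convex m n (A : 'M[R]_(m, n)) (b : 'rV[R]_m) :
  row_free A -> convex_polyhedron (wedge A b).
Proof.
move=> fA; exists m, (fun i => [set x | dotp (- row i A) x <= - b ord0 i]); split.
  move=> i; exists (- row i A), (- b ord0 i); split=> //.
  by rewrite oppr_eq0; exact: row_free_row_neq0.
by apply/seteqP; split=> x h i; [move=> _|have := h i Logic.I];
  rewrite /= dotpNl lerN2; [exact: h|].
Qed.

Lemma dotp_rowE m n (A : 'M[R]_(m, n)) (x : 'rV[R]_n) i :
  dotp (row i A) x = (x *m A^T) ord0 i.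
Proof. by rewrite mxE; apply: eq_bigr => k _; rewrite !mxE mulrC. Qed.

Lemma near_wedge m n (A : 'M[R]_(m, n)) (b : 'rV[R]_m) (x : 'rV[R]_n) :
  (forall i, b ord0 i < dotp (row i A) x) ->
  \forall y \near x, forall i, b ord0 i < dotp (row i A) y.
Proof.
move=> h; have FF : Filter (nbhs x) by exact: nbhs_filter.
apply: (@filter_forall _ _ (fun i y => b ord0 i < dotp (row i A) y) _ FF) => i.
have c : dotp (row i A) y @[y --> x] --> dotp (row i A) x by exact: dotp_continuous.
exact: (cvgr_gt _ c _ (h i)).
Qed.

Lemma polyhedral_comb n (s : seq (R * wedge_data R n)) : polyhedral_function (wedge_comb s).
Proof.
exists (wedge_comb s); split; last exact: ae_equal_refl.
exists (size s), (fun i => (tnth (in_tuple s) i).1),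
  (fun i => wedge_set (tnth (in_tuple s) i).2); split.
  by move=> i; apply: wedge_convex; exact: wedge_free.
by apply/funext => x; rewrite /wedge_comb big_tnth.
Qed.

Lemma polyhedral_ae n (f g : 'rV[R]_n -> R) :
  ae_equal f g -> polyhedral_function g -> polyhedral_function f.
Proof. by move=> fg [h [hh gh]]; exists h; split=> //; exact: ae_equal_trans gh. Qed.

Lemma polyhedral_wedge m n (A : 'M[R]_(m, n)) (b : 'rV[R]_m) :
  row_free A -> polyhedral_function (\1_(wedge A b)).
Proof.
move=> fA; apply: polyhedral_ae (polyhedral_comb [:: (1, WedgeData b fA)]).
by apply: nearW => t; rewrite /wedge_comb big_seq1 mul1r.
Qed.

(** Independence of the rows gives the bounding hyperplanes a common point, which is an apex, and m
    < n gives them a common direction. *)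
Lemma wedge_line_cone m n (A : 'M[R]_(m, n)) (b : 'rV[R]_m) :
  row_free A -> (m < n)%N -> line_cone (wedge A b).
Proof.
move=> fA mn; split.
  pose p := b *m (pinvmx A)^T.
  have Ap i : dotp (row i A) p = b ord0 i.
    by rewrite dotp_rowE -mulmxA -trmx_mul mulmxVp// trmx1 mulmx1.
  exists p; split.
    exists 1%N, (fun=> wedge A b); split; first by move=> _; exact: wedge_convex.
    by apply/seteqP; split=> x; [exists ord0|case].
  move=> x t Ax t0 i; rewrite dotpDr dotpZr dotpDr dotpNr Ap lerDl mulr_ge0// subr_ge0.
  exact: Ax.
have : kermx A^T != 0 by rewrite kermx_eq0 /row_free mxrank_tr (eqP fA) ltn_eqF.
move=> /rowV0Pn[u /sub_kermxP uA u0]; exists u; split=> // x t Ax i.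
by rewrite dotpDr dotpZr [dotp _ u]dotp_rowE uA mxE mulr0 addr0; exact: Ax.
Qed.

(** For square A of full rank this is the basis dual to the rows of A, that is, the generators of
    the cone A x >= 0. *)
Definition dual_rows m n (A : 'M[R]_(m, n)) : 'M[R]_(m, n) := (pinvmx A)^T.

Lemma dual_rowsP m n (A : 'M[R]_(m, n)) : row_free A -> A *m (dual_rows A)^T = 1%:M.
Proof. by move=> fA; rewrite trmxK mulmxVp. Qed.

(* Equals |det W| when W is square, and makes sense without identifying m and n. *)
Definition gram_volume m n (W : 'M[R]_(m, n)) : R := Num.sqrt (\det (W *m W^T)).

Lemma gram_volume_sq n (W : 'M[R]_n) : gram_volume W = `|\det W|.
Proof. by rewrite /gram_volume det_mulmx det_tr -expr2 sqrtr_sqr. Qed.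

Local Notation C := (R[i]^o).

Definition cone_transform m n (W : 'M[R]_(m, n)) (z : 'rV[C]_n) : C :=
  (gram_volume W)%:C * \prod_i - (cdotp z (row i W))^-1.

(* A wedge with fewer than n rows is a line-cone, hence the value 0. *)
Definition wedge_transform n (w : wedge_data R n) (z : 'rV[C]_n) : C :=
  let W := dual_rows (wedge_normals w) in
  if wedge_size w == n
  then cexp (cdotp z (wedge_offsets w *m W)) * cone_transform W z
  else 0.

Lemma translate_cone n (A : 'M[R]_n) (b : 'rV[R]_n) : row_free A ->
  wedge A b = translate (b *m dual_rows A) (simplicial_cone (dual_rows A)).
Proof.
move=> fA; have WA : dual_rows A *m A^T = 1%:M.
  by rewrite -[LHS]trmxK trmx_mul trmxK dual_rowsP// trmx1.
have uW : dual_rows A \in unitmx by case/mulmx1_unit: WA.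
have WI : invmx (dual_rows A) = A^T by rewrite -[LHS]mulmx1 -WA mulKmx.
apply/seteqP; split=> x.
  move=> Ax; exists (x - b *m dual_rows A); last by rewrite subrK.
  apply/simplicial_coneP => // i; rewrite WI mulmxBl -mulmxA WA mulmx1.
  by rewrite mxE [X in _ + X]mxE subr_ge0 -dotp_rowE; exact: Ax.
move=> [y /(simplicial_coneP _ uW) y0 <-] i; have := y0 i.
by rewrite WI -dotp_rowE dotpDr [dotp _ (b *m _)]dotp_rowE -mulmxA WA mulmx1 lerDr.
Qed.

End wedge_geometry.

Section transform.
Variables (R : realType) (n : nat).
Local Notation C := (R[i]^o).
Variable T : ('rV[R]_n.+1 -> R) -> ('rV[C]_n.+1 -> C).
Hypothesis TP : is_Fourier_Laplace_pos T.

Lemma FL0 : agree setT (T (fun=> 0)) (fun=> 0).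
Proof.
have P0 : polyhedral_function (fun _ : 'rV[R]_n.+1 => 0 : R).
  have := polyhedral_comb ([::] : seq (R * wedge_data R n.+1)).
  by congr polyhedral_function; apply/funext => x; rewrite /wedge_comb big_nil.
(* With coefficient 1 and both functions zero, linearity reads T 0 = T 0 + T 0. *)
have := FL_linear TP 1 P0 P0; rewrite mero_eqP.
under [fun x => _ + _]eq_fun do rewrite mulr0 addr0.
case=> D [oD dD E]; exists D; split=> // z Dz _.
by have := E z Dz Logic.I; rewrite mul1r => /eqP; rewrite -subr_eq subrr eq_sym => /eqP.
Qed.

Let flip (j : 'I_n.+1) (W : 'M[R]_n.+1) : 'M[R]_n.+1 :=
  diag_mx (\row_i (-1) ^+ (i == j)) *m W.

Let row_flip j W i : row i (flip j W) = (-1) ^+ (i == j) *: row i W.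
Proof. by apply/rowP => k; rewrite /flip mul_diag_mx !mxE. Qed.

Let flipK j W : flip j (flip j W) = W.
Proof.
apply/row_matrixP => i; rewrite !row_flip scalerA -expr2 sqrr_sign scale1r//.
Qed.

Let flip_unit j W : W \in unitmx -> flip j W \in unitmx.
Proof. by move=> uW; have := uW; rewrite -{1}(flipK j W) unitmx_mul => /andP[]. Qed.

Lemma cdotpZr m (z : 'rV[C]_m) (a : R) (x : 'rV[R]_m) :
  cdotp z (a *: x) = a%:C * cdotp z x.
Proof.
by rewrite /cdotp mulr_sumr; apply: eq_bigr => i _; rewrite mxE rmorphM /= mulrCA.
Qed.

Let cone_transform_flip j W z : cone_transform (flip j W) z = - cone_transform W z.
Proof.
rewrite /cone_transform !gram_volume_sq -mulrN; congr (_%:C * _).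
  rewrite det_mulmx normrM -[RHS]mul1r; congr (_ * _).
  have := congr1 (fun M => `|\det M|) (flipK j 1%:M).
  rewrite /flip mulmx1 det_mulmx det1 normr1 normrM -expr2 => /eqP.
  by rewrite sqrp_eq1// => /eqP.
rewrite (bigD1 j)//= [in RHS](bigD1 j)//= row_flip eqxx expr1 scaleN1r.
rewrite -mulNr; congr (_ * _).
  by rewrite -scaleN1r cdotpZr rmorphN1 mulN1r invrN.
by apply: eq_bigr => i ij; rewrite row_flip (negbTE ij) expr0 scale1r.
Qed.

Let cone_wedge (W : 'M[R]_n.+1) : W \in unitmx ->
  simplicial_cone W = wedge (invmx W)^T 0.
Proof.
move=> uW; apply/seteqP; split=> x.
  by move/(simplicial_coneP _ uW) => x0 i; rewrite dotp_rowE trmxK mxE.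
move=> h; apply/(simplicial_coneP _ uW) => i.
by have := h i; rewrite dotp_rowE trmxK mxE.
Qed.

Let invmxT_free (W : 'M[R]_n.+1) : W \in unitmx -> row_free (invmx W)^T.
Proof. by move=> uW; rewrite row_free_unit unitmx_tr unitmx_inv. Qed.

Let polyhedral_cone (W : 'M[R]_n.+1) : W \in unitmx ->
  polyhedral_function (\1_(simplicial_cone W)).
Proof. by move=> uW; rewrite cone_wedge//; apply: polyhedral_wedge; exact: invmxT_free. Qed.

(** Dropping row j of the dual basis leaves a wedge with n rows, a line-cone; the two cones are its
    parts on either side of the hyperplane of row j, and they overlap in a null set. *)
Let FL_flip j (W : 'M[R]_n.+1) : W \in unitmx ->
  agree setT (T (\1_(simplicial_cone W))) (fun z => - T (\1_(simplicial_cone (flip j W))) z).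
Proof.
move=> uW; have uF := flip_unit j uW.
pose B := (invmx W)^T; have fB : row_free B by exact: invmxT_free.
have fA := row_free_row' j fB.
have BE i x : dotp (row i B) x = (x *m invmx W) ord0 i by rewrite dotp_rowE trmxK.
have invF : invmx (flip j W) = invmx W *m diag_mx (\row_i (-1) ^+ (i == j)).
  have dd : flip j 1%:M *m flip j 1%:M = 1%:M.
    by have := flipK j 1%:M; rewrite /flip mulmx1.
  have uD : diag_mx (\row_i (-1) ^+ (i == j) : 'rV[R]_n.+1) \in unitmx.
    by move: dd; rewrite /flip mulmx1 => /mulmx1_unit[].
  rewrite -[RHS](mulmxK uF) /flip mulmxA -[X in X *m W *m _]mulmxA.
  have -> : diag_mx (\row_i (-1) ^+ (i == j)) *m diag_mx (\row_i (-1) ^+ (i == j))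
    = 1%:M :> 'M[R]_n.+1 by move: dd; rewrite /flip mulmx1.
  by rewrite mulmx1 mulVmx// mul1mx.
have KE x : simplicial_cone W x <-> 0 <= dotp (row j B) x /\ wedge (row' j B) 0 x.
  split=> [/(simplicial_coneP _ uW) h|[hj h]].
    split; first by rewrite BE.
    by move=> i; rewrite mxE row_rowsub BE.
  apply/(simplicial_coneP _ uW) => i; rewrite -BE; case: (unliftP j i) => [k ->|->//].
  by have := h k; rewrite mxE row_rowsub.
have KE' x : simplicial_cone (flip j W) x <-> dotp (row j B) x <= 0 /\ wedge (row' j B) 0 x.
  have FE i : (x *m invmx (flip j W)) ord0 i = dotp (row i B) x * (-1) ^+ (i == j).
    by rewrite invF mulmxA mul_mx_diag BE [LHS]mxE; congr (_ * _); rewrite mxE.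
  split=> [/(simplicial_coneP _ uF) h|[hj h]].
    split; first by have := h j; rewrite FE eqxx expr1 mulrN1 oppr_ge0.
    move=> i; rewrite mxE row_rowsub; have := h (lift j i).
    by rewrite FE eq_sym (negbTE (neq_lift _ _)) mulr1.
  apply/(simplicial_coneP _ uF) => i; rewrite FE; case: (unliftP j i) => [k ->|->].
    by rewrite eq_sym (negbTE (neq_lift _ _)) mulr1; have := h k; rewrite mxE row_rowsub.
  by rewrite eqxx expr1 mulrN1 oppr_ge0.
have sumE : ae_equal (fun x => 1 * \1_(simplicial_cone W) x + \1_(simplicial_cone (flip j W)) x)
    (\1_(wedge (row' j B) 0) : _ -> R).
  have := ae_notin_hyperplane 0 (row_free_row_neq0 j fB); apply: filterS => t tj.
  have ind (P Q : set 'rV[R]_n.+1) (u : 'rV[R]_n.+1) : (P u <-> Q u) -> \1_P u = \1_Q u :> R.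
    by move=> PQ; rewrite !indicE; congr (nat_of_bool _)%:R; apply/idP/idP; rewrite !inE PQ.
  move: tj (KE (row_of_tuple t)) (KE' (row_of_tuple t)); set x := row_of_tuple t => tj k k'.
  case: (ltgtP (dotp (row j B) x) 0) => [xj|xj|//].
    rewrite (ind _ (fun=> False)) ?(ind (simplicial_cone (flip j W)) (wedge (row' j B) 0)).
    - by rewrite indicE memNset ?mulr0 ?add0r.
    - by rewrite k' ltW//; split=> [[]|].
    - by rewrite k leNgt xj; split=> [[]|].
  rewrite (ind _ (wedge (row' j B) 0)) ?(ind (simplicial_cone (flip j W)) (fun=> False)).
  - by rewrite mul1r [X in _ + X]indicE memNset ?addr0.
  - by rewrite k' leNgt xj; split=> [[]|].
  - by rewrite k ltW//; split=> [[]|].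
have P1 := polyhedral_cone uW; have P2 := polyhedral_cone uF.
have P3 := polyhedral_wedge 0 fA.
have Ps := polyhedral_ae sumE P3.
have /mero_eqP h1 := FL_ae TP Ps P3 sumE.
have /mero_eqP h2 := FL_linear TP 1 P1 P2.
have /mero_eqP h3 := FL_line_cone TP (wedge_line_cone 0 fA (ltnSn n)).
have := agree_trans (agree_sym h2) (agree_trans h1 h3).
case=> D [oD dD E]; exists D; split=> // z Dz _.
by have := E z Dz Logic.I; rewrite mul1r => /eqP; rewrite addr_eq0 => /eqP.
Qed.

(** The number k counts the generators whose sign has been freed: [region 0] lies in the region of
    convergence, and [region n.+1] is dense for invertible W. *)
Let region k (W : 'M[R]_n.+1) : set 'rV[C]_n.+1 := [set z | forall i : 'I_n.+1,
  if (i < k)%N then complex.Re (cdotp z (row i W)) != 0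
  else complex.Re (cdotp z (row i W)) < 0].

(* Negating a generator w_j changes the transform by the sign, because the two cones form a
   line-cone, and exchanges the half-spaces Re <z, w_j> < 0 and > 0.  The 2^n sign patterns
   cover a dense open set, so no analytic continuation is needed. *)
Let FL_region k (W : 'M[R]_n.+1) : (k <= n.+1)%N -> W \in unitmx ->
  agree (region k W) (T (\1_(simplicial_cone W))) (cone_transform W).
Proof.
elim: k W => [|k IH] W kn uW.
  have /mero_eq_onP h : mero_eq_on (convergence_region W) (T (\1_(simplicial_cone W)))
      (fun z => cintegral (simplicial_cone W) (fun x => cexp (cdotp z x))).
    by apply: FL_simplicial_cone; rewrite // row_free_unit.
  have sub : region 0 W `<=` convergence_region W.
    move=> z rz; rewrite /convergence_region /=.
    have rz' i : (0 : 'rV[R]_n.+1) ord0 i < dotp (row i W) (- re_row z).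
      rewrite mxE dotpNr oppr_gt0; have := rz i; rewrite ltn0 => h'.
      suff -> : dotp (row i W) (re_row z) = complex.Re (cdotp z (row i W)) by [].
      rewrite /cdotp (raddf_sum (@complex.Re R)); apply: eq_bigr => k _.
      by rewrite [RHS]Re_cmul /= mulr0 subr0 mulrC !mxE.
    apply: filterS (near_wedge rz') => y hy x [t [t0 ->]].
    rewrite dotp_suml sumr_ge0// => i _; rewrite dotpZl mulr_ge0//.
    by have := hy i; rewrite mxE => /ltW.
  apply: agree_trans (agree_sub sub h) _; apply: agree_eq => z rz.
  rewrite (cintegral_simplicial_cone uW) => [|j]; last exact: (rz j).
  by rewrite /cone_transform gram_volume_sq.
pose j := Ordinal kn.
pose pos := [set z : 'rV[C]_n.+1 | 0 < complex.Re (cdotp z (row j W))].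
have sub : region k.+1 W `<=` region k W `|` (region k.+1 W `&` pos).
  move=> z rz; have := rz j; rewrite /= ltnSn => zj.
  case: (ltP 0 (complex.Re (cdotp z (row j W)))) => zj'; [by right|left].
  move=> i; have := rz i; have [ik|ik] := ltnP i k; first by rewrite ltnS (ltnW ik).
  rewrite ltnS leq_eqVlt; have [ij _|ij] := eqVneq (i : nat) k.
    have -> : i = j by exact: val_inj.
    by rewrite lt_neqAle zj.
  by rewrite ltn_neqAle ij/= leqNgt ltn_neqAle eq_sym ij ik.
apply: agree_sub sub _; apply: agree_setU; first exact: IH (ltnW kn) uW.
have subF : region k.+1 W `&` pos `<=` region k (flip j W).
  move=> z [rz zpos] i; rewrite row_flip cdotpZr.
  have [->|ij] := eqVneq i j.
    rewrite ltnn expr1 rmorphN1 mulN1r raddfN /= oppr_lt0; exact: zpos.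
  rewrite expr0 mul1r; have := rz i; rewrite ltnS leq_eqVlt.
  by rewrite (_ : (i : nat) == k = false)//; apply/negbTE; move: ij; apply: contraNN => /eqP ik; apply/eqP/val_inj.
apply: agree_trans (agree_sub (@subsetT _ _) (FL_flip j uW)) _.
have := IH _ (ltnW kn) (flip_unit j uW) => /(agree_sub subF).
case=> D [oD dD E]; exists D; split=> // z Dz zr.
by rewrite E// cone_transform_flip opprK.
Qed.

Lemma FL_cone (W : 'M[R]_n.+1) : W \in unitmx ->
  agree setT (T (\1_(simplicial_cone W))) (cone_transform W).
Proof.
move=> uW; have [|oD dD] := @dense_open_bigcap R n.+1 'I_n.+1 (enum 'I_n.+1) (fun i => re_generic (row i W)).
  move=> i _; split; first exact: open_re_generic.
  by apply: dense_re_generic; apply: row_free_row_neq0; rewrite row_free_unit.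
apply: (agree_dense oD dD); apply: agree_sub (FL_region (leqnn _) uW).
by move=> z zD i; rewrite ltn_ord; apply: zD; rewrite /= mem_enum.
Qed.

Lemma FL_wedge_pos (w : wedge_data R n.+1) :
  agree setT (T (\1_(wedge_set w))) (wedge_transform w).
Proof.
case: w => m A b fA; rewrite /wedge_set /wedge_transform /=.
have [mn|mn] := eqVneq m n.+1; last first.
  have mltn : (m < n.+1)%N.
    by rewrite ltn_neqAle mn -(eqP fA) rank_leq_col.
  have /mero_eqP h := FL_line_cone TP (wedge_line_cone b fA mltn).
  by case: h => D [oD dD E]; exists D; split=> // z Dz _; rewrite E.
subst m; rewrite translate_cone//.
have AW := dual_rowsP fA.
have uW : dual_rows A \in unitmx by case/mulmx1_unit: AW; rewrite unitmx_tr.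
have fW : row_free (dual_rows A) by rewrite row_free_unit.
have /mero_eqP h := FL_translate TP (b *m dual_rows A) fW.
apply: agree_trans h _.
have := FL_cone uW; case=> D [oD dD E]; exists D; split=> // z Dz _.
by rewrite E.
Qed.

End transform.

Section transform_comb.
Variables (R : realType).
Local Notation C := (R[i]^o).

Definition comb_transform n (s : seq (R * wedge_data R n)) (z : 'rV[C]_n) : C :=
  \sum_(p <- s) p.1%:C * wedge_transform p.2 z.

Lemma wedge_transform0 (w : wedge_data R 0) z : wedge_transform w z = 1.
Proof.
case: w => m A b fA; rewrite /wedge_transform /=.
have m0 : m = 0%N by apply/eqP; rewrite -leqn0 -(eqP fA) rank_leq_col.
subst m; rewrite eqxx /cone_transform big_ord0 mulr1 gram_volume_sq det_mx00 normr1 mulr1.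
by rewrite /cdotp big_ord0 cexp0.
Qed.

Lemma FL_comb n (T : ('rV[R]_n -> R) -> ('rV[C]_n -> C)) (f : 'rV[R]_n -> R)
    (s : seq (R * wedge_data R n)) :
  is_Fourier_Laplace T -> ae_equal f (wedge_comb s) ->
  agree setT (T f) (comb_transform s).
Proof.
case: n => [|n] in T f s *.
  (* In R^0 a wedge has no rows, so it is the whole space with transform 1, and an a.e. equality
     holds at the only point. *)
  move=> TP fs; rewrite TP; apply: agree_eq => z _.
  have [x _ fx] := @ae_open _ _ _ (fun x => f x = wedge_comb s x) openT (ex_intro _ 0 Logic.I) fs.
  have x0 : x = 0 by rewrite thinmx0.
  rewrite -x0 fx /wedge_comb /comb_transform rmorph_sum; apply: eq_bigr => p _.
  rewrite wedge_transform0 mulr1 rmorphM /= indicE mem_set ?mulr1// => i.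
  have := leq_trans (ltn_ord i) (eq_leq (esym (eqP (wedge_free p.2)))).
  by rewrite ltnNge (leq_trans (rank_leq_col _)).
move=> TP; elim: s f => [|p s IH] f fs.
  have E : wedge_comb [::] = (fun _ : 'rV[R]_n.+1 => 0 : R).
    by apply/funext => x; rewrite /wedge_comb big_nil.
  have P0 := polyhedral_comb ([::] : seq (R * wedge_data R n.+1)).
  have /mero_eqP h := FL_ae TP (polyhedral_ae fs P0) P0 fs.
  apply: agree_trans h _; rewrite E; apply: agree_trans (FL0 TP) _.
  by apply: agree_eq => z _; rewrite /comb_transform big_nil.
have E : wedge_comb (p :: s) = (fun x => p.1 * \1_(wedge_set p.2) x + wedge_comb s x).
  by apply/funext => x; rewrite /wedge_comb big_cons.
have P0 := polyhedral_comb (p :: s).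
have /mero_eqP h := FL_ae TP (polyhedral_ae fs P0) P0 fs.
have P1 := polyhedral_wedge (wedge_offsets p.2) (wedge_free p.2).
have /mero_eqP h2 := FL_linear TP p.1 P1 (polyhedral_comb s).
apply: agree_trans h _; rewrite E; apply: agree_trans h2 _.
have h3 := agree_comp2 (fun u v => p.1%:C * u + v) (FL_wedge_pos TP p.2) (IH _ (ae_equal_refl _)).
apply: agree_trans h3 _; apply: agree_eq => z _.
by rewrite /comb_transform big_cons.
Qed.

End transform_comb.

(** * Facets of a wedge and signed sections *)

Section isometry.
Variables (R : realType) (n : nat).

Lemma dotp_ge0 m (x : 'rV[R]_m) : 0 <= dotp x x.
Proof. by apply: sumr_ge0 => i _; rewrite -expr2 sqr_ge0. Qed.

Lemma enorm_inj m k (x : 'rV[R]_m) (y : 'rV[R]_k) : enorm x = enorm y -> dotp x x = dotp y y.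
Proof. by move=> /(congr1 (fun r => r ^+ 2)); rewrite !sqr_sqrtr ?dotp_ge0. Qed.

(** After moving the image of 0 to the origin, polarisation shows that inner products are preserved.
    With F formed from the images of the unit vectors, the squared norm of g y - y F then expands to
    0. *)
Lemma isometry_affine (h : oriented_hyperplane R n.+1) (phi : 'rV[R]_n -> 'rV[R]_n.+1) :
  isometric_identification h phi -> exists (q : 'rV[R]_n.+1) (F : 'M[R]_(n, n.+1)),
  [/\ forall y, phi y = q + y *m F, F *m F^T = 1%:M, F *m (normal h)^T = 0 &
      dotp (normal h) q = offset h].
Proof.
move=> [iso rg]; have onh y : dotp (normal h) (phi y) = offset h.
  by rewrite -[_ = _]/(hyperplane_set h (phi y)) -rg; exists y.
pose g y := phi y - phi 0.
have gg x y : dotp (g x - g y) (g x - g y) = dotp (x - y) (x - y).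
  by rewrite /g opprB addrA subrK; apply: enorm_inj; rewrite iso.
have g0 : g 0 = 0 by rewrite /g subrr.
have phiE y : phi y = phi 0 + g y by rewrite /g addrC subrK.
have ng y : dotp (normal h) (g y) = 0 by rewrite /g dotpDr dotpNr !onh subrr.
clearbody g.
have gx x : dotp (g x) (g x) = dotp x x by have := gg x 0; rewrite g0 !subr0.
have gxy x y : dotp (g x) (g y) = dotp x y.
  have := gg x y; rewrite !(dotpDl, dotpDr, dotpNl, dotpNr) !gx.
  by rewrite [dotp (g y) _]dotpC [dotp y x]dotpC; lra.
pose F : 'M[R]_(n, n.+1) := \matrix_i g (delta_mx ord0 i).
have gF y : g y *m F^T = y.
  apply/rowP => i; rewrite -dotp_rowE rowK gxy dotpC dotpE trmx_delta -colE mxE//.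
have FF : F *m F^T = 1%:M.
  by apply/row_matrixP => i; rewrite row_mul rowK gF row1.
have gE y : g y = y *m F.
  apply/eqP; rewrite -subr_eq0 -dotpp_eq0 !(dotpDl, dotpDr, dotpNl, dotpNr) gx.
  rewrite [dotp (y *m F) (g y)]dotpC.
  have -> : dotp (g y) (y *m F) = dotp y y by rewrite !dotpE trmx_mul mulmxA gF.
  have -> : dotp (y *m F) (y *m F) = dotp y y.
    by rewrite !dotpE trmx_mul mulmxA -[y *m F *m F^T]mulmxA FF mulmx1.
  by apply/eqP; ring.
exists (phi 0), F; split=> //.
- by move=> y; rewrite -gE phiE.
- apply/row_matrixP => i; apply/rowP => k; rewrite row_mul rowK (ord1 k) row0 [RHS]mxE.
  by have := ng (delta_mx ord0 i); rewrite dotpC dotpE.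
Qed.

End isometry.

Lemma cdotp_adjoint (R : realType) m k (F : 'M[R]_(m, k)) (z : 'rV[R[i]^o]_m) (x : 'rV[R]_k) :
  cdotp z (x *m F^T) = cdotp (z *m map_mx (real_complex R) F) x.
Proof.
rewrite /cdotp; under eq_bigr => i _ do rewrite mxE rmorph_sum mulr_sumr.
rewrite exchange_big; apply: eq_bigr => j _ /=; rewrite mxE mulr_suml.
by apply: eq_bigr => i _; rewrite !mxE rmorphM /= mulrA mulrAC.
Qed.

Section facets.
Variables (R : realType) (n : nat).
Local Notation C := (R[i]^o).
Variables (nu q : 'rV[R]_n.+1) (c : R) (F : 'M[R]_(n, n.+1)).
Hypotheses (FF : F *m F^T = 1%:M) (Fnu : F *m nu^T = 0) (nunu : dotp nu nu = 1)
           (nuq : dotp nu q = c).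

(** The vector nu and the rows of F form an orthonormal basis, so F^T F is the orthogonal projection
    along nu. *)
Lemma frame_complete : F^T *m F = 1%:M - nu^T *m nu.
Proof.
have nn : nu *m nu^T = 1%:M by rewrite [LHS]mx11_scalar -dotpE nunu.
have nF : nu *m F^T = 0 by rewrite -[LHS]trmxK trmx_mul trmxK Fnu trmx0.
have : col_mx nu F *m (col_mx nu F)^T = 1%:M :> 'M[R]_(1 + n).
  by rewrite tr_col_mx mul_col_row nn nF Fnu FF -scalar_mx_block.
move/mulmx1C; rewrite tr_col_mx mul_row_col => <-.
by rewrite [nu^T *m nu + _]addrC addrK.
Qed.

(* Row j of A x >= b bounds the hyperplane {<nu, x> = c}, on either side. *)
Definition on_plane m (A : 'M[R]_(m, n.+1)) (b : 'rV[R]_m) (j : 'I_m) : bool :=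
  (row j A == dotp (row j A) nu *: nu) && (b ord0 j == dotp (row j A) nu * c).

(** The transform of the wedge with the reciprocal of generator j deleted. Up to the length of
    normal j and the choice of origin, this is the transform of facet j in ambient variables. *)
Definition facet_factor (w : wedge_data R n.+1) (j : 'I_(wedge_size w)) (z : 'rV[C]_n.+1) : C :=
  let W := dual_rows (wedge_normals w) in
  if wedge_size w == n.+1
  then cexp (cdotp z (wedge_offsets w *m W)) * ((gram_volume W)%:C *
        \prod_(i < (wedge_size w).-1) - (cdotp z (row (lift j i) W))^-1)
  else 0.

(** The generators other than j are orthogonal to row j, hence to nu, so F^T carries them
    isometrically to the dual rows of the facet; the remaining normals are projected by F^T, and the
    apex p becomes (p - q) F^T. *)
Lemma facet_wedge (w : wedge_data R n.+1) (j : 'I_(wedge_size w)) :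
  on_plane (wedge_normals w) (wedge_offsets w) j ->
  exists w' : wedge_data R n,
    (forall y, wedge_set w' y <-> forall k, k != j ->
       wedge_offsets w ord0 k <= dotp (row k (wedge_normals w)) (q + y *m F)) /\
    (forall z, wedge_transform w' z = `|dotp (row j (wedge_normals w)) nu|%:C *
       (cexp (- cdotp (z *m map_mx (real_complex R) F) q) *
        facet_factor j (z *m map_mx (real_complex R) F))).
Proof.
case: w j => m A b fA /= j; rewrite /facet_factor /=.
set la := dotp (row j A) nu => /andP[/eqP Aj /eqP bj].
have la0 : la != 0.
  apply/eqP => l0; have := row_free_row_neq0 j fA.
  by rewrite Aj -/la l0 scale0r eqxx.
have AW := dual_rowsP fA; set W := dual_rows A in AW *.
have Wnu : row' j W *m nu^T = 0.
  apply/row_matrixP => k; apply/rowP => u; rewrite (ord1 u) row0 [RHS]mxE row_mul row_rowsub.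
  rewrite -[LHS]dotpE.
  have : (A *m W^T) j (lift j k) = 0 by rewrite AW mxE (negbTE (neq_lift _ _)).
  rewrite (_ : _ j _ = dotp (row j A) (row (lift j k) W)); last first.
    by rewrite mxE; apply: eq_bigr => i _; rewrite !mxE.
  by rewrite Aj -/la dotpZl dotpC => /eqP; rewrite mulf_eq0 (negbTE la0) => /eqP.
have WFF : row' j W *m (F^T *m F) = row' j W.
  by rewrite frame_complete mulmxBr mulmx1 mulmxA Wnu mul0mx subr0.
pose A' := row' j A *m F^T; pose W' := row' j W *m F^T.
have WFFt : F^T *m F *m (row' j W)^T = (row' j W)^T.
  by rewrite -[in RHS]WFF !trmx_mul trmxK.
have AW' : A' *m W'^T = 1%:M.
  rewrite /A' /W' trmx_mul trmxK mulmxA -[_ *m F^T *m F]mulmxA -mulmxA WFFt.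
  by rewrite tr_row' mul_row'_col' AW row'_col'_1.
have fA' : row_free A' by apply/row_freeP; exists W'^T.
pose b' := col' j b - q *m (row' j A)^T.
exists (WedgeData b' fA'); split=> [y|z].
  have E i : (b' ord0 i <= dotp (row i A') y) =
      (b ord0 (lift j i) <= dotp (row (lift j i) A) (q + y *m F)).
    rewrite dotpDr !mxE -/(dotp _ _) lerBlDl; congr (_ <= _ + _).
      by rewrite dotpC; apply: eq_bigr => k _; rewrite !mxE.
    by rewrite !dotp_rowE trmx_mul trmxK mulmxA !mxE; apply: eq_bigr => k _; rewrite !mxE.
  split=> [h k|h i]; last by rewrite /= E; apply: h; rewrite eq_sym neq_lift.
  by case: (unliftP j k) => [i ->|->]; rewrite ?eqxx// -E => _; exact: h.
rewrite /wedge_transform /=; set zF := z *m _.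
have [mn|mn] := eqVneq m n.+1; last first.
  (* The index j makes m positive, so [m.-1 == n] holds exactly when [m == n.+1]. *)
  rewrite ifN ?mulr0// -eqSS prednK//.
  by rewrite (leq_ltn_trans _ (ltn_ord j)).
have -> : m.-1 == n by rewrite mn.
subst m; have W'A' : W'^T *m A' = 1%:M := mulmx1C AW'.
have dualE : dual_rows A' = W'.
  apply: trmx_inj; rewrite -[LHS]mul1mx -W'A' -mulmxA (dual_rowsP fA') mulmx1//.
have A'W' : A'^T *m W' = 1%:M by rewrite -[LHS]trmxK trmx_mul trmxK W'A' trmx1.
set p := b *m W; have pA : p *m A^T = b.
  by rewrite -mulmxA -[W]trmxK -trmx_mul AW trmx1 mulmx1.
have pqnu : (p - q) *m nu^T = 0.
  rewrite [LHS]mx11_scalar -dotpE; suff -> : dotp (p - q) nu = 0 by rewrite raddf0.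
  have : dotp (row j A) p = b ord0 j by rewrite dotp_rowE pA.
  rewrite bj Aj -/la !dotpZl nunu mulr1 => /(mulfI la0) nup.
  by rewrite dotpDl dotpNl dotpC nup [dotp q _]dotpC nuq subrr.
have b'W' : b' *m W' = (p - q) *m F^T.
  have -> : b' = (p - q) *m F^T *m A'^T.
    rewrite trmx_mul trmxK mulmxA -[X in X *m _]mulmxA frame_complete mulmxBr mulmx1.
    rewrite mulmxA pqnu mul0mx subr0 mulmxBl; congr (_ - _).
    apply/rowP => i; rewrite -[in LHS]pA !mxE; apply: eq_bigr => k _; rewrite !mxE//.
  by rewrite -mulmxA A'W' mulmx1.
(* W W^T is inverse to A A^T, and its (j, j) minor is a value of the adjugate. *)
have gramE : gram_volume W' = `|la| * gram_volume W.
  rewrite /gram_volume -sqrtr_sqr -sqrtrM ?sqr_ge0//; congr Num.sqrt.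
  rewrite /W' trmx_mul trmxK mulmxA -[_ *m F^T *m F]mulmxA WFF.
  have -> : row' j W *m (row' j W)^T = row' j (col' j (W *m W^T)).
    by rewrite tr_row' mul_row'_col'.
  set M := W *m W^T.
  have -> : \det (row' j (col' j M)) = (\adj M) j j.
    by rewrite mxE /cofactor -signr_odd oddD addbb mul1r.
  have AM : A *m A^T *m M = 1%:M.
    rewrite /M mulmxA -[A *m A^T *m W]mulmxA.
    have -> : A^T *m W = 1%:M by rewrite -[LHS]trmxK trmx_mul [A^T^T]trmxK (mulmx1C AW) trmx1.
    by rewrite mulmx1.
  have -> : \adj M = \det M *: (A *m A^T).
    by rewrite -[LHS]mul1mx -AM -(mulmxA _ M) mul_mx_adj mul_mx_scalar.
  rewrite mxE mulrC; congr (_ * _).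
  rewrite (_ : (A *m A^T) j j = dotp (row j A) (row j A)); last first.
    by rewrite mxE; apply: eq_bigr => k _; rewrite !mxE.
  by rewrite Aj -/la dotpZl dotpC dotpZl nunu mulr1 expr2.
rewrite dualE /cone_transform gramE b'W' cdotp_adjoint -/zF.
have cB x y : cdotp zF (x - y) = - cdotp zF y + cdotp zF x.
  rewrite /cdotp -sumrN -big_split; apply: eq_bigr => k _.
  by rewrite !mxE rmorphB /= mulrBr addrC.
rewrite cB cexpD rmorphM /=.
have -> : \prod_(i < n) - (cdotp z (row i W'))^-1 =
    \prod_(i < n) - (cdotp zF (row (lift j i) W))^-1.
  apply: eq_bigr => i _; congr (- _^-1).
  by rewrite row_mul cdotp_adjoint row_rowsub.
by rewrite -!mulrA [in LHS](mulrCA (cexp (cdotp zF p))) [LHS]mulrCA.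
Qed.

End facets.

(** * One-sided limits and the jump of a wedge across a hyperplane *)

Section locally_constant.
Variables (R : realType) (n : nat).
Implicit Types (L : seq ('rV[R]_n * R)) (x : 'rV[R]_n) (g : 'rV[R]_n -> R).

Definition off_planes L x := forall p, p \in L -> dotp p.1 x <> p.2.

Definition nonzero_normals L := forall p, p \in L -> p.1 != 0.

Lemma near_off L x : off_planes L x -> \forall y \near x, off_planes L y.
Proof.
have FF : Filter (nbhs x) by exact: nbhs_filter.
elim: L => [|p L IH] h; first by apply: (filterS _ (@filterT _ _ FF)).
have c : dotp p.1 y @[y --> x] --> dotp p.1 x by exact: dotp_continuous.
have hp : \forall y \near x, dotp p.1 y != p.2.
  case: (ltgtP (dotp p.1 x) p.2) => [lt|gt|e]; last by have := h _ (mem_head _ _).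
    by apply: filterS (cvgr_lt _ c _ lt) => y; move/lt_eqF/negbT.
  by apply: filterS (cvgr_gt _ c _ gt) => y; move/gt_eqF/negbT.
have hL : \forall y \near x, off_planes L y by apply: IH => u uL; apply: h; rewrite inE uL orbT.
move: hp hL; apply: filterS2 => y /eqP hp hL u.
by rewrite inE => /predU1P[->//|]; exact: hL.
Qed.

Definition locally_constant_off L g :=
  forall x, off_planes L x -> \forall y \near x, g y = g x.

Lemma near_halfspaces m (a : 'I_m -> 'rV[R]_n) (b : 'I_m -> R) x :
  (forall i, dotp (a i) x <> b i) ->
  \forall y \near x, forall i, (dotp (a i) y <= b i) = (dotp (a i) x <= b i).
Proof.
move=> h; have FF : Filter (nbhs x) by exact: nbhs_filter.
apply: (@filter_forall _ _ (fun i y => (dotp (a i) y <= b i) = (dotp (a i) x <= b i)) _ FF) => i.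
have c : dotp (a i) y @[y --> x] --> dotp (a i) x by exact: dotp_continuous.
case: (ltgtP (dotp (a i) x) (b i)) => [lt|gt|/h//].
  by apply: filterS (cvgr_lt _ c _ lt) => y /ltW.
by apply: filterS (cvgr_gt _ c _ gt) => y; rewrite ltNge => /negbTE.
Qed.

Lemma indicator_comb_locally_constant g : indicator_comb (@convex_polyhedron R n) g ->
  exists2 L, nonzero_normals L & locally_constant_off L g.
Proof.
move=> [m [c [P [hP ->]]]].
have [N hN] := choice hP; pose H i := projT1 (cid (hN i)).
have hH i := projT2 (cid (hN i)); rewrite -/(H _) in hH.
have [ab hab] : exists ab : forall i, 'I_(N i) -> 'rV[R]_n * R, forall i k,
    (ab i k).1 != 0 /\ H i k = [set x | dotp (ab i k).1 x <= (ab i k).2].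
  have hh i k : exists ab : 'rV[R]_n * R, ab.1 != 0 /\ H i k = [set x | dotp ab.1 x <= ab.2].
    by have [a [b [a0 e]]] := (hH i).1 k; exists (a, b).
  by exists (fun i k => projT1 (cid (hh i k))) => i k; exact: projT2 (cid (hh i k)).
exists (flatten [seq [seq ab i k | k <- enum 'I_(N i)] | i <- enum 'I_m]).
  by move=> p /flatten_mapP[i _ /mapP[k _ ->]]; have [] := hab i k.
move=> x hx; have FF : Filter (nbhs x) by exact: nbhs_filter.
have hik i k : dotp (ab i k).1 x <> (ab i k).2.
  apply: hx; apply/flatten_mapP; exists i; first by rewrite mem_enum.
  by apply/mapP; exists k; rewrite ?mem_enum.
have near_all : \forall y \near x, forall i, forall k,
    (dotp (ab i k).1 y <= (ab i k).2) = (dotp (ab i k).1 x <= (ab i k).2).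
  apply: (@filter_forall _ _ (fun i y => forall k,
    (dotp (ab i k).1 y <= (ab i k).2) = (dotp (ab i k).1 x <= (ab i k).2)) _ FF) => i.
  exact: near_halfspaces (hik i).
apply: filterS near_all => y hy; apply: eq_bigr => i _; congr (_ * _).
rewrite !indicE; congr (nat_of_bool _)%:R; have [_ ->] := hH i.
apply/idP/idP; rewrite !inE => h k _; have := h k Logic.I;
  by rewrite -/(H i k) (hab i k).2 /= hy.
Qed.

Lemma locally_constant_off_sub L L' g : {subset L <= L'} ->
  locally_constant_off L g -> locally_constant_off L' g.
Proof. by move=> s h x hx; apply: h => p /s; exact: hx. Qed.

Lemma ae_equal_off L g g' : locally_constant_off L g -> locally_constant_off L g' ->
  ae_equal g g' -> forall x, off_planes L x -> g x = g' x.
Proof.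
move=> h h' gg' x hx; have FF : Filter (nbhs x) by exact: nbhs_filter.
have : \forall y \near x, g y = g x /\ g' y = g' x.
  by have := h' _ hx; have := h _ hx; apply: filterS2.
move=> hn; have [y /interior_subset[<- <-] yy] :=
  @ae_open _ _ _ (fun x => g x = g' x) (open_interior [set y | g y = g x /\ g' y = g' x])
    (ex_intro _ x hn) gg'.
by [].
Qed.

Lemma wedge_fulldim m (A : 'M[R]_(m, n)) (b : 'rV[R]_m) :
  row_free A -> fulldim_polyhedron (wedge A b).
Proof.
move=> fA; split; first exact: wedge_convex.
(* At this point row i of A takes the value b_i + 1. *)
exists ((b + const_mx 1) *m dual_rows A).
apply: (@filterS _ _ (nbhs_filter _) [set y | forall i, b ord0 i < dotp (row i A) y]).
  by move=> y h i; exact: ltW.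
apply: near_wedge => i; rewrite dotp_rowE -mulmxA.
by rewrite -[dual_rows A]trmxK -trmx_mul dual_rowsP// trmx1 mulmx1 !mxE ltrDl.
Qed.

Lemma fulldim_comb (s : seq (R * wedge_data R n)) :
  indicator_comb (@fulldim_polyhedron R n) (wedge_comb s).
Proof.
exists (size s), (fun i => (tnth (in_tuple s) i).1),
  (fun i => wedge_set (tnth (in_tuple s) i).2); split.
  by move=> i; apply: wedge_fulldim; exact: wedge_free.
by apply/funext => x; rewrite /wedge_comb big_tnth.
Qed.

Lemma indicator_comb_sub (Q Q' : set 'rV[R]_n -> Prop) g :
  (forall A, Q A -> Q' A) -> indicator_comb Q g -> indicator_comb Q' g.
Proof. by move=> s [m [c [P [hP ->]]]]; exists m, c, P; split=> // i; apply: s. Qed.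

(** The representative is an unspecified choice; the wedge combination shows that the choice is from
    a nonempty set, so the default 0 is not taken for want of candidates. *)
Lemma fulldim_representativeP f (s : seq (R * wedge_data R n)) : ae_equal f (wedge_comb s) ->
  indicator_comb (@fulldim_polyhedron R n) (fulldim_representative f) /\
  ae_equal (fulldim_representative f) (wedge_comb s).
Proof.
move=> fs; have [h1 h2] : [set g | indicator_comb (@fulldim_polyhedron R n) g /\ ae_equal f g]
    (fulldim_representative f).
  by apply: xgetPex; exists (wedge_comb s); split=> //; exact: fulldim_comb.
by split=> //; exact: ae_equal_trans (ae_equal_sym h2) fs.
Qed.

End locally_constant.

Section one_sided.
Variables (R : realType) (n : nat).
Variables (nu : 'rV[R]_n.+1) (c : R).
Hypothesis nunu : dotp nu nu = 1.
Implicit Types (L : seq ('rV[R]_n.+1 * R)) (x : 'rV[R]_n.+1).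

Definition same_plane (p : 'rV[R]_n.+1 * R) : bool :=
  (p.1 == dotp p.1 nu *: nu) && (p.2 == dotp p.1 nu * c).

Definition generic_on_plane L x := forall p, p \in L -> ~~ same_plane p -> dotp p.1 x <> p.2.

(** In the coordinates of the hyperplane, p has normal [p.1 *m F^T]. If this is nonzero, the trace
    is a null set; if it is zero, p is parallel to the hyperplane and, not being the same plane,
    misses it. *)
Lemma ae_generic L (q : 'rV[R]_n.+1) (F : 'M[R]_(n, n.+1)) : nonzero_normals L ->
  F *m F^T = 1%:M -> F *m nu^T = 0 -> dotp nu q = c ->
  {ae lebesgue_tuple R n, forall t, generic_on_plane L (q + row_of_tuple t *m F)}.
Proof.
move=> + FF Fnu nuq; elim: L => [|p L IH] pL; first by apply: nearW.
have /IH hL : nonzero_normals L by move=> u uL; apply: pL; rewrite inE uL orbT.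
suff hp : {ae lebesgue_tuple R n, forall t, ~~ same_plane p -> dotp p.1 (q + row_of_tuple t *m F) <> p.2}.
  move: hp hL; apply: filterS2 => t hp hL u; rewrite inE => /predU1P[->//|]; exact: hL.
have [hp|] := boolP (same_plane p); first by apply: nearW.
have E y : dotp p.1 (y *m F) = dotp (p.1 *m F^T) y by rewrite !dotpE trmx_mul mulmxA.
have [pF|pF nh] := eqVneq (p.1 *m F^T) 0.
  have p1 : p.1 = dotp p.1 nu *: nu.
    have := congr1 (mulmx^~ F) pF; rewrite -mulmxA (frame_complete FF Fnu nunu) mul0mx.
    rewrite mulmxBr mulmx1 mulmxA => /eqP; rewrite subr_eq0 => /eqP {1}->.
    by rewrite [p.1 *m _]mx11_scalar -dotpE mul_scalar_mx.
  rewrite /same_plane -p1 eqxx /= => p2; apply: nearW => t _.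
  rewrite dotpDr E pF dotp0l addr0 p1 dotpZl nuq.
  by move/esym/eqP; rewrite -[X in X * c]mulr1 -nunu -dotpZl -p1; apply/negP.
have := ae_notin_hyperplane (p.2 - dotp p.1 q) pF; apply: filterS => t h _ e.
by apply: h; rewrite -E -e dotpDr addrC addKr.
Qed.

Lemma cvg_line x (u : 'rV[R]_n.+1) : (x + e *: u) @[e --> (0 : R)^'+] --> x.
Proof.
have h1 : (e *: u) @[e --> (0 : R)^'+] --> (0 : R) *: u.
  by apply: cvg_at_right_filter; exact: scalel_continuous.
have -> : nbhs x = nbhs (x + 0 *: u) by rewrite scale0r addr0.
by apply: cvgD; [exact: cvg_cst|exact: h1].
Qed.

(** The other planes keep a distance from x, and the plane through x itself is left as soon as e >
    0. *)
Lemma near_line L x (s : R) : nonzero_normals L -> s != 0 -> dotp nu x = c -> generic_on_plane L x ->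
  \forall e \near (0 : R)^'+, off_planes L (x + e *: (s *: nu)).
Proof.
move=> pL s0 nux gL.
have ox : off_planes [seq p <- L | ~~ same_plane p] x.
  by move=> p; rewrite mem_filter => /andP[hp pL']; exact: gL.
have h : \forall e \near (0 : R)^'+, off_planes [seq p <- L | ~~ same_plane p] (x + e *: (s *: nu)).
  exact: (@cvg_line x (s *: nu) _ (near_off ox)).
have h0 : \forall e \near (0 : R)^'+, 0 < e by exact: nbhs_right_gt.
move: h h0; apply: filterS2 => e /= h e0 p pL'.
have [hp|hp] := boolP (same_plane p); last by apply: h; rewrite mem_filter hp.
have p0 := pL _ pL'; case/andP: hp => /eqP p1 /eqP p2.
set la := dotp p.1 nu in p1 p2.
have la0 : la != 0 by apply: contraNneq p0 => l0; rewrite p1 l0 scale0r.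
rewrite p1 p2 dotpZl dotpDr !dotpZr nux nunu mulr1 => /(mulfI la0)/eqP.
by rewrite -subr_eq0 addrC addKr mulf_eq0 (negbTE s0) orbF gt_eqF.
Qed.

(** The value of the indicator just off x on side s: a row on the plane is an equality at x and is
    decided by the direction of departure, the others are already decided at x. *)
Definition side_ind (w : wedge_data R n.+1) x (s : R) : bool :=
  [forall k, if on_plane nu c (wedge_normals w) (wedge_offsets w) k
             then 0 <= s * dotp (row k (wedge_normals w)) nu
             else wedge_offsets w ord0 k <= dotp (row k (wedge_normals w)) x].

Definition wedge_rows (w : wedge_data R n.+1) : seq ('rV[R]_n.+1 * R) :=
  [seq (row k (wedge_normals w), wedge_offsets w ord0 k) | k <- enum 'I_(wedge_size w)].

Lemma near_side (w : wedge_data R n.+1) x (s : R) : s != 0 -> dotp nu x = c ->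
  generic_on_plane (wedge_rows w) x ->
  \forall e \near (0 : R)^'+, \1_(wedge_set w) (x + e *: (s *: nu)) = (side_ind w x s)%:R :> R.
Proof.
case: w => m A b fA; rewrite /side_ind /wedge_rows /wedge_set /= => s0 nux gx.
(* Rows on the plane are replaced by the dummy condition 0 <= 1, so that [near_halfspaces] applies
   to the whole family. *)
pose a k := if on_plane nu c A b k then 0 else - row k A.
pose b' k := if on_plane nu c A b k then 1 else - b ord0 k.
have ab k : dotp (a k) x <> b' k.
  rewrite /a /b'; case: ifPn => hk; first by rewrite dotp0l => /esym/eqP; rewrite oner_eq0.
  rewrite dotpNl => /oppr_inj; apply: (gx (row k A, b ord0 k)) => //.
  by apply/mapP; exists k; rewrite ?mem_enum.
have h : \forall e \near (0 : R)^'+, forall k,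
    (dotp (a k) (x + e *: (s *: nu)) <= b' k) = (dotp (a k) x <= b' k).
  exact: (@cvg_line x (s *: nu) _ (near_halfspaces ab)).
have h0 : \forall e \near (0 : R)^'+, 0 < e by exact: nbhs_right_gt.
move: h h0; apply: filterS2 => e /= h e0.
rewrite indicE; congr (nat_of_bool _)%:R; apply/idP/forallP.
  rewrite inE => hw k; have := hw k; have := h k; rewrite /a /b'; case: ifPn => hk.
    case/andP: hk => /eqP p1 /eqP p2 _; set la := dotp _ nu in p1 p2 *; clearbody la.
    rewrite p2 p1 dotpZl dotpDr !dotpZr nux nunu !mulr1 mulrDr lerDl.
    by rewrite mulrCA pmulr_rge0// mulrC.
  by rewrite !dotpNl !lerN2 => ->.
move=> hw; rewrite inE => k; have := hw k; have := h k; rewrite /a /b'; case: ifPn => hk.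
  case/andP: hk => /eqP p1 /eqP p2 _; set la := dotp _ nu in p1 p2 *; clearbody la.
  rewrite p2 p1 dotpZl dotpDr !dotpZr nux nunu !mulr1 mulrDr lerDl.
  by move=> sl; rewrite mulrCA; apply: mulr_ge0; [exact: ltW|rewrite mulrC].
by rewrite !dotpNl !lerN2 => ->.
Qed.

Lemma one_sided_limitE (f : 'rV[R]_n.+1 -> R) (s : seq (R * wedge_data R n.+1)) :
  ae_equal f (wedge_comb s) -> exists2 L, nonzero_normals L &
  forall x sg, dotp nu x = c -> generic_on_plane L x -> sg != 0 ->
    one_sided_limit f x (sg *: nu) = \sum_(p <- s) p.1 * (side_ind p.2 x sg)%:R.
Proof.
move=> fs; have [g0 g0s] := fulldim_representativeP fs.
have conv g : indicator_comb (@fulldim_polyhedron R n.+1) g -> indicator_comb (@convex_polyhedron R n.+1) g.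
  by apply: indicator_comb_sub => A [].
have [L0 pL0 lc0] := indicator_comb_locally_constant (conv _ g0).
have [L1 pL1 lc1] := indicator_comb_locally_constant (conv _ (fulldim_comb s)).
pose L2 := flatten [seq wedge_rows p.2 | p <- s].
(* Off L0 and L1 the chosen representative and the wedge combination are locally constant, hence
   equal; L2 makes x generic for each wedge of s. *)
exists (L0 ++ L1 ++ L2).
  have pL2 : nonzero_normals L2.
    rewrite /L2; elim: (s) => //= p r IH u; rewrite mem_cat => /orP[/mapP[k _ ->]|/IH//].
    exact: row_free_row_neq0 (wedge_free _).
  by move=> p; rewrite !mem_cat => /or3P[/pL0|/pL1|/pL2].
move=> x sg nux gx sg0; rewrite /one_sided_limit.
have gsub L : {subset L <= L0 ++ L1 ++ L2} -> generic_on_plane L x.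
  by move=> sL p /sL; exact: gx.
have near1 : \forall e \near (0 : R)^'+, fulldim_representative f (x + e *: (sg *: nu)) =
    wedge_comb s (x + e *: (sg *: nu)).
  have p01 : nonzero_normals (L0 ++ L1) by move=> p; rewrite mem_cat => /orP[/pL0|/pL1].
  have g01 : generic_on_plane (L0 ++ L1) x.
    by apply: gsub => p; rewrite !mem_cat => /orP[]->; rewrite ?orbT.
  have lc0' : locally_constant_off (L0 ++ L1) (fulldim_representative f).
    by apply: locally_constant_off_sub lc0 => p; rewrite mem_cat => ->.
  have lc1' : locally_constant_off (L0 ++ L1) (wedge_comb s).
    by apply: locally_constant_off_sub lc1 => p; rewrite mem_cat orbC => ->.
  by have := near_line p01 sg0 nux g01; apply: filterS => e; exact: ae_equal_off lc0' lc1' g0s _.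
have near2 : \forall e \near (0 : R)^'+, wedge_comb s (x + e *: (sg *: nu)) =
    \sum_(p <- s) p.1 * (side_ind p.2 x sg)%:R.
  have : {subset flatten [seq wedge_rows p.2 | p <- s] <= L0 ++ L1 ++ L2}.
    by move=> p pL; rewrite !mem_cat pL !orbT.
  elim: (s) => [|p r IH] sub.
    by apply: nearW => e; rewrite /wedge_comb !big_nil.
  have h1 : generic_on_plane (wedge_rows p.2) x by apply: gsub => u up; apply: sub; rewrite /= mem_cat up.
  have h2 := near_side sg0 nux h1.
  have {}h3 : \forall e \near (0 : R)^'+, wedge_comb r (x + e *: (sg *: nu)) =
      \sum_(p <- r) p.1 * (side_ind p.2 x sg)%:R.
    by apply: IH => u ur; apply: sub; rewrite /= mem_cat ur orbT.
  move: h2 h3; apply: filterS2 => e h2 h3.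
  by rewrite /wedge_comb !big_cons h2 -h3.
apply: cvg_lim => //; apply: cvg_near_cst; move: near1 near2; apply: filterS2 => e -> ->.
by [].
Qed.

Definition facet_ind (w : wedge_data R n.+1) (k : 'I_(wedge_size w)) x : bool :=
  [forall (j | j != k), wedge_offsets w ord0 j <= dotp (row j (wedge_normals w)) x].

(** Independence of the rows allows at most one row on the plane, so the sum has at most one term.
    That row holds on just one side, determined by the sign of its slope; without such a row both
    sides agree. *)
Lemma side_indB (w : wedge_data R n.+1) x :
  (side_ind w x 1)%:R - (side_ind w x (-1))%:R =
  \sum_(k | on_plane nu c (wedge_normals w) (wedge_offsets w) k)
     Num.sg (dotp (row k (wedge_normals w)) nu) * (facet_ind k x)%:R :> R.
Proof.
case: w => m A b fA; rewrite /side_ind /facet_ind /=.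
case: (pickP (on_plane nu c A b)) => [k hk|h0]; last first.
  rewrite big_pred0// [X in X - _](_ : _ = [forall j, b ord0 j <= dotp (row j A) x]%:R).
    rewrite [X in _ - X](_ : _ = [forall j, b ord0 j <= dotp (row j A) x]%:R) ?subrr//.
    by congr (nat_of_bool _)%:R; apply: eq_forallb => j; rewrite h0.
  by congr (nat_of_bool _)%:R; apply: eq_forallb => j; rewrite h0.
set la := dotp (row k A) nu.
have la0 : la != 0.
  apply: contraNneq (row_free_row_neq0 k fA) => l0; case/andP: hk => /eqP -> _.
  by rewrite -/la l0 scale0r.
have uk j : on_plane nu c A b j = (j == k).
  apply/idP/eqP => [hj|->//]; apply: contrapT => /eqP jk.
  case/andP: hk => /eqP kE _; case/andP: hj => /eqP jE _.
  have : (delta_mx ord0 j - (dotp (row j A) nu / la) *: delta_mx ord0 k) *m A == 0 :> 'rV_n.+1.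
    by rewrite mulmxBl -scalemxAl -!rowE {1}jE kE -/la scalerA divfK// subrr.
  rewrite mulmx_free_eq0// => /eqP/rowP/(_ j); rewrite !mxE !eqxx (negbTE jk) mulr0 subr0.
  by move/eqP; rewrite oner_eq0.
rewrite (eq_bigl _ _ uk) big_pred1_eq -/la.
have E s : [forall j, if on_plane nu c A b j then 0 <= s * dotp (row j A) nu
   else b ord0 j <= dotp (row j A) x] =
   (0 <= s * la) && [forall (j | j != k), b ord0 j <= dotp (row j A) x].
  apply/forallP/andP => [h|[h1 /forallP h2] j].
    split; first by have := h k; rewrite hk.
    by apply/forallP => j; apply/implyP => jk; have := h j; rewrite uk (negbTE jk).
  by rewrite uk; case: eqVneq => [->//|jk]; have := h2 j; rewrite jk.
rewrite !E mul1r mulN1r oppr_ge0; case: [forall (j | j != k), _]; rewrite ?andbF ?andbT ?mulr0 ?subrr//.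
rewrite mulr1; case: (ltgtP la 0) la0 => [l|l|->]; rewrite ?eqxx// => _.
  by rewrite ltr0_sg// sub0r.
by rewrite gtr0_sg// subr0.
Qed.

Lemma signed_section_formula (h : oriented_hyperplane R n.+1) (f : 'rV[R]_n.+1 -> R)
    (s : seq (R * wedge_data R n.+1)) : normal h = nu -> offset h = c ->
  ae_equal f (wedge_comb s) -> exists2 L, nonzero_normals L &
  forall x, dotp nu x = c -> generic_on_plane L x ->
    signed_section_at f h x = \sum_(p <- s) p.1 *
      \sum_(k | on_plane nu c (wedge_normals p.2) (wedge_offsets p.2) k)
        Num.sg (dotp (row k (wedge_normals p.2)) nu) * (facet_ind k x)%:R.
Proof.
move=> hnu hc fs; have [L pL lim] := one_sided_limitE fs; exists L => // x nux gx.
rewrite /signed_section_at hnu -(scale1r nu) -scaleNr !lim ?oppr_eq0 ?oner_neq0//.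
rewrite -sumrB; apply: eq_bigr => p _.
by rewrite -mulrBr side_indB scale1r.
Qed.

End one_sided.

(** * Decay and almost periodicity *)

Section pointwise_continuity.
Variables (R : realType) (n : nat).
Local Notation C := (R[i]^o).
Implicit Types (F G : 'rV[C]_n -> C) (z : 'rV[C]_n).

Lemma continuous_at_sum (I : Type) (r : seq I) (P : pred I) (F : I -> 'rV[C]_n -> C) z :
  (forall i, P i -> {for z, continuous (F i)}) ->
  {for z, continuous (fun y => \sum_(i <- r | P i) F i y)}.
Proof.
move=> h; have FF : Filter (nbhs z) by exact: nbhs_filter.
exact: (@cvg_big C I +%R 0 P (@add_continuous C) _ (nbhs z) r F (fun i => F i z) FF h).
Qed.

Lemma continuous_at_mul F G z : {for z, continuous F} -> {for z, continuous G} ->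
  {for z, continuous (fun y => F y * G y)}.
Proof.
move=> hF hG; have FF : Filter (nbhs z) by exact: nbhs_filter.
exact: (@cvgM _ _ (nbhs z) FF F G (F z) (G z) hF hG).
Qed.

Lemma continuous_at_prod (I : Type) (r : seq I) (P : pred I) (F : I -> 'rV[C]_n -> C) z :
  (forall i, P i -> {for z, continuous (F i)}) ->
  {for z, continuous (fun y => \prod_(i <- r | P i) F i y)}.
Proof.
move=> h; have FF : Filter (nbhs z) by exact: nbhs_filter.
exact: (@cvg_big C I *%R 1 P (@mul_continuous C) _ (nbhs z) r F (fun i => F i z) FF h).
Qed.

Lemma continuous_at_cst (a : C) z : {for z, continuous (fun=> a)}.
Proof.
have FF : Filter (nbhs z) by exact: nbhs_filter.
exact: cvg_cst.
Qed.

Lemma continuous_at_Ninv F z : F z != 0 -> {for z, continuous F} ->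
  {for z, continuous (fun y => - (F y)^-1)}.
Proof.
move=> F0 hF; have FF : Filter (nbhs z) by exact: nbhs_filter.
exact: (cvgN (@cvgV _ _ (nbhs z) FF F (F z) F0 hF)).
Qed.

Lemma continuous_at_cexp F z : {for z, continuous F} ->
  {for z, continuous (fun y => cexp (F y) : C)}.
Proof.
move=> hF; have FF : Filter (nbhs z) by exact: nbhs_filter.
exact: (cvg_comp _ _ hF (@cexp_continuous R (F z))).
Qed.

End pointwise_continuity.

Section almost_periodic.
Variable R : realType.
Local Notation C := (R[i]).
Implicit Types (u v : R -> C).

Definition vanishing u := forall e : R, 0 < e -> exists M, forall s, M <= s -> normc (u s) < e.

Lemma normc_ge0 (x : C) : 0 <= normc x.
Proof. by case: x => a b; exact: sqrtr_ge0. Qed.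

Lemma eq_vanishing u v : u =1 v -> vanishing u -> vanishing v.
Proof. by move=> /funext ->. Qed.

Lemma vanishing0 : vanishing (fun=> 0).
Proof. by move=> e e0; exists 0 => s _; rewrite normc0. Qed.

Lemma vanishingD u v : vanishing u -> vanishing v -> vanishing (fun s => u s + v s).
Proof.
move=> hu hv e e0; have e2 : 0 < e / 2 by rewrite divr_gt0.
have [M hM] := hu _ e2; have [N hN] := hv _ e2.
exists (Num.max M N) => s; rewrite ge_max => /andP[sM sN].
by rewrite (le_lt_trans (le_normcD _ _))// [ltRHS](splitr e) ltrD ?hM ?hN.
Qed.

Lemma vanishing_sum (I : Type) (r : seq I) (P : pred I) (u : I -> R -> C) :
  (forall i, P i -> vanishing (u i)) -> vanishing (fun s => \sum_(i <- r | P i) u i s).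
Proof.
move=> h; elim: r => [|i r IH].
  by apply: eq_vanishing vanishing0 => s; rewrite big_nil.
have [Pi|nPi] := boolP (P i).
  by apply: eq_vanishing (vanishingD (h i Pi) IH) => s; rewrite big_cons Pi.
by apply: eq_vanishing IH => s; rewrite big_cons (negbTE nPi).
Qed.

Lemma vanishingM (K : R) u v : (forall s, normc (v s) <= K) -> vanishing u ->
  vanishing (fun s => v s * u s).
Proof.
move=> hK hu e e0.
have K0 : 0 < `|K| + 1 by rewrite ltr_wpDl.
have [M hM] := hu (e / (`|K| + 1)) (divr_gt0 e0 K0).
exists M => s sM; rewrite normcM.
rewrite (@le_lt_trans _ _ ((`|K| + 1) * normc (u s)))//.
  rewrite ler_wpM2r ?normc_ge0// (le_trans (hK s))// (le_trans (ler_norm _))// lerDl//.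
by rewrite mulrC -ltr_pdivlMr// hM.
Qed.

Lemma vanishingZ (a : C) u : vanishing u -> vanishing (fun s => a * u s).
Proof. exact: (@vanishingM (normc a)). Qed.

Lemma vanishing_shift (t : R) u : vanishing u -> vanishing (fun s => u (s + t)).
Proof.
move=> hu e e0; have [M hM] := hu e e0; exists (M - t) => s.
by rewrite lerBlDr => /hM.
Qed.

Lemma vanishing_cst (a : C) : vanishing (fun=> a) -> a = 0.
Proof.
move=> h; apply: eq0_normc; apply: contrapT => /eqP a0.
have ap : 0 < normc a by rewrite lt_neqAle eq_sym a0 normc_ge0.
by have [M /(_ M (lexx _))] := h _ ap; rewrite ltxx.
Qed.

Definition wave (b s : R) : C := cexp (0 +i* (b * s)).

Lemma waveD b s t : wave b (s + t) = wave b s * wave b t.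
Proof. by rewrite -cexpD; congr cexp; rewrite mulrDr; simpc. Qed.

Lemma normc_wave b s : normc (wave b s) = 1.
Proof. by rewrite /wave /cexp /= expR0 !mul1r cos2Dsin2 sqrtr1. Qed.

Lemma wave_neq0 b s : wave b s != 0.
Proof. by apply/eqP => e; have := normc_wave b s; rewrite e normc0 => /esym/eqP; rewrite oner_eq0. Qed.

Lemma wave_half_turn b b' : b' != b ->
  wave b (pi / (b' - b)) - wave b' (pi / (b' - b)) = 2 * wave b (pi / (b' - b)).
Proof.
move=> bb; set t := pi / (b' - b).
have -> : wave b' t = - wave b t.
  rewrite /wave; have -> : b' * t = b * t + pi.
    by rewrite /t; field; rewrite subr_eq0.
  rewrite /cexp /= cosDpi sinDpi !mulrN.
  by simpc.
by rewrite opprK mulr_natl mulr2n.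
Qed.

(* The difference u(s + t) - exp(i b0 t) u(s) kills the frequency b0; t is a half-period of
   b0 - c, so that frequency c is kept with factor 2 exp(i c t). *)
Lemma almost_periodic (T : Type) (r : seq T) (y : T -> C) (be : T -> R) (c : R) :
  vanishing (fun s => \sum_(k <- r) y k * wave (be k) s) ->
  \sum_(k <- r | be k == c) y k = 0.
Proof.
have [m] := ubnP (size r); elim: m => // m IH in r y *; rewrite ltnS => rm h.
have [/hasP[b0 b0r b0c]|hb] := boolP (has (fun b => b != c) [seq be k | k <- r]); last first.
  (* Only the frequency c is present: dividing by its wave leaves a constant that tends to 0. *)
  have E s : \sum_(k <- r) y k * wave (be k) s = wave c s * \sum_(k <- r | be k == c) y k.
    move: hb; rewrite has_map -all_predC; elim: (r) => [|k r' IHr] /=; first by rewrite !big_nil mulr0.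
    by rewrite negbK => /andP[/eqP kc /IHr {}IHr]; rewrite !big_cons kc eqxx IHr mulrDr mulrC.
  apply: vanishing_cst.
  have v1 s : normc (wave c (- s)) <= 1 by rewrite normc_wave.
  apply: eq_vanishing (vanishingM v1 h) => s.
  by rewrite E mulrA -waveD addNr /wave mulr0 cexp0 mul1r.
pose t := pi / (b0 - c); pose y' k := y k * (wave (be k) t - wave b0 t).
have y'0 k : be k == b0 -> y' k = 0 by move=> /eqP kb; rewrite /y' kb subrr mulr0.
have h' : vanishing (fun s => \sum_(k <- [seq k <- r | be k != b0]) y' k * wave (be k) s).
  have := vanishingD (vanishing_shift t h) (vanishingZ (- wave b0 t) h).
  apply: eq_vanishing => s; rewrite big_filter [RHS]big_mkcond mulr_sumr -big_split /=.
  apply: eq_bigr => k _; case: ifPn => [_|]; last rewrite negbK => kb.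
    by rewrite waveD /y'; ring.
  by rewrite waveD (eqP kb); ring.
have sz : (size [seq k <- r | be k != b0] < m)%N.
  apply: leq_trans rm; rewrite size_filter -(count_predC (fun k => be k != b0) r).
  rewrite -addn1 leq_add2l -has_count.
  have : has (pred1 b0) [seq be k | k <- r] by rewrite has_pred1.
  by rewrite has_map; apply: sub_has => k /=; rewrite negbK.
have := IH _ y' sz h'; rewrite big_filter_cond.
have -> : \sum_(k <- r | (be k != b0) && (be k == c)) y' k =
    (2 * wave c t) * \sum_(k <- r | be k == c) y k.
  rewrite mulr_sumr; apply: eq_big => k; first by case: eqVneq => //= ->; rewrite (negbTE b0c).
  by case/andP => _ /eqP kc; rewrite /y' kc wave_half_turn// mulrC.
by move/eqP; rewrite mulf_eq0 mulf_eq0 pnatr_eq0 (negbTE (wave_neq0 _ _)) => /eqP.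
Qed.

Lemma vanishing_inv (a : C) (b : R) : b != 0 ->
  vanishing (fun s => - (a + 0 +i* (s * b))^-1).
Proof.
move=> b0 e e0; exists ((e^-1 + `|complex.Im a| + 1) / `|b|) => s.
rewrite ler_pdivrMr ?normr_gt0// => hs.
rewrite normcN normcV.
have h1 : `|complex.Im (a + 0 +i* (s * b))| <= normc (a + 0 +i* (s * b)).
  case: (a) => x y /=; rewrite -sqrtr_sqr; apply: ler_wsqrtr.
  by rewrite lerDr sqr_ge0.
have h2 : e^-1 < `|complex.Im (a + 0 +i* (s * b))|.
  have -> : complex.Im (a + 0 +i* (s * b)) = s * b - - complex.Im a.
    by case: (a) => x y /=; ring.
  rewrite (lt_le_trans _ (lerB_normD _ _))// !normrN normrM.
  have s0 : `|s| * `|b| >= s * `|b| by rewrite ler_wpM2r// ler_norm.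
  lra.
have p0 : 0 < normc (a + 0 +i* (s * b)).
  by rewrite (lt_le_trans _ h1)// (lt_trans _ h2)// invr_gt0.
by rewrite -[e]invrK ltf_pV2 ?posrE ?invr_gt0// (lt_le_trans h2).
Qed.

End almost_periodic.

(** * The divergence identity *)

Section combination.
Variables (R : realType) (n : nat).
Local Notation C := (R[i]^o).

Lemma dual_rows_free m k (A : 'M[R]_(m, k)) : row_free A -> row_free (dual_rows A).
Proof.
move=> fA; apply/row_freeP; exists A^T.
by rewrite -[LHS]trmxK trmx_mul trmxK dual_rowsP// trmx1.
Qed.

(** Expand v = sum_k <a_k, v> w_k in the basis dual to the rows a_k; the factor <z, w_k> cancels the
    reciprocal of generator k and leaves the facet factor with a minus sign. *)
Lemma cdotp_wedge_transform (w : wedge_data R n.+1) (z : 'rV[C]_n.+1) (v : 'rV[R]_n.+1) :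
  (forall k, cdotp z (row k (dual_rows (wedge_normals w))) != 0) ->
  cdotp z v * wedge_transform w z =
  - \sum_k (dotp (row k (wedge_normals w)) v)%:C * facet_factor k z.
Proof.
case: w => m A b fA; rewrite /wedge_transform /facet_factor /= => h.
have [mn|_] := eqVneq m n.+1; last first.
  by rewrite mulr0 big1 ?oppr0// => k _; rewrite mulr0.
subst m; have AW := dual_rowsP fA; set W := dual_rows A in h AW *.
have AW' : A^T *m W = 1%:M.
  by rewrite -[LHS]trmxK trmx_mul [A^T^T]trmxK (mulmx1C AW) trmx1.
rewrite -[in LHS](mulmx1 v) -AW' mulmxA cdotp_mul /cone_transform.
rewrite mulr_suml -sumrN; apply: eq_bigr => k _.
rewrite -dotp_rowE (bigD1_ord k) //= -mulNr.
set P := \prod_(i < n) _; set e := cexp _; set g := (gram_volume W)%:C; set d := (dotp _ v)%:C.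
have zk := h k; set u := cdotp z (row k W) in zk *.
transitivity (- (u * u^-1) * (d * (e * (g * P)))).
  by ring.
by rewrite divff// mulN1r mulNr.
Qed.

Variable s : seq (R * wedge_data R n.+1).

Let N := size s.
Let co (i : 'I_N) : R := (tnth (in_tuple s) i).1.
Let w (i : 'I_N) : wedge_data R n.+1 := (tnth (in_tuple s) i).2.

Definition facet_index : finType := {i : 'I_N & 'I_(wedge_size (w i))}.
Implicit Type x : facet_index.

Definition facet_normal x : 'rV[R]_n.+1 := row (tagged x) (wedge_normals (w (tag x))).
Definition facet_offset x : R := wedge_offsets (w (tag x)) ord0 (tagged x).
Definition facet_term x (z : 'rV[C]_n.+1) : C := (co (tag x))%:C * facet_factor (tagged x) z.
Definition dual_vector x : 'rV[R]_n.+1 := row (tagged x) (dual_rows (wedge_normals (w (tag x)))).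

Definition generic_point : set 'rV[C]_n.+1 :=
  [set z | forall x, complex.Re (cdotp z (dual_vector x)) != 0].

Definition in_plane (nu : 'rV[R]_n.+1) (c : R) x : bool :=
  same_plane nu c (facet_normal x, facet_offset x).

(** The F_h of the overview for h = {<nu, x> = c}, expressed without a frame of h. A row la nu of
    either orientation enters with weight la, whose sign is that of the jump. *)
Definition plane_transform (nu : 'rV[R]_n.+1) (c : R) (z : 'rV[C]_n.+1) : C :=
  \sum_(x | in_plane nu c x) (dotp (facet_normal x) nu)%:C * facet_term x z.

Lemma dual_vector_neq0 x : dual_vector x != 0.
Proof. apply: row_free_row_neq0; apply: dual_rows_free; exact: wedge_free. Qed.

Lemma facet_normal_neq0 x : facet_normal x != 0.
Proof. exact: row_free_row_neq0 (wedge_free _). Qed.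

Lemma generic_point_open_dense : open generic_point /\ dense generic_point.
Proof.
have -> : generic_point = \bigcap_(x in [set` enum facet_index]) re_generic (dual_vector x).
  by apply/seteqP; split=> z h x; [move=> _; exact: h|apply: h; rewrite /= mem_enum].
apply: dense_open_bigcap => x _; split; first exact: open_re_generic.
exact/dense_re_generic/dual_vector_neq0.
Qed.

Lemma generic_point_neq0 z i k : generic_point z ->
  cdotp z (row k (dual_rows (wedge_normals (w i)))) != 0.
Proof.
move=> /(_ (Tagged (fun i => 'I_(wedge_size (w i))) k)); rewrite /dual_vector /=.
by apply: contraNneq => ->.
Qed.

Lemma comb_transformE z : comb_transform s z = \sum_i (co i)%:C * wedge_transform (w i) z.
Proof. by rewrite /comb_transform big_tnth. Qed.

Lemma comb_transform_continuous z : generic_point z -> {for z, continuous (comb_transform s)}.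
Proof.
move=> hz; have -> : comb_transform s = (fun z => \sum_i (co i)%:C * wedge_transform (w i) z).
  by apply/funext => y; exact: comb_transformE.
apply: continuous_at_sum => i _; apply: continuous_at_mul; first exact: continuous_at_cst.
rewrite /wedge_transform; case: (wedge_size (w i) == n.+1); last exact: continuous_at_cst.
apply: continuous_at_mul; first by apply: continuous_at_cexp; exact: cdotp_continuous.
apply: continuous_at_mul; first exact: continuous_at_cst.
apply: continuous_at_prod => k _; apply: continuous_at_Ninv; last exact: cdotp_continuous.
exact: generic_point_neq0.
Qed.

Lemma comb_transform_zero :
  agree setT (comb_transform s) (fun=> 0) <-> (forall z, generic_point z -> comb_transform s z = 0).
Proof.
have [oG dG] := generic_point_open_dense; split=> [[D [oD dD E]] z gz|h].
  apply: (dense_eq0 oD dD); last exact: comb_transform_continuous.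
  by move=> y Dy; exact: E.
by apply: (agree_dense oG dG); exact: agree_eq.
Qed.

Lemma divergence_identity z v : generic_point z ->
  cdotp z v * comb_transform s z =
  - \sum_x (dotp (facet_normal x) v)%:C * facet_term x z.
Proof.
move=> gz; rewrite comb_transformE mulr_sumr.
transitivity (- \sum_i \sum_k (dotp (row k (wedge_normals (w i))) v)%:C *
  ((co i)%:C * facet_factor k z)); last by rewrite sig_big_dep.
rewrite -sumrN; apply: eq_bigr => i _; rewrite mulrCA cdotp_wedge_transform.
  by rewrite mulrN mulr_sumr; congr (- _); apply: eq_bigr => k _; rewrite mulrCA.
by move=> k; exact: generic_point_neq0.
Qed.

End combination.

(** * Sums over the facets lying in one hyperplane *)

Section plane.
Variables (R : realType) (n : nat).
Local Notation C := (R[i]^o).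
Variables (s : seq (R * wedge_data R n.+1)).
Variables (nu q : 'rV[R]_n.+1) (c : R) (F : 'M[R]_(n, n.+1)).
Hypotheses (FF : F *m F^T = 1%:M) (Fnu : F *m nu^T = 0) (nunu : dotp nu nu = 1)
           (nuq : dotp nu q = c).
Implicit Types (x : facet_index s).
Local Notation w i := (tnth (in_tuple s) i).2.
Local Notation cplx M := (map_mx (real_complex R) M).

Lemma in_plane_slope_neq0 x : in_plane nu c x -> dotp (facet_normal x) nu != 0.
Proof.
case/andP => /eqP e _; apply: contraNneq (facet_normal_neq0 x) => l0.
by rewrite [facet_normal x]e /= l0 scale0r.
Qed.

Lemma dual_orthogonal (u : wedge_data R n.+1) (j k : 'I_(wedge_size u)) (la : R) :
  row j (wedge_normals u) = la *: nu -> la != 0 -> k != j ->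
  dotp (row k (dual_rows (wedge_normals u))) nu = 0.
Proof.
move=> jE la0 kj.
have e : (wedge_normals u *m (dual_rows (wedge_normals u))^T) j k = 0.
  by rewrite (dual_rowsP (wedge_free u)) mxE eq_sym (negbTE kj).
have : dotp (row j (wedge_normals u)) (row k (dual_rows (wedge_normals u))) = 0.
  by rewrite -e mxE; apply: eq_bigr => i _; rewrite !mxE.
by rewrite jE dotpZl dotpC => /eqP; rewrite mulf_eq0 (negbTE la0) => /eqP.
Qed.

Lemma in_planeE x : in_plane nu c x ->
  facet_normal x = dotp (facet_normal x) nu *: nu /\
  facet_offset x = dotp (facet_normal x) nu * c.
Proof. by case/andP => /eqP e1 /eqP e2; split. Qed.

Lemma dual_orthogonal_plane x k : in_plane nu c x -> k != tagged x ->
  dotp (row k (dual_rows (wedge_normals (w (tag x))))) nu = 0.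
Proof.
move=> hx; have [e _] := in_planeE hx.
exact: dual_orthogonal e (in_plane_slope_neq0 hx).
Qed.

Lemma apex_in_plane x : in_plane nu c x ->
  dotp (wedge_offsets (w (tag x)) *m dual_rows (wedge_normals (w (tag x)))) nu = c.
Proof.
move=> hx; have [e1 e2] := in_planeE hx; have := in_plane_slope_neq0 hx.
move: e1 e2; set la := dotp _ nu; clearbody la => e1 e2 la0; set p := _ *m _.
have : dotp (facet_normal x) p = facet_offset x.
  rewrite /facet_normal dotp_rowE -mulmxA -[dual_rows _]trmxK -trmx_mul.
  by rewrite dual_rowsP ?trmx1 ?mulmx1//; exact: wedge_free.
by rewrite e1 e2 dotpZl dotpC => /(mulfI la0).
Qed.

Lemma cdotp_proj (z : 'rV[C]_n.+1) v :
  cdotp (z *m cplx F^T *m cplx F) v = cdotp z v - (dotp v nu)%:C * cdotp z nu.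
Proof.
rewrite -(cdotp_adjoint F); have := cdotp_adjoint F^T z (v *m F^T); rewrite trmxK => <-.
rewrite -mulmxA (frame_complete FF Fnu nunu) mulmxBr mulmx1 mulmxA.
rewrite [v *m nu^T]mx11_scalar -dotpE mul_scalar_mx -cdotpZr.
rewrite /cdotp -sumrB; apply: eq_bigr => i _.
by rewrite !mxE rmorphB /= mulrBr.
Qed.

(** The apexes lie on {<nu, x> = c} and the remaining generators are orthogonal to nu, so <z, nu>
    enters only through a common exponential. *)
Lemma plane_transform_shift (z : 'rV[C]_n.+1) :
  plane_transform s nu c z =
  cexp (c%:C * cdotp z nu) * plane_transform s nu c (z *m cplx F^T *m cplx F).
Proof.
rewrite /plane_transform mulr_sumr; apply: eq_bigr => x hx.
rewrite [RHS]mulrCA; congr (_ * _); rewrite /facet_term [RHS]mulrCA; congr (_ * _).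
rewrite /facet_factor; case: (_ == n.+1); last by rewrite mulr0.
rewrite [RHS]mulrA; congr (_ * (_ * _)).
  by rewrite cdotp_proj apex_in_plane// -cexpD addrC subrK.
apply: eq_bigr => k _; rewrite cdotp_proj dual_orthogonal_plane// ?mul0r ?subr0//.
by rewrite eq_sym neq_lift.
Qed.

(** Restricted to dual vectors orthogonal to nu: the denominators on the plane involve only these,
    and projecting a transverse one may give 0. *)
Definition section_generic : set 'rV[C]_n :=
  [set z | forall x, dotp (dual_vector x) nu = 0 ->
    complex.Re (cdotp z (dual_vector x *m F^T)) != 0].

Lemma section_generic_open_dense : open section_generic /\ dense section_generic.
Proof.
pose r := [seq x <- enum (facet_index s) | dotp (dual_vector x) nu == 0].
have -> : section_generic = \bigcap_(x in [set` r]) re_generic (dual_vector x *m F^T).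
  apply/seteqP; split=> z h x.
    by rewrite /= mem_filter => /andP[/eqP e _]; exact: h.
  by move=> e; apply: h; rewrite /= mem_filter e eqxx mem_enum.
apply: dense_open_bigcap => x; rewrite mem_filter => /andP[/eqP e _].
split; first exact: open_re_generic.
apply: dense_re_generic; apply: contraNneq (dual_vector_neq0 x) => e'.
have := congr1 (mulmx^~ F) e'; rewrite -mulmxA (frame_complete FF Fnu nunu) mul0mx.
rewrite mulmxBr mulmx1 mulmxA [_ *m nu^T]mx11_scalar -dotpE e raddf0 mul0mx subr0.
by move=> ->.
Qed.

Lemma plane_transform_continuous z : section_generic z ->
  {for z, continuous (fun y : 'rV[C]_n => plane_transform s nu c (y *m cplx F) : C)}.
Proof.
move=> hz; apply: continuous_at_sum => x hx; apply: continuous_at_mul; first exact: continuous_at_cst.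
apply: continuous_at_mul; first exact: continuous_at_cst.
rewrite /facet_factor; case: (_ == n.+1); last exact: continuous_at_cst.
have cl v : {for z, continuous (fun y : 'rV[C]_n => cdotp (y *m cplx F) v : C)}.
  have -> : (fun y : 'rV[C]_n => cdotp (y *m cplx F) v : C) = (fun y => cdotp y (v *m F^T)).
    by apply/funext => y; rewrite cdotp_adjoint.
  exact: cdotp_continuous.
apply: continuous_at_mul; first exact: continuous_at_cexp.
apply: continuous_at_mul; first exact: continuous_at_cst.
apply: continuous_at_prod => k _; apply: continuous_at_Ninv => //.
set u := row _ _; have : dotp u nu = 0.
  by apply: dual_orthogonal_plane => //; rewrite eq_sym neq_lift.
pose x' : facet_index s := Tagged (fun i => 'I_(wedge_size (w i))) (lift (tagged x) k).
move=> /(hz x'); rewrite cdotp_adjoint; apply: contraNneq => e.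
by rewrite /dual_vector /= -/u e.
Qed.

End plane.

Section section_transform.
Variables (R : realType) (n : nat).
Local Notation C := (R[i]^o).
Variables (s : seq (R * wedge_data R n.+1)).
Variables (nu q : 'rV[R]_n.+1) (c : R) (F : 'M[R]_(n, n.+1)).
Hypotheses (FF : F *m F^T = 1%:M) (Fnu : F *m nu^T = 0) (nunu : dotp nu nu = 1)
           (nuq : dotp nu q = c).
Implicit Types (x : facet_index s).
Local Notation co i := (tnth (in_tuple s) i).1.
Local Notation w i := (tnth (in_tuple s) i).2.
Local Notation cplx M := (map_mx (real_complex R) M).

(** The sign of the jump and the factor [|la|] from the volume of the facet combine to the slope la.
    Facets off the plane get the empty list, so that a list can be chosen for every x. *)
Lemma facet_comb x : exists r : seq (R * wedge_data R n),
  (forall y, wedge_comb r y = if in_plane nu c x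
     then co (tag x) * (Num.sg (dotp (facet_normal x) nu) *
            (facet_ind (tagged x) (q + y *m F))%:R) else 0) /\
  (forall z : 'rV[C]_n, comb_transform r z = if in_plane nu c x
     then cexp (- cdotp (z *m cplx F) q) *
          ((dotp (facet_normal x) nu)%:C * facet_term x (z *m cplx F)) else 0).
Proof.
case hx : (in_plane nu c x); last first.
  by exists [::]; split=> y; rewrite /wedge_comb /comb_transform big_nil.
have [w' [setE trE]] := facet_wedge FF Fnu nunu nuq (hx : on_plane nu c _ _ (tagged x)).
exists [:: (co (tag x) * Num.sg (dotp (facet_normal x) nu), w')]; split=> y.
  rewrite /wedge_comb big_seq1 /= -mulrA; congr (_ * (_ * _)).
  rewrite indicE; congr (nat_of_bool _)%:R; apply/idP/forallP.
    by rewrite inE => /setE h j; apply/implyP; exact: h.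
  by move=> h; rewrite inE; apply/setE => j jk; have := h j; rewrite jk.
rewrite /comb_transform big_seq1 /= trE /facet_term -/(facet_normal x).
set la := dotp (facet_normal x) nu.
have -> : la%:C = (Num.sg la)%:C * `|la|%:C by rewrite -rmorphM /= -numEsg.
rewrite rmorphM /=; set e := cexp _; set f := facet_factor _ _.
by ring.
Qed.

Lemma section_comb (h : oriented_hyperplane R n.+1) (phi : 'rV[R]_n -> 'rV[R]_n.+1)
    (f : 'rV[R]_n.+1 -> R) :
  normal h = nu -> offset h = c -> (forall y, phi y = q + y *m F) ->
  ae_equal f (wedge_comb s) -> exists2 r : seq (R * wedge_data R n),
    ae_equal (signed_section f h phi) (wedge_comb r) &
    forall z : 'rV[C]_n, comb_transform r z =
       cexp (- cdotp (z *m cplx F) q) * plane_transform s nu c (z *m cplx F).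
Proof.
move=> hnu hc phiE fs.
have [r rP] := choice facet_comb.
exists (flatten [seq r x | x <- enum (facet_index s)]); last first.
  move=> z; transitivity (\sum_x comb_transform (r x) z).
    by rewrite /comb_transform big_flatten big_map big_enum.
  rewrite /plane_transform mulr_sumr [RHS]big_mkcond; apply: eq_bigr => x _.
  by rewrite (rP x).2.
have [L nL secE] := signed_section_formula nunu hnu hc fs.
have := ae_generic nunu nL FF Fnu nuq; apply: filterS => t gt.
rewrite /signed_section phiE secE//; last first.
  by rewrite dotpDr nuq dotpE trmx_mul mulmxA -[nu *m F^T]trmxK trmx_mul trmxK Fnu trmx0 mul0mx mxE addr0.
transitivity (\sum_x wedge_comb (r x) (row_of_tuple t)); last first.
  by rewrite /wedge_comb big_flatten big_map big_enum.
under [RHS]eq_bigr => x _ do rewrite (rP x).1.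
rewrite -big_mkcond [LHS]big_tnth /=; under eq_bigr => i _ do rewrite mulr_sumr.
exact: (@sig_big_dep _ _ _ _ (fun i => 'I_(wedge_size (w i))) xpredT
  (fun i k => on_plane nu c (wedge_normals (w i)) (wedge_offsets (w i)) k)
  (fun i k => co i * (Num.sg (dotp (row k (wedge_normals (w i))) nu) *
     (facet_ind k (q + row_of_tuple t *m F))%:R))).
Qed.

End section_transform.

Lemma cexp_neq0 (R : realType) (z : R[i]^o) : cexp z != 0.
Proof.
apply/eqP => e; have := cexpD z (- z); rewrite subrr cexp0 e mul0r => /eqP.
by rewrite oner_eq0.
Qed.

Section product_decay.
Variable R : realType.
Local Notation C := (R[i]).

Lemma normc_ge_normRe (x : C) : `|complex.Re x| <= normc x.
Proof. by case: x => a b /=; rewrite -sqrtr_sqr; apply: ler_wsqrtr; rewrite lerDl sqr_ge0. Qed.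

(** An imaginary shift leaves real parts unchanged, so the factors other than j are bounded by
    [|Re a_i|^-1], while factor j decays. *)
Lemma vanishing_prod_inv m (a : 'I_m -> C) (b : 'I_m -> R) (j : 'I_m) :
  (forall i, complex.Re (a i) != 0) -> b j != 0 ->
  vanishing (fun s => \prod_i - (a i + 0 +i* (s * b i))^-1).
Proof.
move=> a0 bj; pose v s := \prod_(i | i != j) - (a i + 0 +i* (s * b i))^-1.
have vK s : normc (v s) <= \prod_(i | i != j) `|complex.Re (a i)|^-1.
  rewrite /v (big_morph _ (@normcM R) (@normc1 R)); apply: ler_prod => i _.
  rewrite normc_ge0 normcN normcV lef_pV2 ?posrE ?normr_gt0//.
    by apply: le_trans (normc_ge_normRe _); case: (a i) => x y /=; rewrite addr0.
  rewrite (lt_le_trans _ (normc_ge_normRe _))//.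
  by have := a0 i; case: (a i) => x y /=; rewrite addr0 normr_gt0.
apply: eq_vanishing (vanishingM vK (vanishing_inv (a j) bj)) => s.
by rewrite [RHS](bigD1 j)//= mulrC.
Qed.

End product_decay.

(** * Grouping facets by hyperplane, and behaviour along an imaginary ray *)

Section forward.
Variables (R : realType) (n : nat).
Local Notation C := (R[i]^o).
Variables (s : seq (R * wedge_data R n.+1)).
Implicit Types (x y : facet_index s).
Local Notation w i := (tnth (in_tuple s) i).2.
Local Notation cplx M := (map_mx (real_complex R) M).

(** Facets are grouped by proportionality of (normal, offset). Each class consists of the facets in
    one hyperplane, with unit normal nu say, and contributes <nu, v> times a plane transform. *)
Lemma facet_sum_eq0 (z : 'rV[C]_n.+1) (v : 'rV[R]_n.+1) :
  (forall nu c, dotp nu nu = 1 -> plane_transform s nu c z = 0) ->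
  \sum_(x : facet_index s) (dotp (facet_normal x) v)%:C * facet_term x z = 0.
Proof.
move=> h.
pose prop x y := `[< exists la : R, [/\ la != 0, facet_normal x = la *: facet_normal y &
   facet_offset x = la * facet_offset y] >].
have prefl x : prop x x by apply/asboolP; exists 1; rewrite oner_neq0 scale1r mul1r.
have psym x y : prop x y -> prop y x.
  move/asboolP => [la [la0 e1 e2]]; apply/asboolP; exists la^-1.
  by rewrite invr_neq0// e1 e2 scalerA mulrA mulVf// scale1r mul1r.
have ptrans x y u : prop x y -> prop y u -> prop x u.
  move=> /asboolP[la [la0 e1 e2]] /asboolP[mu [mu0 f1 f2]]; apply/asboolP.
  by exists (la * mu); rewrite mulf_neq0// e1 e2 f1 f2 scalerA mulrA.
(* The class of x as a finite set is the key by which the sum is partitioned. *)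
pose K x := finset (prop x).
rewrite (partition_big K predT)//=; apply: big1 => S _.
have [x0 /eqP Kx0|none] := pickP (fun x => K x == S); last by rewrite big_pred0.
have KP x : (K x == S) = prop x x0.
  rewrite -Kx0; apply/eqP/idP => [e|xx0].
    have : x0 \in K x0 by rewrite inE.
    by rewrite -e inE.
  apply/setP => y; rewrite !inE; apply/idP/idP; last exact: ptrans.
  by apply: ptrans; exact: psym.
pose a := facet_normal x0; pose r := (enorm a)^-1.
have an : enorm a ^+ 2 = dotp a a by rewrite sqr_sqrtr ?dotp_ge0.
have a0 : dotp a a != 0 by rewrite dotpp_eq0 facet_normal_neq0.
have e0 : enorm a != 0 by apply: contra_neq a0 => e; rewrite -an e expr0n.
pose nu := r *: a; pose c := r * facet_offset x0.
have nunu : dotp nu nu = 1.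
  by rewrite dotpZl dotpZr mulrA -expr2 exprVn an mulVf.
have inP x : prop x x0 = in_plane nu c x.
  apply/asboolP/andP => [[la [la0 e1 e2]]|[/eqP e1 /eqP e2]].
    have E : dotp (facet_normal x) nu = la / r.
      by rewrite e1 -[facet_normal x0]/a -[a in LHS](scalerK (invr_neq0 e0)) -/nu scalerA dotpZl nunu mulr1.
    by rewrite /= E /nu /c e1 e2 scalerA mulrA divfK ?invr_neq0.
  exists (dotp (facet_normal x) nu * r); rewrite -scalerA -mulrA; split=> //.
  rewrite mulf_neq0 ?invr_neq0//; apply: contraNneq (facet_normal_neq0 x) => l0.
  by rewrite [facet_normal x]e1 /= l0 scale0r.
have := h nu c nunu; rewrite /plane_transform => /(congr1 (fun u => (dotp nu v)%:C * u)).
rewrite mulr0 mulr_sumr => e; rewrite -[RHS]e.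
rewrite (eq_bigl _ _ (fun x => etrans (KP x) (inP x))).
apply: eq_bigr => x /andP[/eqP /= xE _]; rewrite [RHS]mulrA -rmorphM /=; congr (_%:C * _).
by rewrite {1}xE dotpZl mulrC.
Qed.

Variables (nu : 'rV[R]_n.+1) (z0 : 'rV[C]_n.+1).
Hypotheses (nunu : dotp nu nu = 1) (gz0 : generic_point s z0).

Definition ray (t : R) : 'rV[C]_n.+1 := z0 + (0 +i* t) *: cplx nu.

Lemma cdotp_ray t v : cdotp (ray t) v = cdotp z0 v + 0 +i* (t * dotp nu v).
Proof.
rewrite /ray cdotpD cdotpZ; congr (_ + _).
have -> : cplx nu = cplx_row nu by apply/rowP => i; rewrite !mxE.
by rewrite cdotp_cplx; simpc.
Qed.

Lemma generic_ray t : generic_point s (ray t).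
Proof. by move=> x; rewrite cdotp_ray raddfD /= addr0; exact: gz0. Qed.

Definition parallel x : bool := facet_normal x == dotp (facet_normal x) nu *: nu.

Lemma cexp_ray t v : cexp (cdotp (ray t) v) = wave (dotp nu v) t * cexp (cdotp z0 v).
Proof. by rewrite cdotp_ray cexpD mulrC mulrC /wave [t * _]mulrC mulrC. Qed.

(** The quotient is the c for which the facet lies in {<nu, x> = c}. The remaining generators are
    orthogonal to nu, so only the exponential changes along the ray. *)
Lemma facet_term_parallel x t : parallel x ->
  facet_term x (ray t) =
  wave (facet_offset x / dotp (facet_normal x) nu) t * facet_term x z0.
Proof.
move=> px; have xE := eqP px.
have l0 : dotp (facet_normal x) nu != 0.
  by apply: contraNneq (facet_normal_neq0 x) => l0; rewrite xE l0 scale0r.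
have hx : in_plane nu (facet_offset x / dotp (facet_normal x) nu) x.
  by rewrite /in_plane /same_plane /= -/(parallel x) px /= mulrC divfK.
rewrite /facet_term [RHS]mulrCA; congr (_ * _); rewrite /facet_factor.
case: (_ == n.+1); last by rewrite mulr0.
rewrite cexp_ray [dotp nu _]dotpC (apex_in_plane hx) -!mulrA; congr (_ * (_ * (_ * _))).
apply: eq_bigr => k _; congr (- _^-1); rewrite cdotp_ray [dotp nu _]dotpC.
rewrite (dual_orthogonal_plane hx) ?mulr0; last by rewrite eq_sym neq_lift.
by rewrite -[RHS]addr0.
Qed.

(** If all generators other than k were orthogonal to nu, expanding nu in the rows would leave only
    row k, making it parallel to nu. So some remaining reciprocal decays along the ray. *)
Lemma facet_factor_decay (u : wedge_data R n.+1) (k : 'I_(wedge_size u)) :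
  (forall j, complex.Re (cdotp z0 (row j (dual_rows (wedge_normals u)))) != 0) ->
  row k (wedge_normals u) != dotp (row k (wedge_normals u)) nu *: nu ->
  vanishing (fun t => facet_factor k (ray t)).
Proof.
rewrite /facet_factor; case: u k => m A b fA /= k gen npar.
have [mn|_] := eqVneq m n.+1; last exact: vanishing0.
subst m; have AW := dual_rowsP fA; set W := dual_rows A in gen AW *.
have [j bj] : exists j : 'I_n, dotp nu (row (lift k j) W) != 0.
  apply: contrapT => /forallNP h; move/eqP: npar; apply.
  have nuE : nu = dotp nu (row k W) *: row k A.
    rewrite -[LHS]mulmx1 -(mulmx1C AW) mulmxA mulmx_sum_row (bigD1_ord k) //=.
    rewrite big1 ?addr0 => [|i _]; first by rewrite -dotp_rowE dotpC.
    by rewrite -dotp_rowE dotpC; have /negP := h i; rewrite negbK => /eqP ->; rewrite scale0r.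
  move: nuE; set mu := dotp nu _ => nuE.
  have mu0 : mu != 0.
    by apply: contra_eq_neq nunu => m0; rewrite nuE m0 scale0r dotp0l eq_sym oner_neq0.
  have aE : row k A = mu^-1 *: nu by rewrite [in RHS]nuE scalerA mulVf// scale1r.
  by rewrite aE dotpZl nunu mulr1.
have K t : normc (cexp (cdotp (ray t) (b *m W)) * (gram_volume W)%:C) <=
    normc (cexp (cdotp z0 (b *m W)) * (gram_volume W)%:C).
  by rewrite cexp_ray -mulrA normcM normc_wave mul1r.
have gen' (i : 'I_n) : complex.Re (cdotp z0 (row (lift k i) W)) != 0 by exact: gen.
have V := @vanishing_prod_inv _ _ (fun i => cdotp z0 (row (lift k i) W))
  (fun i => dotp nu (row (lift k i) W)) j gen' bj.
apply: eq_vanishing (vanishingM K V) => t.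
rewrite -!mulrA; congr (_ * (_ * _)); apply: eq_bigr => i _.
by rewrite cdotp_ray.
Qed.

Lemma facet_term_decay x : ~~ parallel x -> vanishing (fun t => facet_term x (ray t)).
Proof.
move=> npx; apply: vanishingZ; apply: facet_factor_decay => // j.
exact: (gz0 (Tagged (fun i => 'I_(wedge_size (w i))) j)).
Qed.

Lemma plane_transform_ray_eq0 c :
  (forall z, generic_point s z -> comb_transform s z = 0) -> plane_transform s nu c z0 = 0.
Proof.
move=> h.
have sum0 t : \sum_(x : facet_index s) (dotp (facet_normal x) nu)%:C * facet_term x (ray t) = 0.
  apply/eqP; rewrite -oppr_eq0 -divergence_identity; last exact: generic_ray.
  by rewrite h ?mulr0//; exact: generic_ray.
have van : vanishing (fun t => \sum_(x <- [seq x <- enum (facet_index s) | parallel x])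
    (dotp (facet_normal x) nu)%:C * facet_term x z0 *
    wave (facet_offset x / dotp (facet_normal x) nu) t).
  have vn : vanishing (fun t => - 1 * \sum_(x | ~~ parallel x)
      (dotp (facet_normal x) nu)%:C * facet_term x (ray t)).
    apply: vanishingZ; apply: vanishing_sum => x npx; apply: vanishingZ.
    exact: facet_term_decay.
  apply: eq_vanishing vn => t; rewrite mulN1r; apply/eqP; rewrite eq_sym -addr_eq0.
  rewrite -[X in _ == X](sum0 t) [X in _ == X](bigID parallel) /=; apply/eqP; congr (_ + _).
  rewrite big_filter big_enum_cond /=; apply: eq_bigr => x px.
  by rewrite facet_term_parallel// mulrA mulrAC.
have := @almost_periodic _ _ _ _ _ c van; rewrite big_filter_cond big_enum_cond => e.
rewrite -[RHS]e /plane_transform; apply: eq_bigl => x /=.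
rewrite /in_plane /same_plane /= -/(parallel x); case px : (parallel x) => //=.
have l0 : dotp (facet_normal x) nu != 0.
  apply: contraNneq (facet_normal_neq0 x) => l0.
  by rewrite (eqP px) l0 scale0r.
by apply/eqP/eqP => [->|<-]; [rewrite mulrAC divff// mul1r|rewrite mulrC divfK].
Qed.

End forward.

(** * Vanishing on a hyperplane and in the ambient space *)

Section plane_vanishing.
Variables (R : realType) (n : nat).
Local Notation C := (R[i]^o).
Variables (s : seq (R * wedge_data R n.+1)).
Variables (nu q : 'rV[R]_n.+1) (c : R) (F : 'M[R]_(n, n.+1)).
Hypotheses (FF : F *m F^T = 1%:M) (Fnu : F *m nu^T = 0) (nunu : dotp nu nu = 1)
           (nuq : dotp nu q = c).
Local Notation cplx M := (map_mx (real_complex R) M).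

Lemma section_transform_zero (r : seq (R * wedge_data R n)) :
  (forall z : 'rV[C]_n, comb_transform r z =
     cexp (- cdotp (z *m cplx F) q) * plane_transform s nu c (z *m cplx F)) ->
  agree setT (comb_transform r) (fun=> 0) <->
  (forall z : 'rV[C]_n, section_generic s nu F z -> plane_transform s nu c (z *m cplx F) = 0).
Proof.
move=> rE; have [oG dG] := section_generic_open_dense s FF Fnu nunu.
split=> [[D [oD dD E]] z gz|h].
  apply: (@dense_eq0 _ _ D (fun y => plane_transform s nu c (y *m cplx F)) z oD dD) => [y Dy|].
  2: exact: plane_transform_continuous.
  have /eqP := E y Dy Logic.I; rewrite rE mulf_eq0 (negbTE (cexp_neq0 _)).
  by move/eqP.
apply: (agree_dense oG dG); apply: agree_eq => z gz.
by rewrite rE h// mulr0.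
Qed.

Lemma plane_transform_of_section (z : 'rV[C]_n.+1) : generic_point s z ->
  (forall y : 'rV[C]_n, section_generic s nu F y -> plane_transform s nu c (y *m cplx F) = 0) ->
  plane_transform s nu c z = 0.
Proof.
move=> gz h; rewrite (plane_transform_shift s c FF Fnu nunu) h ?mulr0// => x wnu.
rewrite cdotp_adjoint (cdotp_proj FF Fnu nunu) wnu mul0r subr0.
exact: gz.
Qed.

(** The point y F has no component along nu and need not be generic in the ambient space. A large
    real multiple of nu is added to make it so; by the shift formula this only multiplies the plane
    transform by an exponential. *)
Lemma section_of_plane_transform :
  (forall z, generic_point s z -> plane_transform s nu c z = 0) ->
  forall y : 'rV[C]_n, section_generic s nu F y -> plane_transform s nu c (y *m cplx F) = 0.
Proof.
(* Each exceptional value of t is minus one of these quotients, so t exceeds them all in modulus.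
   Dual vectors orthogonal to nu add 0, as division by 0 gives 0; for them [gy] applies. *)
move=> h y gy; pose t : R := 1 + \sum_(x : facet_index s)
  `|complex.Re (cdotp (y *m cplx F) (dual_vector x)) / dotp nu (dual_vector x)|.
pose z : 'rV[C]_n.+1 := y *m cplx F + t%:C *: cplx nu.
have zE v : cdotp z v = cdotp (y *m cplx F) v + (t * dotp nu v)%:C.
  rewrite /z cdotpD cdotpZ; congr (_ + _).
  have -> : cplx nu = cplx_row nu by apply/rowP => i; rewrite !mxE.
  by rewrite cdotp_cplx -rmorphM.
have gz : generic_point s z.
  move=> x; rewrite zE raddfD /=; have [w0|w0] := eqVneq (dotp nu (dual_vector x)) 0.
    rewrite w0 mulr0 addr0 -cdotp_adjoint; apply: gy; by rewrite dotpC.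
  set a := complex.Re _; apply/eqP => /eqP; rewrite addr_eq0 => /eqP aE.
  have : `|a / dotp nu (dual_vector x)| < t.
    rewrite /t (bigD1 x)//= -/a addrA ltr_wpDr ?sumr_ge0// ltrDr ltr01//.
  rewrite aE mulNr mulfK// normrN => /(le_lt_trans (ler_norm t)).
  by rewrite ltxx.
have := h z gz; rewrite (plane_transform_shift s c FF Fnu nunu).
have -> : z *m cplx F^T *m cplx F = y *m cplx F.
  have FF' : cplx F *m cplx F^T = 1%:M by rewrite -map_mxM FF map_mx1.
  have nF : cplx nu *m cplx F^T = 0.
    by rewrite -map_mxM -[nu *m F^T]trmxK trmx_mul trmxK Fnu trmx0 map_mx0.
  by rewrite /z mulmxDl -mulmxA FF' mulmx1 -scalemxAl nF scaler0 addr0.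
by move/eqP; rewrite mulf_eq0 (negbTE (cexp_neq0 _)) => /eqP.
Qed.

End plane_vanishing.

Theorem theorem4 (R : realType)
    (FL : forall k : nat, ('rV[R]_k -> R) -> ('rV[R[i]^o]_k -> R[i]^o))
    (FL_spec : forall k : nat, is_Fourier_Laplace (FL k))
    (n : nat)
    (phi : oriented_hyperplane R n.+1 -> 'rV[R]_n -> 'rV[R]_n.+1)
    (phi_isometry : forall h : oriented_hyperplane R n.+1,
       isometric_identification h (phi h))
    (f : 'rV[R]_n.+1 -> R) (f_polyhedral : polyhedral_function f) :
  mero_zero (FL n.+1 f) <->
  (forall h : oriented_hyperplane R n.+1,
     mero_zero (FL n (signed_section f h (phi h)))).
Proof.
have [s fs] := polyhedral_in_span f_polyhedral.
have unit_normal (h : oriented_hyperplane R n.+1) : dotp (normal h) (normal h) = 1.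
  by have := congr1 (fun r => r ^+ 2) (normal_unit h); rewrite sqr_sqrtr ?dotp_ge0// expr1n.
(* Both vanishing conditions are brought to one and the same set of generic points, which is
   independent of h. *)
have fE : mero_zero (FL n.+1 f) <-> forall z, generic_point s z -> comb_transform s z = 0.
  have fT := FL_comb (FL_spec n.+1) fs.
  rewrite -comb_transform_zero /mero_zero mero_eqP.
  by split; apply: agree_trans; [exact: agree_sym|].
have hE h : mero_zero (FL n (signed_section f h (phi h))) <->
    forall z, generic_point s z -> plane_transform s (normal h) (offset h) z = 0.
  have [q [F [phiE FF Fnu nuq]]] := isometry_affine (phi_isometry h).
  have [r sr rE] := section_comb FF Fnu (unit_normal h) nuq (erefl _) (erefl _) phiE fs.
  have sT := FL_comb (FL_spec n) sr.
  have zE := section_transform_zero FF Fnu (unit_normal h) rE.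
  rewrite /mero_zero mero_eqP; split=> [zero|zero].
    move=> z gz; apply: (plane_transform_of_section FF Fnu (unit_normal h) gz).
    by apply/zE; exact: agree_trans (agree_sym sT) zero.
  apply: agree_trans sT _; apply/zE.
  exact: (section_of_plane_transform FF Fnu (unit_normal h) zero).
split=> [/fE zero h|zero].
  by apply/hE => z gz; exact: plane_transform_ray_eq0 (unit_normal h) gz _ zero.
apply/fE => z gz; apply: contrapT => /eqP z0.
(* A nonzero value requires a wedge with n + 1 rows. One of its dual vectors serves as v in the
   divergence identity: genericity gives <z, v> != 0. *)
have [i wi] : exists i, wedge_size (tnth (in_tuple s) i).2 = n.+1.
  apply: contrapT => /forallNP h; move/eqP: z0; apply.
  rewrite comb_transformE big1// => i _; rewrite /wedge_transform.
  by case: eqP => [/h|]; rewrite ?mulr0.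
have k : 'I_(wedge_size (tnth (in_tuple s) i).2) by rewrite wi; exact: ord0.
pose x : facet_index s := Tagged (fun i => 'I_(wedge_size (tnth (in_tuple s) i).2)) k.
have := divergence_identity (dual_vector x) gz.
rewrite facet_sum_eq0 ?oppr0 => [/eqP|nu c nunu].
  rewrite mulf_eq0 (negbTE z0) orbF => /eqP e.
  by have := gz x; rewrite e eqxx.
have nu1 : enorm nu = 1 by rewrite /enorm nunu sqrtr1.
exact: ((hE (OrientedHyperplane c nu1)).1 (zero _) z gz).
Qed.
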